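(* Let $\mathfrak g$ be a $2$-step nilpotent real Lie algebra of dimension $7$ whose commutator $\mathfrak g'=[\mathfrak g,\mathfrak g]$ has dimension $2$ or $3$. Let $\varphi$ be a coclosed $\mathrm G_2$-structure on $\mathfrak g$, let $\lambda\in\mathbb R$, and let $\nabla^\lambda$ be the connection defined by $\varphi$ and $\lambda$. The connection $\nabla^\lambda$ is a $\mathrm G_2$-instanton if and only if $\dim\mathfrak g'=3$ and the following conditions hold: (1) $\lambda=1$; (2) there exists an orthonormal basis $\{e_1,\dots,e_7\}$ of $\mathfrak g$ such that $\mathfrak g'=\langle e_5,e_6,e_7\rangle$, $\varphi=e^{127}+e^{347}+e^{567}+e^{135}-e^{146}-e^{236}-e^{245}$ and, for some real $\mu\ne0$, $$(de^{i+4})^+=\frac\mu3\sigma_i^+,\qquad i=1,2,3;$$ (3) (with the same $\mu$) the map $j:\mathfrak g'\to\mathfrak{so}(\mathfrak r)$ satisfies $$[j(z),j(z')]=\frac23\,\mu\, j(\tau(z)z')\qquad\text{for all }z,z'\in\mathfrak g',$$ where, for $z\in\mathfrak g'$, $\tau(z)\in\mathfrak{so}(\mathfrak g')$ is the endomorphism corresponding to $z\lrcorner(\varphi|_{\mathfrak g'})$, i.e. $g(\tau(z)z',z'')=\varphi(z,z',z'')$ for all $z',z''\in\mathfrak g'$.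
   Context: Notation: $e^{ij\cdots}=e^i\wedge e^j\wedge\cdots$, $\{e^i\}$ dual to $\{e_i\}$; $d$ is the Chevalley–Eilenberg differential, $d\xi(x,y)=-\xi([x,y])$. $2$-step nilpotent means $[\mathfrak g,\mathfrak g]\ne0$, $[\mathfrak g,[\mathfrak g,\mathfrak g]]=0$. A $\mathrm G_2$-structure on $\mathfrak g$ is $\varphi\in\Lambda^3\mathfrak g^*$ that in some basis of $\mathfrak g^*$ equals $e^{127}+e^{347}+e^{567}+e^{135}-e^{146}-e^{236}-e^{245}$. It determines an inner product $g$ and volume form by $(x\lrcorner\varphi)\wedge(y\lrcorner\varphi)\wedge\varphi=6g(x,y)\mathrm{vol}$ (such a basis is orthonormal and positively oriented), hence a Hodge star $\star$; put $\psi=\star\varphi$. $\varphi$ is coclosed if $d\psi=0$. The metric connection $\nabla^\lambda$ is defined by $g(\nabla^\lambda_xy,z)=g(\nabla^g_xy,z)+\frac\lambda2T(x,y,z)$, $x,y,z\in\mathfrak g$, where $\nabla^g$ is the Levi-Civita connection of the left-invariant metric $g$ on a Lie group with Lie algebra $\mathfrak g$ and $T=\frac16\star(d\varphi\wedge\varphi)\varphi-\star d\varphi$. Its curvature is $R^\lambda_{x,y}=[\nabla^\lambda_x,\nabla^\lambda_y]-\nabla^\lambda_{[x,y]}$, and it is a $\mathrm G_2$-instanton if $R^\lambda\wedge\psi=0$, i.e. for all $u,v$ the 2-form $(x,y)\mapsto g(R^\lambda_{x,y}u,v)$ wedged with $\psi$ vanishes. $\mathfrak r=(\mathfrak g')^\perp$,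 and $j:\mathfrak g'\to\mathfrak{so}(\mathfrak r)$ is defined by $g(j(z)x,y)=g(z,[x,y])$ for $x,y\in\mathfrak r$. For a basis as in (2), $de^5,de^6,de^7\in\Lambda^2\mathfrak r^*$, and for $\alpha\in\Lambda^2\mathfrak r^*$, $\alpha^+$ denotes its self-dual part with respect to the orientation $e^{1234}$ of $\mathfrak r=\langle e_1,\dots,e_4\rangle$. The self-dual forms $\sigma_i^+$ are $\sigma_1^+=e^{13}-e^{24}$, $\sigma_2^+=-e^{14}-e^{23}$, $\sigma_3^+=e^{12}+e^{34}$. *)

(* Defs.v *)
From HB Require Import structures.
From mathcomp Require Import all_boot all_order all_fingroup all_algebra.
From mathcomp Require Import reals.

Set Implicit Arguments.
Unset Strict Implicit.
Unset Printing Implicit Defensive.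

Import Order.TTheory GRing.Theory Num.Theory.
Local Open Scope ring_scope.

(* A k-form is represented by its function of k vectors; every form that the
   operations below are applied to is multilinear and alternating. *)
Definition kform (R : fieldType) (V : vectType R) (k : nat) : Type :=
  k.-tuple V -> R.

Section Forms.
Variables (R : fieldType) (V : vectType R).

(* Normalized so that (a /\ b)(x, y) = a(x) b(y) - a(y) b(x) for 1-forms. *)
Definition wedge k l (a : kform V k) (b : kform V l) : kform V (k + l) := fun v =>
  (k`! * l`!)%:R^-1 *
  \sum_(s : 'S_(k + l)) (-1) ^+ s
    * a [tuple tnth v (s (lshift l i)) | i < k]
    * b [tuple tnth v (s (rshift k j)) | j < l].

(* f_0 /\ ... /\ f_(k-1) for linear functionals f_i, in the normalization of
   [wedge]. *)
Definition wedge1 k (f : 'I_k -> V -> R) : kform V k := fun v =>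
  \det (\matrix_(i, j) f i (tnth v j)).

Definition contraction k (x : V) (a : kform V k.+1) : kform V k := fun v =>
  a [tuple of x :: v].

Definition restrictf (U : {vspace V}) k (a : kform V k) : kform (subvs_of U) k :=
  fun v => a [tuple vsval (tnth v i) | i < k].

(* The scalar c such that a = c vol, when n = dim V and vol != 0. It is read off
   on a basis of V, whose choice does not matter since top forms are
   proportional. *)
Definition top_coef n (vol a : kform V n) : R :=
  let b := [tuple (vbasis {:V})`_i | i < n] in a b / vol b.

(* (star a)(v_1, ..., v_l) vol = a /\ g(v_1, -) /\ ... /\ g(v_l, -), which is
   equivalent to b /\ star a = <b, a>_g vol for all b of the same degree as a. *)
Definition hodge (g : V -> V -> R) k l (vol : kform V (k + l)) (a : kform V k) :
    kform V l := fun v =>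
  top_coef vol (wedge a (wedge1 (fun i => g (tnth v i)))).

(* Self-dual part of a 2-form in dimension 4. *)
Definition self_dual_part (g : V -> V -> R) (vol : kform V 4) (a : kform V 2) :
    kform V 2 := fun v =>
  2^-1 * (a v + hodge g (k := 2) (l := 2) vol a v).

(* The indices are those of the literature: e^{i j ...} with 1 <= i, j, ... <= 7
   for a basis (e_1, ..., e_7). *)
Definition eform (e : 7.-tuple V) k (I : k.-tuple nat) : kform V k :=
  wedge1 (fun a => coord e (inord (tnth I a).-1)).

Definition g2_model (e : 7.-tuple V) : kform V 3 :=
  eform e [tuple 1; 2; 7]%N \+ eform e [tuple 3; 4; 7]%N
  \+ eform e [tuple 5; 6; 7]%N \+ eform e [tuple 1; 3; 5]%N
  \- eform e [tuple 1; 4; 6]%N \- eform e [tuple 2; 3; 6]%N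
  \- eform e [tuple 2; 4; 5]%N.

(* sigma_1^+, sigma_2^+ and sigma_3^+; the value for other indices is junk. *)
Definition sigma_plus (e : 7.-tuple V) (i : nat) : kform V 2 :=
  match i with
  | 1 => eform e [tuple 1; 3]%N \- eform e [tuple 2; 4]%N
  | 2 => fun v => - eform e [tuple 1; 4]%N v - eform e [tuple 2; 3]%N v
  | 3 => eform e [tuple 1; 2]%N \+ eform e [tuple 3; 4]%N
  | _ => fun=> 0
  end.

End Forms.

Section LieAlgebra.
Variables (R : fieldType) (V : vectType R) (br : {bilinear V -> V -> V}).

Definition lie_bracket : Prop :=
  (forall x, br x x = 0) /\
  (forall x y z, br x (br y z) + br y (br z x) + br z (br x y) = 0).

Definition bracketv (U W : {vspace V}) : {vspace V} :=
  <<allpairs br (vbasis U) (vbasis W)>>%VS.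

Definition derivedv : {vspace V} := bracketv fullv fullv.

Definition two_step_nilpotent : Prop :=
  derivedv <> 0%VS /\ bracketv fullv derivedv = 0%VS.

(* Chevalley-Eilenberg differential:
   (d a)(v_0, ..., v_(k+1)) = \sum_(i < j) (-1)^(i + j)
       a([v_i, v_j], v_0, ..., v_i omitted, ..., v_j omitted, ..., v_(k+1));
   here i ranges over 'I_k.+1 and lift j i is the index i, as i < j. *)
Definition ce_diff k (a : kform V k.+1) : kform V k.+2 := fun v =>
  \sum_(j < k.+2) \sum_(i < k.+1 | (i < j)%N) (-1) ^+ (i + j) *
    a [tuple of br (tnth v (lift j i)) (tnth v j)
         :: [tuple tnth v (lift j (lift i h)) | h < k]].

Definition curvature (D : V -> V -> V) (x y u : V) : V :=
  D x (D y u) - D y (D x u) - D (br x y) u.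

End LieAlgebra.

Section Metric.
Variables (R : numFieldType) (V : vectType R).
Variables (br : {bilinear V -> V -> V}) (g : {dot V for idfun}).

Definition orthonormal_basis n (e : n.-tuple V) : Prop :=
  basis_of {:V} e /\ orthonormal g e.

(* On left-invariant vector fields: metric and torsion-free. *)
Definition levi_civita (D : {bilinear V -> V -> V}) : Prop :=
  (forall x y z, g (D x y) z + g y (D x z) = 0) /\
  (forall x y, D x y - D y x = br x y).

Definition orth_derivedv : {vspace V} := orthov g (derivedv br).

End Metric.

Section G2.
Variables (R : numFieldType) (V : vectType R).
Implicit Types (br : {bilinear V -> V -> V}) (g : {dot V for idfun}).
Implicit Types (phi : kform V 3) (vol : kform V 7).

Definition g2_structure phi : Prop :=
  exists2 e : 7.-tuple V, basis_of {:V} e & phi =1 g2_model e.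

(* g and vol are the inner product and the volume form of phi. The identity
   determines the pair up to (t g, t^-1 vol); that vol is the volume form of an
   orientation and of the metric g itself fixes t = 1. *)
Definition g2_metric phi g vol : Prop :=
  (exists2 b : 7.-tuple V, orthonormal_basis g b &
     vol =1 eform b [tuple 1; 2; 3; 4; 5; 6; 7]%N) /\
  (forall x y v,
     wedge (wedge (contraction x phi) (contraction y phi)) phi v
     = 6 * g x y * vol v).

Definition g2_psi phi g vol : kform V 4 := hodge g (k := 3) (l := 4) vol phi.

Definition coclosed br phi g vol : Prop :=
  forall v, ce_diff br (g2_psi phi g vol) v = 0.

(* T = (1/6) star(d phi /\ phi) phi - star(d phi), where star(d phi /\ phi) is a
   0-form. *)
Definition g2_torsion br phi g vol : kform V 3 := fun v =>
  6^-1 * hodge g (k := 7) (l := 0) vol (wedge (ce_diff br phi) phi) [tuple]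
    * phi v
  - hodge g (k := 4) (l := 3) vol (ce_diff br phi) v.

Definition lambda_connection br phi g vol (lambda : R)
    (D Dl : V -> V -> V) : Prop :=
  forall x y z,
    g (Dl x y) z
    = g (D x y) z + lambda / 2 * g2_torsion br phi g vol [tuple x; y; z].

Definition g2_instanton br phi g vol (Dl : V -> V -> V) : Prop :=
  forall (u w : V) v,
    wedge (fun xy : 2.-tuple V =>
             g (curvature br Dl (tnth xy ord0) (tnth xy ord_max) u) w)
          (g2_psi phi g vol) v = 0.

(* j : g' -> so(r), where r is the orthogonal of g'. *)
Definition is_j br g
    (j : subvs_of (derivedv br) -> 'End(subvs_of (orth_derivedv br g))) : Prop :=
  forall z (x y : subvs_of (orth_derivedv br g)),
    g (vsval (j z x)) (vsval y) = g (vsval z) (br (vsval x) (vsval y)).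

(* tau : g' -> so(g'). *)
Definition is_tau br phi g
    (tau : subvs_of (derivedv br) -> 'End(subvs_of (derivedv br))) : Prop :=
  forall z z' z'' : subvs_of (derivedv br),
    g (vsval (tau z z')) (vsval z'')
    = phi [tuple vsval z; vsval z'; vsval z''].

(* (de^{i+4})^+ = (mu/3) sigma_i^+ for i = 1, 2, 3, as 2-forms on r with the
   orientation e^{1234}. *)
Definition self_dual_condition br g (e : 7.-tuple V) (mu : R) : Prop :=
  let r := orth_derivedv br g in
  forall i : nat, (1 <= i <= 3)%N -> forall v : 2.-tuple (subvs_of r),
    self_dual_part (fun x y => g (vsval x) (vsval y))
      (restrictf (U := r) (eform e [tuple 1; 2; 3; 4]%N))
      (restrictf (ce_diff br (eform e [tuple i + 4]%N))) v
    = mu / 3 * restrictf (sigma_plus e i) v.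

End G2.

(* Main.v *)
Require Import Defs.
From HB Require Import structures.
From mathcomp Require Import all_boot all_order all_fingroup all_algebra.
From mathcomp Require Import reals.
From mathcomp Require Import ring lra zify.

(** The statement is a computation in an adapted basis e_1, ..., e_7, once the basis is well
    chosen with respect to the commutator g'.

    The cross product u x v of phi satisfies |a x y|^2 = |a|^2 |y|^2 - g(a, y)^2, and this makes
    the first three vectors of an adapted basis free: any orthonormal u, v and any unit vector x
    that is orthogonal to u, v and u x v are e_5, e_6 and e_1 of an adapted basis with e_7 = u x v
    ([adapted_basis]). Hence g' is <e_5, e_6> in dimension 2, and <e_5, e_6, C e_7 + Z e_1> with
    C^2 + Z^2 = 1 in dimension 3; it lies in an associative subspace, that is, one spanned by
    vectors u, v and u x v, in dimension 2 and for Z = 0. A basis in which phi is the model form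
    is automatically orthonormal and positive ([g2_basis_orthonormal]).

    The condition that a 2-form wedged with psi vanishes means that its contraction with phi
    vanishes. So the instanton equations are E(w, u, v) = 0, where E(w, u, v) is the sum over x <
    y of phi(e_x, e_y, e_w) g(R(e_x, e_y) e_u, e_v) ([instantonP]); they are quadratic in the
    structure constants.

    If Z <> 0, then d psi = 0 leaves a symmetric 3 x 3 matrix S of structure constants. Three
    contractions of E are polynomials in lambda, C, |S|^2 and the second symmetric function of S,
    and their vanishing forces S = 0 ([nc_zero]), so that the bracket would vanish.

    If Z = 0, or in dimension 2, the forms - de^5, - de^6, - de^7 have self-dual coordinates given
    by a 3 x 3 matrix x and anti-self-dual coordinates given by a 3 x 3 matrix y; in dimension 2
    the vector e_7 is central and the last rows vanish. The equation d psi = 0 says that x is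
    symmetric. Three contractions of E are linear combinations of |x|^2, |y|^2 and (tr x)^2, with
    polynomials in lambda as coefficients. They vanish together only if lambda = 1, unless the
    bracket is zero ([cal_dichotomy]), and at lambda = 1 one of them reads 3 |x|^2 = (tr x)^2, so
    that x = r id ([cal_scalar]). This is the self-duality condition with mu = - 3 r
    ([self_dual_conditionP]). Conversely, for lambda = 1 and x = r id the connection is trivial
    along the orthogonal complement of g', and E reduces to the relation between the brackets of j
    and the cross product of g' ([inst_diag], [j_relationP]). Finally r <> 0: for r = 0, which
    holds in dimension 2, that relation makes the three rows of y parallel, and all brackets would
    lie on a line ([ccal_rank1]). *)

Set Implicit Arguments.
Unset Strict Implicit.
Unset Printing Implicit Defensive.

Import Order.TTheory GRing.Theory Num.Theory.
Local Open Scope ring_scope.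

(** * Alternating forms *)
Section BlockPerm.
Variables (k l : nat) (p : 'S_k) (q : 'S_l).

Definition block_perm_fun (i : 'I_(k + l)) : 'I_(k + l) :=
  match split i with inl a => lshift l (p a) | inr b => rshift k (q b) end.

Lemma block_perm_inj : injective block_perm_fun.
Proof.
move=> i j; rewrite -[i]splitK -[j]splitK /block_perm_fun.
case: (split i) => a; case: (split j) => b;
  rewrite ?(unsplitK (inl _ _)) ?(unsplitK (inr _ _)) /=.
- by move/lshift_inj/perm_inj->.
- by move/eqP; rewrite eq_lrshift.
- by move/eqP; rewrite eq_rlshift.
- by move/rshift_inj/perm_inj->.
Qed.

(** The subgroup S_k x S_l of S_(k + l), along which the sum in [wedge] collapses. *)
Definition block_perm : 'S_(k + l) := perm block_perm_inj.

Lemma block_permL i : block_perm (lshift l i) = lshift l (p i).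
Proof. by rewrite permE /block_perm_fun (unsplitK (inl _ i)). Qed.

Lemma block_permR i : block_perm (rshift k i) = rshift k (q i).
Proof. by rewrite permE /block_perm_fun (unsplitK (inr _ i)). Qed.

(** Block permutation matrices are block triangular, so that multiplicativity of the sign is
    multiplicativity of the determinant. *)
Lemma sign_block_perm (R : comPzRingType) :
  (-1) ^+ block_perm = (-1) ^+ p * (-1) ^+ q :> R.
Proof.
rewrite -!det_perm -(det_ublock (perm_mx p) 0 (perm_mx q)).
congr (\det _); apply/matrixP => i j.
rewrite -[i]splitK -[j]splitK.
case: (split i) => a; case: (split j) => b /=;
  rewrite ?(block_mxEul, block_mxEur, block_mxEdl, block_mxEdr) !mxE
    ?(block_permL, block_permR) ?eq_lshift ?eq_rshift //.
- by rewrite eq_lrshift.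
- by rewrite eq_rlshift.
Qed.

End BlockPerm.

Section Forms.
Variables (R : numFieldType) (V : vectType R).

Definition cat_fun (T : Type) k l (f : 'I_k -> T) (h : 'I_l -> T) (i : 'I_(k + l)) : T :=
  match split i with inl a => f a | inr b => h b end.

Lemma cat_funL T k l (f : 'I_k -> T) (h : 'I_l -> T) i : cat_fun f h (lshift l i) = f i.
Proof. by rewrite /cat_fun (unsplitK (inl _ i)). Qed.

Lemma cat_funR T k l (f : 'I_k -> T) (h : 'I_l -> T) i : cat_fun f h (rshift k i) = h i.
Proof. by rewrite /cat_fun (unsplitK (inr _ i)). Qed.

Lemma fact_unit_neq0 k l : (k`! * l`!)%:R != 0 :> R.
Proof. by rewrite pnatr_eq0 -lt0n muln_gt0 !fact_gt0. Qed.

(** Expanding both determinants turns the left-hand side into a triple sum over s, p and q; for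
    fixed p and q the substitution that absorbs p and q into s gives the determinant of the
    concatenated family, and the k! l! pairs (p, q) cancel the normalization of [wedge]. *)
Lemma wedge_wedge1 k l (f : 'I_k -> V -> R) (h : 'I_l -> V -> R) :
  wedge (wedge1 f) (wedge1 h) =1 wedge1 (cat_fun f h).
Proof.
move=> v; rewrite /wedge.
set M := \matrix_(i, j) cat_fun f h i (tnth v j) : 'M_(k + l).
rewrite -[wedge1 (cat_fun f h) v]/(\det M).
apply: (mulfI (fact_unit_neq0 k l)); rewrite mulrA divff ?fact_unit_neq0 // mul1r.
pose F (s : 'S_(k + l)) (p : 'S_k) (q : 'S_l) : R :=
  (-1) ^+ (block_perm p q * s)%g * \prod_i M i ((block_perm p q * s)%g i).
transitivity (\sum_(s : 'S_(k + l)) \sum_(p : 'S_k) \sum_(q : 'S_l) F s p q).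
  apply: eq_bigr => s _; rewrite -mulrA [X in _ * X]mulr_suml mulr_sumr.
  apply: eq_bigr => p _; rewrite [X in _ * X]mulr_sumr mulr_sumr.
  apply: eq_bigr => q _; rewrite /F odd_permM signr_addb sign_block_perm.
  rewrite big_split_ord /= -!mulrA mulrCA; congr (_ * _).
  rewrite [RHS]mulrCA; congr (_ * _).
  rewrite mulrCA; congr (_ * _); congr (_ * _); apply: eq_bigr => i _;
  rewrite !mxE permM ?block_permL ?block_permR ?cat_funL ?cat_funR tnth_mktuple //.
rewrite exchange_big /=.
transitivity (\sum_(p : 'S_k) \sum_(q : 'S_l) \det M).
  apply: eq_bigr => p _; rewrite exchange_big /=; apply: eq_bigr => q _.
  by rewrite /determinant [RHS](reindex_inj (mulgI (block_perm p q))).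
have cst n (x : R) : \sum_(p : 'S_n) x = n`!%:R * x.
  by rewrite -card_Sn mulr_natl -sumr_const; apply: eq_bigl => u; rewrite inE.
by rewrite !cst mulrA -natrM.
Qed.

Lemma eq_wedge k l (a a' : kform V k) (b b' : kform V l) :
  a =1 a' -> b =1 b' -> wedge a b =1 wedge a' b'.
Proof. by move=> Ea Eb v; rewrite /wedge; congr (_ * _); apply: eq_bigr => s _; rewrite Ea Eb. Qed.

Lemma wedgeDl k l (a a' : kform V k) (b : kform V l) v :
  wedge (fun v => a v + a' v) b v = wedge a b v + wedge a' b v.
Proof.
rewrite /wedge -mulrDr -big_split; congr (_ * _); apply: eq_bigr => s _ /=.
by rewrite mulrDr mulrDl.
Qed.

Lemma wedgeZl k l c (a : kform V k) (b : kform V l) v :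
  wedge (fun v => c * a v) b v = c * wedge a b v.
Proof.
rewrite /wedge mulrCA; congr (_ * _); rewrite mulr_sumr; apply: eq_bigr => s _ /=.
by rewrite !mulrA; congr (_ * _ * _); rewrite mulrC.
Qed.

Lemma wedgeDr k l (a : kform V k) (b b' : kform V l) v :
  wedge a (fun v => b v + b' v) v = wedge a b v + wedge a b' v.
Proof.
rewrite /wedge -mulrDr -big_split; congr (_ * _); apply: eq_bigr => s _ /=.
by rewrite mulrDr.
Qed.

Lemma wedgeZr k l c (a : kform V k) (b : kform V l) v :
  wedge a (fun v => c * b v) v = c * wedge a b v.
Proof.
rewrite /wedge mulrCA; congr (_ * _); rewrite mulr_sumr; apply: eq_bigr => s _ /=.
by rewrite mulrCA.
Qed.

(** The linear span of the decomposable forms. Everything that is multilinear, such as [wedge] and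
    [hodge], can then be computed by induction on a decomposable form, where it becomes an identity
    between determinants. *)
Inductive alt_form k : kform V k -> Prop :=
| alt_wedge1 (f : 'I_k -> V -> R) of (forall i, scalar (f i)) : alt_form (wedge1 f)
| alt_comb c a b of alt_form a & alt_form b : alt_form (fun v => c * a v + b v)
| alt_zero : alt_form (fun=> 0)
| alt_ext a b of alt_form a & a =1 b : alt_form b.

Lemma alt_formD k (a b : kform V k) :
  alt_form a -> alt_form b -> alt_form (fun v => a v + b v).
Proof. by move=> Ha Hb; apply: alt_ext (alt_comb 1 Ha Hb) _ => v; rewrite mul1r. Qed.

Lemma alt_formZ k c (a : kform V k) : alt_form a -> alt_form (fun v => c * a v).
Proof. by move=> Ha; apply: alt_ext (alt_comb c Ha (alt_zero _)) _ => v; rewrite addr0. Qed.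

Lemma alt_formN k (a : kform V k) : alt_form a -> alt_form (fun v => - a v).
Proof. by move=> Ha; apply: alt_ext (alt_formZ (-1) Ha) _ => v; rewrite mulN1r. Qed.

Lemma alt_formB k (a b : kform V k) :
  alt_form a -> alt_form b -> alt_form (fun v => a v - b v).
Proof. by move=> Ha Hb; apply: alt_formD => //; apply: alt_formN. Qed.

Lemma alt_form_sum k I (r : seq I) (F : I -> kform V k) :
  (forall i, alt_form (F i)) -> alt_form (fun v => \sum_(i <- r) F i v).
Proof.
move=> HF; elim: r => [|i r IH].
  by apply: alt_ext (alt_zero _) _ => v; rewrite big_nil.
by apply: alt_ext (alt_formD (HF i) IH) _ => v; rewrite big_cons.
Qed.

Lemma wedge0l k l (b : kform V l) (v : (k + l).-tuple V) :
  wedge (fun _ : k.-tuple V => 0) b v = 0.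
Proof.
by rewrite /wedge big1 ?mulr0 // => s _; rewrite mulr0 mul0r.
Qed.

Lemma wedge0r k l (a : kform V k) (v : (k + l).-tuple V) :
  wedge a (fun _ : l.-tuple V => 0) v = 0.
Proof. by rewrite /wedge big1 ?mulr0 // => s _; rewrite mulr0. Qed.

Lemma alt_wedge k l (a : kform V k) (b : kform V l) :
  alt_form a -> alt_form b -> alt_form (wedge a b).
Proof.
move=> Ha Hb; elim: Ha => {a} [f Hf|c a a' _ IH _ IH'||a a' _ IH E].
- elim: Hb => {b} [h Hh|c b b' _ IH _ IH'||b b' _ IH E].
  + apply: alt_ext (fsym (wedge_wedge1 f h)); apply: alt_wedge1 => i.
    by rewrite /cat_fun; case: split.
  + by apply: alt_ext (alt_comb c IH IH') _ => v; rewrite wedgeDr wedgeZr.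
  + by apply: alt_ext (alt_zero _) _ => v; rewrite wedge0r.
  + by apply: alt_ext IH _; apply: eq_wedge.
- by apply: alt_ext (alt_comb c IH IH') _ => v; rewrite wedgeDl wedgeZl.
- by apply: alt_ext (alt_zero _) _ => v; rewrite wedge0l.
- by apply: alt_ext IH _; apply: eq_wedge.
Qed.

Lemma top_form_det n (e : n.-tuple V) (a : kform V n) v :
  basis_of {:V} e -> alt_form a ->
  a v = a e * \det (\matrix_(i, j) coord e i (tnth v j)).
Proof.
move=> eB; elim=> {a} [f Hf|c a b _ IHa _ IHb||a b _ IH E].
- rewrite /wedge1 -det_mulmx; congr (\det _); apply/matrixP => i j; rewrite !mxE.
  pose h : {scalar V} := HB.pack (f i) (GRing.isLinear.Build _ _ _ _ (f i) (Hf i)).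
  have {1}-> := coord_basis eB (memvf (tnth v j)).
  rewrite -[f i _]/(h _) linear_sum; apply: eq_bigr => m _.
  by rewrite linearZ /= !mxE mulrC -tnth_nth.
- by rewrite IHa IHb mulrDl mulrA.
- by rewrite mul0r.
- by rewrite -!E.
Qed.

(** Top forms are proportional, so any w on which vol does not vanish computes the coefficient. *)
Lemma top_coefE n (vol a : kform V n) (w : n.-tuple V) :
  \dim {:V} = n -> alt_form vol -> alt_form a -> vol w != 0 ->
  top_coef vol a = a w / vol w.
Proof.
move=> dimV Hvol Ha; rewrite /top_coef.
set b := [tuple _ | _ < _].
have bB : basis_of {:V} b.
  suff -> : tval b = vbasis {:V} by apply: vbasisP.
  apply: (@eq_from_nth _ 0); first by rewrite !size_tuple dimV.
  move=> i; rewrite size_tuple => ltin.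
  by rewrite -[i]/(val (Ordinal ltin)) -tnth_nth tnth_mktuple.
rewrite (top_form_det w bB Hvol) (top_form_det w bB Ha) mulf_eq0 negb_or.
by case/andP=> v0 d0; rewrite invfM mulrACA divff // mulr1.
Qed.

Section Hodge.
Variables (g : V -> V -> R) (k l : nat) (vol : kform V (k + l)).
Hypotheses (gl : forall x, scalar (g x)) (dimV : \dim {:V} = (k + l)%N).
Hypothesis vol_alt : alt_form vol.
Implicit Types (a : kform V k).

Lemma hodgeE a v w : alt_form a -> vol w != 0 ->
  hodge g vol a v = wedge a (wedge1 (fun i => g (tnth v i))) w / vol w.
Proof.
move=> Ha; apply: top_coefE => //; apply: alt_wedge => //.
by apply: alt_wedge1 => i.
Qed.

(** Wedging with the duals of an orthonormal family z leaves the component of the form on the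
    orthogonal vectors w: the determinant is block triangular with an identity block. All Hodge
    stars below are evaluated with this formula. *)
Lemma hodge_basis a (w : k.-tuple V) (z : l.-tuple V) :
  alt_form a -> vol [tuple of w ++ z] != 0 ->
  (forall i j, g (tnth z i) (tnth w j) = 0) ->
  (forall i j, g (tnth z i) (tnth z j) = (i == j)%:R) ->
  hodge g vol a z = a w / vol [tuple of w ++ z].
Proof.
move=> Ha vol0 zw zz; rewrite (hodgeE _ Ha vol0); congr (_ / _).
elim: Ha => {a} [f Hf|c a b _ IHa _ IHb||a b _ IH E].
- rewrite wedge_wedge1 /wedge1.
  set A := \matrix_(_, _) _.
  rewrite -[A]submxK.
  have -> : dlsubmx A = 0.
    by apply/matrixP=> i j; rewrite !mxE cat_funR tnth_lshift zw.
  have -> : drsubmx A = 1%:M.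
    by apply/matrixP=> i j; rewrite !mxE cat_funR tnth_rshift zz.
  rewrite det_ublock det1 mulr1; congr (\det _).
  by apply/matrixP=> i j; rewrite !mxE cat_funL tnth_lshift.
- by rewrite wedgeDl wedgeZl IHa IHb.
- by rewrite wedge0l.
- by rewrite -(eq_wedge E (frefl _)) IH E.
Qed.

End Hodge.

Lemma alt_form_perm k (a : kform V k) (v : k.-tuple V) (s : 'S_k) :
  alt_form a -> a [tuple tnth v (s i) | i < k] = (-1) ^+ s * a v.
Proof.
elim=> {a} [f Hf|c a b _ IHa _ IHb||a b _ IH E].
- rewrite /wedge1 -[s in RHS]invgK odd_permV mulrC -det_perm -det_mulmx -col_permE.
  by congr (\det _); apply/matrixP => i j; rewrite !mxE tnth_mktuple.
- by rewrite IHa IHb mulrDr mulrCA.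
- by rewrite mulr0.
- by rewrite -!E.
Qed.

Lemma alt_form_eq0 k (a : kform V k) (v : k.-tuple V) i j :
  alt_form a -> i != j -> tnth v i = tnth v j -> a v = 0.
Proof.
move=> Ha nij vij; elim: Ha => {a} [f Hf|c a b _ IHa _ IHb||a b _ IH E].
- rewrite /wedge1 -det_tr; apply: (determinant_alternate nij) => m.
  by rewrite !mxE vij.
- by rewrite IHa IHb mulr0 addr0.
- by [].
- by rewrite -E.
Qed.

Lemma alt_form_expand k n (e : n.-tuple V) (a : kform V k) v :
  basis_of {:V} e -> alt_form a ->
  a v = \sum_(f : {ffun 'I_k -> 'I_n})
    (\prod_i coord e (f i) (tnth v i)) * a [tuple tnth e (f i) | i < k].
Proof.
move=> eB; elim=> {a} [f Hf|c a b _ IHa _ IHb||a b _ IH E].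
- rewrite {1}/wedge1 -det_tr /determinant.
  under [RHS]eq_bigr => h _ do rewrite /wedge1 -det_tr /determinant mulr_sumr.
  rewrite exchange_big /=; apply: eq_bigr => s _.
  under [RHS]eq_bigr => h _ do rewrite mulrCA -big_split /=.
  rewrite -mulr_sumr; congr (_ * _).
  pose T i m := coord e m (tnth v i) * f (s i) (tnth e m).
  transitivity (\prod_i \sum_m T i m).
    apply: eq_bigr => i _; rewrite !mxE.
    pose h : {scalar V} :=
      HB.pack (f (s i)) (GRing.isLinear.Build _ _ _ _ (f (s i)) (Hf (s i))).
    have {1}-> := coord_basis eB (memvf (tnth v i)).
    rewrite -[f (s i) _]/(h _) linear_sum; apply: eq_bigr => m _.
    by rewrite linearZ /= -tnth_nth.
  rewrite bigA_distr_bigA; apply: eq_bigr => h _; apply: eq_bigr => i _.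
  by rewrite !mxE tnth_mktuple.
- rewrite IHa IHb mulr_sumr -big_split; apply: eq_bigr => h _ /=.
  by rewrite mulrDr mulrCA.
- by rewrite big1 // => h _; rewrite mulr0.
- by rewrite -E IH; apply: eq_bigr => h _; rewrite E.
Qed.

(** By multilinearity and antisymmetry the values on increasing tuples of basis vectors
    determine a form. *)
Lemma alt_form_eq_basis k n (e : n.-tuple V) (a b : kform V k) :
  basis_of {:V} e -> alt_form a -> alt_form b ->
  (forall f : k.-tuple 'I_n, sorted ltn (map val f) ->
     a [tuple tnth e (tnth f i) | i < k] = b [tuple tnth e (tnth f i) | i < k]) ->
  a =1 b.
Proof.
move=> eB Ha Hb ab v; apply/eqP; rewrite -subr_eq0; apply/eqP.
have Hc := alt_formB Ha Hb.
apply: etrans (alt_form_expand v eB Hc) _.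
apply: big1 => f _; set c := (X in _ * X); suff -> : c = 0 by rewrite mulr0.
rewrite {}/c.
have [/injectiveP finj|/injectivePn[i [j nij fij]]] := boolP (injectiveb f); last first.
  by apply: (alt_form_eq0 Hc nij); rewrite !tnth_mktuple fij.
pose t := sort_tuple (fun i j : 'I_n => leq i j) [tuple f i | i < k].
have /tuple_permP[s Es] : perm_eq t [tuple f i | i < k].
  by rewrite /= perm_sort.
have ft i : tnth t i = f (s i).
  by rewrite (tnth_nth (f i)) Es -tnth_nth !tnth_mktuple.
have st : sorted ltn (map val t).
  rewrite ltn_sorted_uniq_leq (map_inj_uniq val_inj) /= sort_uniq.
  rewrite (map_inj_uniq finj) enum_uniq /= sorted_map.
  by apply: sort_sorted => x y; apply: leq_total.
have := alt_form_perm [tuple tnth e (f i) | i < k] s Hc.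
have -> : [tuple tnth [tuple tnth e (f i) | i < k] (s i) | i < k]
     = [tuple tnth e (tnth t i) | i < k].
  by apply: eq_from_tnth => i; rewrite !tnth_mktuple ft.
rewrite ab // subrr => /esym/eqP; rewrite mulf_eq0 signr_eq0 => /= /eqP//.
Qed.

End Forms.

Section AltMore.
Variables (R : numFieldType) (V : vectType R).

Definition set_slot k (v : k.-tuple V) (i : 'I_k) (x : V) : k.-tuple V :=
  [tuple if j == i then x else tnth v j | j < k].

Lemma wedge1_tr k (f : 'I_k -> V -> R) (v : k.-tuple V) :
  wedge1 f v = \det (\matrix_(j, i) f i (tnth v j)).
Proof. by rewrite -det_tr; congr (\det _); apply/matrixP => i j; rewrite !mxE. Qed.

Lemma alt_form_slot k (a : kform V k) (v : k.-tuple V) i c x y :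
  alt_form a ->
  a (set_slot v i (c *: x + y)) = c * a (set_slot v i x) + a (set_slot v i y).
Proof.
elim=> {a} [f Hf|d a b _ IHa _ IHb||a b _ IH E].
- rewrite !wedge1_tr -[\det (\matrix_(j, l) f l (tnth (set_slot v i y) j))]mul1r.
  apply: (determinant_multilinear (i0 := i)).
  + by apply/matrixP => p q; rewrite !mxE !tnth_mktuple eqxx Hf mul1r.
  + apply/matrixP => p q; rewrite !mxE !tnth_mktuple.
    by rewrite eq_sym (negPf (neq_lift _ _)).
  + apply/matrixP => p q; rewrite !mxE !tnth_mktuple.
    by rewrite eq_sym (negPf (neq_lift _ _)).
- rewrite IHa IHb; rewrite !mulrDr !addrA !mulrA [c * d]mulrC; congr (_ + _).
  by rewrite -!addrA; congr (_ + _); rewrite addrC.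
- by rewrite mulr0 addr0.
- by rewrite -!E.
Qed.

(** For a fixed w with vol w <> 0, the star is a combination of the forms
    g(-, w_(s(k+1))) /\ ... /\ g(-, w_(s(k+l))). *)
Lemma alt_hodge (g : V -> V -> R) k l (vol : kform V (k + l)) (a : kform V k)
    (w : (k + l).-tuple V) :
  (forall x, scalar (g x)) -> (forall x, scalar (g^~ x)) ->
  \dim {:V} = (k + l)%N -> alt_form vol -> vol w != 0 -> alt_form a ->
  alt_form (hodge g vol a).
Proof.
move=> gr gl dimV Hvol vol0 Ha.
pose b (s : 'S_(k + l)) : kform V l :=
  wedge1 (fun j x => g x (tnth w (s (rshift k j)))).
have Hb s : alt_form (b s) by apply: alt_wedge1 => i.
have H : alt_form (fun v => (vol w)^-1 * ((k`! * l`!)%:R^-1 *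
    \sum_(s : 'S_(k + l)) (-1) ^+ s *
      a [tuple tnth w (s (lshift l i)) | i < k] * b s v)).
  apply/alt_formZ/alt_formZ/alt_form_sum => s; exact: alt_formZ.
apply: alt_ext H _ => v; rewrite (hodgeE gr dimV Hvol _ Ha vol0) mulrC.
congr (_ * _ * _); apply: eq_bigr => s _; congr (_ * _).
rewrite /b /wedge1 -[RHS]det_tr; congr (\det _); apply/matrixP=> i j.
by rewrite !mxE tnth_mktuple.
Qed.

End AltMore.

(** * Components on lists of basis indices *)

(** The generalized Kronecker symbol: the sign of the permutation that takes I to J, and 0 if there
    is no such permutation or more than one. It is written as a Laplace
    expansion so that it evaluates by computation. *)
Fixpoint eps (I J : seq nat) : int :=
  if I is i :: I' then
    foldr (fun p s => (if i == nth 0%N J p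
             then (-1) ^+ p * eps I' (take p J ++ drop p.+1 J) else 0) + s) 0
      (iota 0 (size J))
  else 1.

Lemma det_eps (R : comPzRingType) k (I J : seq nat) :
  size I = k -> size J = k ->
  \det (\matrix_(i < k, j < k) (nth 0%N I i == nth 0%N J j)%:R) = (eps I J)%:~R :> R.
Proof.
elim: k I J => [|k IH] [|i I] J //= sI sJ; first by rewrite det_mx00.
case: sI => sI.
rewrite (expand_det_row _ ord0) sJ.
pose F p : int := if i == nth 0%N J p
             then (-1) ^+ p * eps I (take p J ++ drop p.+1 J) else 0.
rewrite -[RHS]/((foldr (fun p s => F p + s) 0 (iota 0 k.+1))%:~R).
rewrite (_ : foldr _ _ _ = \sum_(p < k.+1) F p); last first.
  rewrite -(big_mkord predT) /index_iota subn0.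
  by elim: (iota _ _) => [|p s IHs]; rewrite ?big_nil ?big_cons //= IHs.
rewrite rmorph_sum; apply: eq_bigr => p _ /=; rewrite mxE /= /F.
case: eqP => [_|_]; last by rewrite mul0r.
rewrite mul1r /cofactor intrM intr_sign; congr (_ * _).
rewrite -IH //; last first.
  by rewrite size_cat size_take size_drop sJ ltn_ord /= subSS subnKC // -ltnS.
congr (\det _); apply/matrixP => a b; rewrite !mxE /=.
congr ((_ == _)%:R); rewrite nth_cat size_take sJ ltn_ord /bump.
have [ltbp|lepb] := ltnP b p; first by rewrite nth_take.
by rewrite nth_drop addSn subnKC.
Qed.

Fixpoint sublists (s : seq nat) : seq (seq nat) :=
  if s is x :: s' then map (cons x) (sublists s') ++ sublists s' else [:: [::]].

Lemma mem_sublists I s : subseq I s -> I \in sublists s.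
Proof.
elim: s I => [|x s IH] [|y I] //=; rewrite mem_cat.
  by rewrite IH ?orbT ?sub0seq.
case: eqP => [->|_] H; rewrite ?(map_f _ (IH _ H)) //.
by rewrite IH ?orbT.
Qed.

Definition subs k := [seq I <- sublists (iota 1 7) | size I == k].

Arguments subs k%_N.

Definition compl (I : seq nat) := [seq i <- iota 1 7 | i \notin I].

(** Basis indices run from 1 to 7, as in the literature, and are kept as natural numbers so that
    tables of components can be given by pattern matching. *)
Definition rng i := (0 < i <= 7)%N.

Lemma rng_iota i : rng i = (i \in iota 1 7).
Proof. by rewrite mem_iota. Qed.

Lemma sublists_sub I s : I \in sublists s -> {subset I <= s}.
Proof.
elim: s I => [|x s IH] I /=; first by rewrite inE => /eqP->.
rewrite mem_cat => /orP[/mapP[J /IH sJ ->]|/IH sI] y; rewrite !inE.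
  by case/orP=> [->//|/sJ->]; rewrite orbT.
by move/sI->; rewrite orbT.
Qed.

Lemma subs_rng k I : I \in subs k -> all rng I.
Proof.
rewrite mem_filter => /andP[_ /sublists_sub sI]; apply/allP => i /sI.
by rewrite rng_iota.
Qed.

Lemma subs_size k I : I \in subs k -> size I = k.
Proof. by rewrite mem_filter => /andP[/eqP]. Qed.

Lemma mem_subs k I : size I = k -> sorted ltn I -> all rng I -> I \in subs k.
Proof.
move=> sI oI /allP rI; rewrite mem_filter sI eqxx mem_sublists //.
have -> : I = [seq i <- iota 1 7 | i \in I].
  apply: (irr_sorted_eq ltn_trans ltnn) => // [|i].
    by apply: sorted_filter => //; apply: ltn_trans.
  rewrite mem_filter -rng_iota; case: (boolP (i \in I)) => // /rI ->//.
exact: filter_subseq.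
Qed.

Section Frame.
Variables (R : numFieldType) (V : vectType R) (e : 7.-tuple V).
Hypothesis eB : basis_of {:V} e.

Definition bv i : V := if i is i'.+1 then e`_i' else 0.
Definition bvs k (I : seq nat) : k.-tuple V := [tuple bv (nth 0%N I i) | i < k].
(** The form e^I of [eform], for a list of indices. *)
Definition cform k (I : seq nat) : kform V k :=
  wedge1 (fun a : 'I_k => coord e (inord (nth 0%N I a).-1)).

Arguments bvs k I : clear implicits.
Arguments cform k I : clear implicits.

Lemma bv_tnth (i : 'I_7) : bv i.+1 = tnth e i.
Proof. by rewrite (tnth_nth 0). Qed.

Lemma coord_bv i j : rng i -> rng j -> coord e (inord i.-1) (bv j) = (i == j)%:R.
Proof.
case: i j => [|i] [|j] //; rewrite /rng /= !ltnS => i7 j7.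
have {1}-> : j = nat_of_ord (Ordinal (j7 : (j < 7)%N)) by [].
by rewrite (coord_free _ _ (basis_free eB)) -val_eqE /= inordK // eqSS eq_sym.
Qed.

Lemma alt_cform k I : alt_form (cform k I).
Proof. by apply: alt_wedge1 => i; apply: linearP. Qed.

Lemma eformE k (I : k.-tuple nat) : eform e I =1 cform k I.
Proof.
move=> v; congr (\det _); apply/matrixP => i j.
by rewrite !mxE (tnth_nth 0%N).
Qed.

Lemma alt_eform k (I : k.-tuple nat) : alt_form (eform e I).
Proof. by apply: alt_ext (alt_cform k I) _; apply/fsym/eformE. Qed.

Lemma cform_bvs k I J :
  size I = k -> size J = k -> all rng I -> all rng J ->
  cform k I (bvs k J) = (eps I J)%:~R.
Proof.
move=> sI sJ /(all_nthP 0%N) rI /(all_nthP 0%N) rJ.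
rewrite -(det_eps _ sI sJ); congr (\det _); apply/matrixP => i j.
by rewrite !mxE tnth_mktuple coord_bv ?rI ?rJ ?sI ?sJ.
Qed.

Lemma alt_form_eq_subs k (a b : kform V k) :
  alt_form a -> alt_form b ->
  (forall I, I \in subs k -> a (bvs k I) = b (bvs k I)) -> a =1 b.
Proof.
move=> Ha Hb ab; apply: (alt_form_eq_basis eB Ha Hb) => f sf.
have E : [tuple tnth e (tnth f i) | i < k] = bvs k [seq (val i).+1 | i <- f].
  apply: eq_from_tnth => i; rewrite !tnth_mktuple (nth_map (tnth f i)) ?size_tuple //.
  by rewrite -tnth_nth -bv_tnth.
rewrite E; apply: ab; apply: mem_subs.
- by rewrite size_map size_tuple.
- by rewrite sorted_map; rewrite sorted_map in sf.
- by apply/allP => _ /mapP[i _ ->]; rewrite /rng /=.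
Qed.

(** The forms e^I with I increasing are dual to the increasing tuples of basis vectors; the first
    hypothesis is this duality, which a computation verifies for each degree that is needed. *)
Lemma alt_form_subs k (a : kform V k) :
  all (fun I => all (fun J => eps I J == (I == J)%:R) (subs k)) (subs k) ->
  alt_form a -> a =1 fun v => \sum_(I <- subs k) a (bvs k I) * cform k I v.
Proof.
move=> /allP Hk Ha; apply: (alt_form_eq_subs Ha).
  by apply: alt_form_sum => I; apply/alt_formZ/alt_cform.
move=> J HJ; have uS : uniq (subs k).
  apply: filter_uniq; have: uniq (iota 1 7) by [].
  by vm_compute.
rewrite (bigD1_seq J) //= cform_bvs ?(subs_size HJ) ?(subs_rng HJ) //.
rewrite (eqP (allP (Hk _ HJ) _ HJ)) eqxx mulr1 big1_seq ?addr0 // => I /andP[nIJ HI].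
rewrite cform_bvs ?(subs_size HJ) ?(subs_rng HJ) ?(subs_size HI) ?(subs_rng HI) //.
by rewrite (eqP (allP (Hk _ HI) _ HJ)) (negPf nIJ) mulr0.
Qed.

End Frame.
Arguments bvs {R V} e k%_N I.
Arguments cform {R V} e k%_N I.

Lemma subs2_check : all (fun I => all (fun J => eps I J == (I == J)%:R) (subs 2)) (subs 2).
Proof. by vm_compute. Qed.
Lemma subs3_check : all (fun I => all (fun J => eps I J == (I == J)%:R) (subs 3)) (subs 3).
Proof. by vm_compute. Qed.
Lemma subs4_check : all (fun I => all (fun J => eps I J == (I == J)%:R) (subs 4)) (subs 4).
Proof. by vm_compute. Qed.

(** Over an abstract field an identity indexed by a finite list of index lists cannot be decided by
    evaluation, but it can be split into one goal for each index list. *)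
Fixpoint conj_all (s : seq (seq nat)) (P : seq nat -> Prop) : Prop :=
  if s is x :: s' then P x /\ conj_all s' P else True.

Lemma conj_allP s (P : seq nat -> Prop) : conj_all s P -> forall x, x \in s -> P x.
Proof.
elim: s => [|x s IH] //= [Px Ps] y; rewrite inE => /orP[/eqP->//|]; exact: IH.
Qed.

(** * Bases adapted to a G2-structure are orthonormal *)
Section Contraction.
Variables (R : numFieldType) (V : vectType R).

Lemma alt_contraction k x (a : kform V k.+1) : alt_form a -> alt_form (contraction x a).
Proof.
elim=> {a} [f Hf|c a b _ IHa _ IHb||a b _ IH E].
- have H : alt_form (fun v => \sum_(i < k.+1) (f i x * (-1) ^+ i) *
     wedge1 (fun m => f (lift i m)) v : R).
    by apply: alt_form_sum => i; apply/alt_formZ/alt_wedge1 => m.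
  apply: alt_ext H _ => v; rewrite /contraction /wedge1 (expand_det_col _ ord0).
  apply: eq_bigr => i _; rewrite mxE -mulrA /cofactor addn0 [tnth _ ord0](tnth_nth x) /=.
  congr (_ * (_ * \det _)); apply/matrixP => p q.
  by rewrite !mxE !(tnth_nth x) /=.
- exact: alt_ext (alt_comb c IHa IHb) _.
- exact: alt_ext (alt_zero _ _) _.
- by apply: alt_ext IH _ => v; rewrite /contraction E.
Qed.

End Contraction.

Section CformComb.
Variables (R : numFieldType) (V : vectType R) (e : 7.-tuple V).
Hypothesis eB : basis_of {:V} e.

Lemma wedge_cform k l I J : size I = k -> size J = l ->
  wedge (cform e k I) (cform e l J) =1 cform e (k + l) (I ++ J).
Proof.
move=> sI sJ v; rewrite wedge_wedge1; congr (\det _); apply/matrixP => i j.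
rewrite !mxE -[i]splitK nth_cat sI; case: (split i) => m /=.
  by rewrite cat_funL ltn_ord.
by rewrite cat_funR ltnNge leq_addr addKn.
Qed.

Lemma wedge_sum k l (A B : Type) (r : seq A) (s : seq B)
    (F : A -> kform V k) (G : B -> kform V l) (u : A -> R) (w : B -> R) v :
  wedge (fun v => \sum_(i <- r) u i * F i v) (fun v => \sum_(j <- s) w j * G j v) v
  = \sum_(i <- r) \sum_(j <- s) u i * w j * wedge (F i) (G j) v.
Proof.
elim: r => [|i r IH].
  rewrite [RHS]big_nil -[RHS](@wedge0l _ _ k _ (fun v => \sum_(j <- s) w j * G j v) v).
  by apply: (eq_wedge _ (frefl _)) => x; rewrite big_nil.
rewrite big_cons -IH.
rewrite -(eq_wedge (a := fun v => u i * F i v + \sum_(i <- r) u i * F i v)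
  (b := fun v => \sum_(j <- s) w j * G j v)); last 2 first.
- by move=> x; rewrite /= big_cons.
- by [].
rewrite wedgeDl wedgeZl; congr (_ + _).
elim: s {IH} => [|j s IH].
  rewrite [RHS]big_nil -[RHS](mulr0 (u i)); congr (_ * _).
  rewrite -[RHS](@wedge0r _ _ _ l (F i) v).
  by apply: (eq_wedge (frefl _)) => x; rewrite big_nil.
rewrite big_cons -IH.
rewrite -(eq_wedge (a := F i)
  (b := fun v => w j * G j v + \sum_(j <- s) w j * G j v)); last 2 first.
- by [].
- by move=> x; rewrite /= big_cons.
by rewrite wedgeDr wedgeZr mulrDr mulrA.
Qed.

End CformComb.

Section Metric.
Variables (R : rcfType) (V : vectType R) (g : {dot V for idfun}).

Lemma dotC x y : g x y = g y x.
Proof. by rewrite hermC mul1r. Qed.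
Lemma dotDl x y z : g (x + y) z = g x z + g y z.
Proof. exact: linearDl. Qed.
Lemma dotZl c x z : g (c *: x) z = c * g x z.
Proof. exact: linearZl_LR. Qed.
Lemma dotDr x y z : g z (x + y) = g z x + g z y.
Proof. exact: linearDr. Qed.
Lemma dotZr c x z : g z (c *: x) = c * g z x.
Proof. exact: linearZr_LR. Qed.
Lemma dot0l x : g 0 x = 0.
Proof. exact: linear0l. Qed.
Lemma dot0r x : g x 0 = 0.
Proof. exact: linear0r. Qed.
Lemma dotNl x y : g (- x) y = - g x y.
Proof. exact: linearNl. Qed.
Lemma dotNr x y : g x (- y) = - g x y.
Proof. exact: linearNr. Qed.
Lemma dotBl x y z : g (x - y) z = g x z - g y z.
Proof. exact: linearBl. Qed.
Lemma dotBr x y z : g z (x - y) = g z x - g z y.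
Proof. exact: linearBr. Qed.
Lemma dot_suml I (r : seq I) (F : I -> V) y :
  g (\sum_(i <- r) F i) y = \sum_(i <- r) g (F i) y.
Proof. by elim: r => [|i r IH]; rewrite ?big_nil ?dot0l // !big_cons dotDl IH. Qed.
Lemma dot_sumr I (r : seq I) (F : I -> V) y :
  g y (\sum_(i <- r) F i) = \sum_(i <- r) g y (F i).
Proof. by elim: r => [|i r IH]; rewrite ?big_nil ?dot0r // !big_cons dotDr IH. Qed.
Lemma dot_scalarr x : scalar (g x).
Proof. by move=> c y z; rewrite dotDr dotZr. Qed.
Lemma dot_scalarl x : scalar (g^~ x).
Proof. by move=> c y z; rewrite /= dotDl dotZl. Qed.
Lemma dot_gt0 x : x != 0 -> 0 < g x x.
Proof. exact: neq0_dnorm_gt0. Qed.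

Lemma dot_nondeg x y : (forall z, g x z = g y z) -> x = y.
Proof.
move=> xy; apply/eqP; rewrite -subr_eq0; apply/negPn/negP => /dot_gt0.
by rewrite dotBl xy subrr ltxx.
Qed.

Lemma orthonormalP n (e : n.-tuple V) :
  reflect (forall i j, g (tnth e i) (tnth e j) = (i == j)%:R) (orthonormal g e).
Proof.
have H (s : seq V) : orthonormal g s <->
    (forall i j, (i < size s)%N -> (j < size s)%N -> g s`_i s`_j = (i == j)%:R).
  elim: s => [|x s IH]; first by split.
  rewrite /orthonormal /=.
  have -> : [&& g x x == 1 & all [pred v | g v v == 1] s] &&
      (ortho_rec g [:: x] s && pair_ortho_rec g s)
     = [&& g x x == 1, ortho_rec g [:: x] s & orthonormal g s].
    by rewrite -andbA; congr (_ && _); rewrite /orthonormal andbCA.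
  split.
    case/and3P => /eqP xx /=; rewrite andbT => /allP xs /IH oS.
    case=> [|i] [|j] //=; rewrite ?ltnS => li lj.
    + by apply/eqP/xs/mem_nth.
    + by rewrite dotC; apply/eqP/xs/mem_nth.
    + by rewrite oS.
  move=> oS; apply/and3P; split.
  + by rewrite (oS 0%N 0%N).
  + rewrite /= andbT; apply/(all_nthP 0) => i li /=.
    by rewrite (oS 0%N i.+1).
  + by apply/IH => i j li lj; rewrite (oS i.+1 j.+1).
apply: (iffP idP) => [/H oS i j|oS]; first by rewrite !(tnth_nth 0) oS ?size_tuple.
apply/H => i j; rewrite size_tuple => li lj.
by have := oS (Ordinal li) (Ordinal lj); rewrite !(tnth_nth 0).
Qed.

Lemma orthonormal_basisP n (e : n.-tuple V) :
  \dim {:V} = n -> (forall i j, g (tnth e i) (tnth e j) = (i == j)%:R) ->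
  orthonormal_basis g e.
Proof.
move=> dimV oe; split; last exact/orthonormalP.
rewrite basisEfree subvf size_tuple dimV leqnn !andbT.
apply/freeP => k k0 i; have := congr1 (g^~ (tnth e i)) k0.
rewrite dot0l dot_suml (bigD1 i) //= big1 ?addr0 => [|j nji].
  by rewrite dotZl -tnth_nth oe eqxx /= mulr1.
by rewrite dotZl -tnth_nth oe (negPf nji) /= mulr0.
Qed.

Lemma coord_orthonormal n (e : n.-tuple V) x i :
  orthonormal_basis g e -> coord e i x = g x (tnth e i).
Proof.
case=> eB /orthonormalP oe; rewrite {2}(coord_basis eB (memvf x)).
rewrite dot_suml (bigD1 i) //= big1 ?addr0 => [|j nji].
  by rewrite dotZl -tnth_nth oe eqxx /= mulr1.
by rewrite dotZl -tnth_nth oe (negPf nji) /= mulr0.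
Qed.

Lemma dot_coord n (e : n.-tuple V) x y :
  orthonormal_basis g e -> g x y = \sum_i coord e i x * coord e i y.
Proof.
move=> oe; rewrite {1}(coord_basis (proj1 oe) (memvf x)) dot_suml.
apply: eq_bigr => i _. rewrite dotZl -tnth_nth; congr (_ * _).
by rewrite (coord_orthonormal _ _ oe) dotC.
Qed.

End Metric.

Definition model3 : seq (int * seq nat) :=
  [:: (1, [:: 1; 2; 7]%N); (1, [:: 3; 4; 7]%N); (1, [:: 5; 6; 7]%N);
      (1, [:: 1; 3; 5]%N); (-1, [:: 1; 4; 6]%N); (-1, [:: 2; 3; 6]%N);
      (-1, [:: 2; 4; 5]%N)].

Definition model3_val (J : seq nat) : int :=
  foldr (fun t s => t.1 * eps t.2 J + s) 0 model3.

(** The coefficient of e^{1234567} in the 7-form obtained by wedging the contractions of the model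
    with e_a and e_b and the model itself. The tests against 0 only keep the computation short. *)
Definition gram_val a b : int :=
  foldr (fun I s => (if model3_val (a :: I) == 0 then 0 else
     foldr (fun J s => (if model3_val (b :: J) == 0 then 0 else
       foldr (fun K s => (if model3_val K == 0 then 0 else
          model3_val (a :: I) * model3_val (b :: J) * model3_val K *
            eps ((I ++ J) ++ K) (iota 1 7)) + s) 0 (subs 3)) + s) 0 (subs 2)) + s) 0 (subs 2).

Lemma gram_valE : all (fun a => all (fun b => gram_val a b == 6 * (a == b)%:R)
  (iota 1 7)) (iota 1 7).
Proof. by vm_compute. Qed.

Lemma foldr_sum (R : nmodType) (T : Type) (F : T -> R) (r : seq T) :
  foldr (fun x s => F x + s) 0 r = \sum_(x <- r) F x.
Proof. by elim: r => [|x r IH]; rewrite ?big_nil ?big_cons //= IH. Qed.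

Section G2Basis.
Variables (R : rcfType) (V : vectType R) (e : 7.-tuple V).
Hypothesis eB : basis_of {:V} e.
Variable phi : kform V 3.
Hypothesis phiE : phi =1 g2_model e.

Lemma g2_model_sum v : g2_model e v = \sum_(t <- model3) t.1%:~R * cform e 3 t.2 v.
Proof.
rewrite /model3 !big_cons big_nil /g2_model /= !eformE /=.
by rewrite !mul1r !mulN1r addr0 !addrA.
Qed.

Lemma alt_g2_model : alt_form phi.
Proof.
have H : alt_form (fun v => \sum_(t <- model3) t.1%:~R * cform e 3 t.2 v).
  by apply: alt_form_sum => t; apply/alt_formZ/alt_cform.
by apply: alt_ext H _ => v; rewrite phiE g2_model_sum.
Qed.

Lemma g2_model_val J : size J = 3%N -> all rng J -> phi (bvs e 3 J) = (model3_val J)%:~R.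
Proof.
move=> sJ rJ; rewrite phiE g2_model_sum /model3_val foldr_sum rmorph_sum /=.
apply: eq_big_seq => t Ht; rewrite intrM; congr (_ * _); rewrite cform_bvs //.
  by apply/eqP; move: t Ht; apply/allP.
by move: t Ht; apply/allP.
Qed.

Lemma contraction_bvs k (a : kform V k.+1) i I :
  contraction (bv e i) a (bvs e k I) = a (bvs e k.+1 (i :: I)).
Proof.
congr (a _); apply: eq_from_tnth => m; rewrite tnth_mktuple.
by case: (unliftP ord0 m) => [p ->|->]; rewrite ?tnthS ?tnth0 // tnth_mktuple.
Qed.

Lemma bvs_all : bvs e 7 (iota 1 7) = e.
Proof.
apply: eq_from_tnth => i; rewrite tnth_mktuple nth_iota // add1n.
exact: bv_tnth.
Qed.

Lemma gram_g2_model a b : rng a -> rng b ->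
  wedge (wedge (contraction (bv e a) phi) (contraction (bv e b) phi)) phi e
  = 6 * (a == b)%:R.
Proof.
move=> ra rb.
have C3 : phi =1 fun v => \sum_(I <- subs 3) (model3_val I)%:~R * cform e 3 I v.
  move=> v; rewrite (alt_form_subs eB subs3_check alt_g2_model).
  by apply: eq_big_seq => I HI; rewrite g2_model_val ?(subs_size HI) ?(subs_rng HI).
have C2 c : rng c -> contraction (bv e c) phi =1
    fun v => \sum_(I <- subs 2) (model3_val (c :: I))%:~R * cform e 2 I v.
  move=> rc v; rewrite (alt_form_subs eB subs2_check (alt_contraction _ alt_g2_model)).
  apply: eq_big_seq => I HI; rewrite contraction_bvs.
  by rewrite g2_model_val /= ?(subs_size HI) ?rc ?(subs_rng HI).
rewrite (eq_wedge (eq_wedge (C2 a ra) (C2 b rb)) C3).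
have W2 v : wedge
    (fun v => \sum_(I <- subs 2) (model3_val (a :: I))%:~R * cform e 2 I v)
    (fun v => \sum_(I <- subs 2) (model3_val (b :: I))%:~R * cform e 2 I v) v
  = \sum_(IJ <- allpairs pair (subs 2) (subs 2))
     ((model3_val (a :: IJ.1))%:~R * (model3_val (b :: IJ.2))%:~R)
      * cform e 4 (IJ.1 ++ IJ.2) v.
  rewrite wedge_sum big_allpairs_dep; apply: eq_big_seq => I HI.
  by apply: eq_big_seq => J HJ; rewrite wedge_cform ?(subs_size HI) ?(subs_size HJ).
rewrite (eq_wedge W2 (frefl _)) wedge_sum big_allpairs_dep.
transitivity ((gram_val a b)%:~R : R); last first.
  move: ra rb; rewrite !rng_iota => ra rb.
  have /allP/(_ a ra)/allP/(_ b rb)/eqP-> := gram_valE.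
  by rewrite intrM; case: (a == b).
rewrite /gram_val foldr_sum rmorph_sum; apply: eq_big_seq => I HI.
case: (model3_val (a :: I) =P 0) => [E|_].
  by rewrite big1 // => J _; rewrite big1 // => K _; rewrite /= E !mul0r.
rewrite foldr_sum rmorph_sum; apply: eq_big_seq => J HJ.
case: (model3_val (b :: J) =P 0) => [E|_].
  by rewrite big1 // => K _; rewrite /= E mulr0 !mul0r.
rewrite foldr_sum rmorph_sum; apply: eq_big_seq => K HK.
case: (model3_val K =P 0) => [E|_]; first by rewrite /= E mulr0 mul0r.
rewrite !rmorphM; congr (_ * _ * _ * _).
rewrite wedge_cform ?size_cat ?(subs_size HI) ?(subs_size HJ) ?(subs_size HK) //.
have : all rng ((I ++ J) ++ K).
  by rewrite !all_cat (subs_rng HI) (subs_rng HJ) (subs_rng HK).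
have : size ((I ++ J) ++ K) = 7%N.
  by rewrite !size_cat (subs_size HI) (subs_size HJ) (subs_size HK).
move=> s7 r7; have := cform_bvs eB (k := 7) s7 (J := iota 1 7) erefl r7 isT.
by rewrite bvs_all.
Qed.

Lemma inord_iota7 (i : 'I_7) : inord (tnth [tuple 1; 2; 3; 4; 5; 6; 7]%N i).-1 = i.
Proof.
apply: val_inj; case: i => m Hm.
by do 7! [case: m Hm => [|m] Hm; first by rewrite /= inordK].
Qed.

(** The identity that defines g says that g(e_i, e_j) vol(e) = delta_ij. Taking determinants, with
    the base change matrix from an orthonormal basis on which vol is normalized, gives
    vol(e)^7 vol(e)^2 = 1; hence vol(e) = 1, as vol(e) is positive. *)
Lemma g2_basis_orthonormal (g : {dot V for idfun}) vol :
  g2_metric phi g vol -> [/\ orthonormal_basis g e, alt_form vol & vol e = 1].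
Proof.
case=> -[b oB volE] gE.
have Hvol : alt_form vol by apply: alt_ext (alt_eform b _) _; apply/fsym.
have dimV : \dim {:V} = 7%N by apply: size_basis eB.
have gE' i j : g (tnth e i) (tnth e j) * vol e = (i == j)%:R.
  apply: (mulfI (_ : 6 != 0 :> R)); first by rewrite pnatr_eq0.
  by rewrite mulrA -gE -!bv_tnth gram_g2_model // /rng /= ltn_ord.
pose X := \matrix_(i < 7, j < 7) coord b i (tnth e j) : 'M[R]_7.
have volX : vol e = \det X.
  rewrite volE /eform /wedge1 /X; congr (\det _); apply/matrixP => p q; rewrite !mxE.
  by congr (coord b _ _); apply: inord_iota7.
(* det (vol(e) G) = 1 for the Gram matrix G = X^T X of e, and det X = vol(e) *)
have c9 : vol e ^+ 9 = 1.
  have : \det ((vol e) *: (X^T *m X)) = 1.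
    rewrite -(det1 _ 7); congr (\det _); apply/matrixP => p q; rewrite !mxE -gE'.
    rewrite [RHS]mulrC (dot_coord _ _ oB); congr (_ * _).
    by apply: eq_bigr => m _; rewrite !mxE.
  by rewrite detZ det_mulmx det_tr -volX -expr2 -exprD.
have c0 : 0 < vol e.
  have e0 : tnth e ord0 != 0.
    apply/eqP => e0; have := gE' ord0 ord0.
    by rewrite e0 dot0l mul0r => /eqP; rewrite eq_sym oner_eq0.
  by rewrite -(pmulr_rgt0 _ (dot_gt0 g e0)) gE'.
have c1 : vol e = 1 by apply/eqP; rewrite -(pexpr_eq1 (n := 9)) ?ltW ?c9.
split=> //; apply: orthonormal_basisP => // i j.
by have := gE' i j; rewrite c1 mulr1.
Qed.

End G2Basis.

(** * The Chevalley-Eilenberg differential *)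
Section SmallDet.
Variables (R : comPzRingType) (M : nat -> nat -> R).

Lemma det2E (N : 'M[R]_2) : \det N = N ord0 ord0 * N (lift ord0 ord0) (lift ord0 ord0)
  - N ord0 (lift ord0 ord0) * N (lift ord0 ord0) ord0.
Proof.
rewrite (expand_det_row _ ord0) !big_ord_recl big_ord0 /cofactor !det_mx11 !mxE /=.
rewrite (_ : lift (lift ord0 ord0) ord0 = ord0 :> 'I_2); last exact: val_inj.
rewrite /bump /=; ring.
Qed.

Lemma det3E : \det (\matrix_(i < 3, j < 3) M i j) =
  M 0 0 * (M 1 1 * M 2 2 - M 1 2 * M 2 1)
  - M 0 1 * (M 1 0 * M 2 2 - M 1 2 * M 2 0)
  + M 0 2 * (M 1 0 * M 2 1 - M 1 1 * M 2 0).
Proof.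
rewrite (expand_det_row _ ord0) !big_ord_recl big_ord0 /cofactor !det2E !mxE /=.
rewrite /bump /=; ring.
Qed.

Lemma det4E : \det (\matrix_(i < 4, j < 4) M i j) =
  (M 0 0 * M 1 1 - M 0 1 * M 1 0) * (M 2 2 * M 3 3 - M 2 3 * M 3 2)
  - (M 0 0 * M 1 2 - M 0 2 * M 1 0) * (M 2 1 * M 3 3 - M 2 3 * M 3 1)
  + (M 0 0 * M 1 3 - M 0 3 * M 1 0) * (M 2 1 * M 3 2 - M 2 2 * M 3 1)
  + (M 0 1 * M 1 2 - M 0 2 * M 1 1) * (M 2 0 * M 3 3 - M 2 3 * M 3 0)
  - (M 0 1 * M 1 3 - M 0 3 * M 1 1) * (M 2 0 * M 3 2 - M 2 2 * M 3 0)
  + (M 0 2 * M 1 3 - M 0 3 * M 1 2) * (M 2 0 * M 3 1 - M 2 1 * M 3 0).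
Proof.
rewrite (expand_det_row _ ord0) !big_ord_recl big_ord0 /cofactor.
rewrite !(expand_det_row _ ord0) !big_ord_recl !big_ord0 /cofactor !det2E !mxE /=.
rewrite /bump /=; ring.
Qed.

End SmallDet.

Section CEDiff.
Variables (R : numFieldType) (V : vectType R).

Lemma alt_form2 (b : V -> V -> R) :
  (forall x, scalar (b x)) -> (forall x, scalar (b^~ x)) -> (forall x, b x x = 0) ->
  alt_form (fun v : 2.-tuple V => b (tnth v ord0) (tnth v ord_max)).
Proof.
move=> br bl bxx; pose e := vbasis {:V}.
have bC x y : b y x = - b x y.
  have := bxx (1 *: x + y); rewrite (br _ 1) (bl _ 1 x y) (bl _ 1 x y) !bxx !mul1r addr0 add0r.
  by move/eqP; rewrite addr_eq0 => /eqP.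
pose h i j : 'I_2 -> V -> R := fun m => if m == ord0 then coord e i else coord e j.
pose n := \dim {:V}.
have H : alt_form (fun v : 2.-tuple V =>
    2^-1 * \sum_(i < n) \sum_(j < n) b e`_i e`_j * wedge1 (h i j) v).
  apply/alt_formZ/alt_form_sum => i; apply/alt_form_sum => j.
  by apply/alt_formZ/alt_wedge1 => m c x y; rewrite /h; case: eqP => _; rewrite linearP.
apply: alt_ext H _ => v; set x := tnth v ord0; set y := tnth v ord_max.
have hE i j : wedge1 (h i j) v = coord e i x * coord e j y - coord e i y * coord e j x.
  rewrite /wedge1 det2E !mxE /h /=.
  by rewrite (_ : lift ord0 ord0 = ord_max) //; apply: val_inj.
have bE x' y' : b x' y' = \sum_(i < n) \sum_(j < n) b e`_i e`_j * (coord e i x' * coord e j y').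
  pose bx : {scalar V} := HB.pack (b x') (GRing.isLinear.Build _ _ _ _ (b x') (br x')).
  rewrite {1}(coord_vbasis (memvf y')) -[b x' _]/(bx _) linear_sum exchange_big.
  apply: eq_bigr => j _; rewrite linearZ /= /bx /=.
  pose by_ : {scalar V} := HB.pack (b^~ e`_j) (GRing.isLinear.Build _ _ _ _ (b^~ e`_j) (bl e`_j)).
  rewrite {1}(coord_vbasis (memvf x')) -[b _ _]/(by_ _) linear_sum mulr_sumr.
  by apply: eq_bigr => i _; rewrite linearZ /= /by_ /= mulrCA !mulrA mulrC mulrA.
apply: (mulfI (_ : 2 != 0 :> R)); first by rewrite pnatr_eq0.
rewrite mulrA divff ?pnatr_eq0 // mul1r mulr_natl mulr2n {2}[b x y](_ : _ = - b y x).
  rewrite !bE -sumrB; apply: eq_bigr => i _; rewrite -sumrB; apply: eq_bigr => j _.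
  by rewrite hE mulrBr.
by rewrite bC.
Qed.

(** Written out because the differential of a decomposable 3-form is a sum of such products. *)
Lemma wedge22E (b : kform V 2) (f : nat -> V -> R) (v : 4.-tuple V) :
  alt_form b ->
  let x := tnth v in
  let m i j := f 0 v`_i * f 1 v`_j - f 0 v`_j * f 1 v`_i in
  wedge b (wedge1 (fun i : 'I_2 => f i)) v =
    b [tuple v`_0; v`_1] * m 2 3 - b [tuple v`_0; v`_2] * m 1 3
  + b [tuple v`_0; v`_3] * m 1 2 + b [tuple v`_1; v`_2] * m 0 3
  - b [tuple v`_1; v`_3] * m 0 2 + b [tuple v`_2; v`_3] * m 0 1.
Proof.
move=> Hb x m; elim: Hb => {b} [h Hh|c a b _ IHa _ IHb||a b _ IH E].
- pose h' i := h (inord i).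
  have hE w : wedge1 h w = wedge1 (fun i : 'I_2 => h' i) w.
    by congr (\det _); apply/matrixP => i j; rewrite !mxE /h' inord_val.
  rewrite (eq_wedge hE (frefl _)) wedge_wedge1 !hE.
  pose M i j := (if i is i'.+2 then f i' else h' i) v`_j.
  rewrite /wedge1.
  rewrite (_ : \matrix_(_, _) _ = \matrix_(i < 4, j < 4) M i j); last first.
    apply/matrixP => i j; rewrite !mxE (tnth_nth 0) /M /cat_fun.
    by case: splitP => p -> //; case: p => [[|[|//]]].
  rewrite det4E /M /=.
  have e2 (s t : V) : \det (\matrix_(i, j) h' i (tnth [tuple s; t] j))
      = h' 0 s * h' 1 t - h' 0 t * h' 1 s.
    by rewrite det2E !mxE.
  rewrite !e2 /m; ring.
- rewrite wedgeDl wedgeZl IHa IHb; ring.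
- rewrite wedge0l; ring.
- by rewrite -(eq_wedge E (frefl _)) IH !E.
Qed.

Variable br : {bilinear V -> V -> V}.

Lemma ce_diff_nth k (a : kform V k.+1) (v : k.+2.-tuple V) :
  ce_diff br a v = \sum_(j < k.+2) \sum_(i < k.+1 | (i < j)%N) (-1) ^+ (i + j) *
    a [tuple of br v`_(bump j i) v`_j :: [tuple v`_(bump j (bump i h)) | h < k]].
Proof.
apply: eq_bigr => j _; apply: eq_bigr => i _.
rewrite !(tnth_nth 0) /=; congr (_ * a [tuple of _ :: _]).
by apply: eq_from_tnth => h; rewrite !tnth_mktuple (tnth_nth 0).
Qed.

Lemma ce_diff1E (a : kform V 1) (v : 2.-tuple V) :
  ce_diff br a v = - a [tuple br v`_0 v`_1].
Proof.
have E (j i : nat) : a [tuple of br v`_(bump j i) v`_j :: [tuple v`_(bump j (bump i h)) | h < 0]]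
    = a [tuple br v`_(bump j i) v`_j].
  by congr (a _); apply: val_inj; rewrite /= enum_ord0.
rewrite ce_diff_nth.
under eq_bigr => j _ do rewrite big_mkcond /=.
under eq_bigr => j _ do under eq_bigr => i _ do rewrite E.
rewrite !big_ord_recl !big_ord0 /=.
rewrite /bump /= ?addSn ?add0n ?exprS ?expr0.
ring.
Qed.

Lemma ce_diff3E (a : kform V 3) (v : 4.-tuple V) :
  ce_diff br a v =
  - a [tuple br v`_0 v`_1; v`_2; v`_3] + a [tuple br v`_0 v`_2; v`_1; v`_3]
  - a [tuple br v`_0 v`_3; v`_1; v`_2] - a [tuple br v`_1 v`_2; v`_0; v`_3]
  + a [tuple br v`_1 v`_3; v`_0; v`_2] - a [tuple br v`_2 v`_3; v`_0; v`_1].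
Proof.
have E (j i : nat) : a [tuple of br v`_(bump j i) v`_j :: [tuple v`_(bump j (bump i h)) | h < 2]]
    = a [tuple br v`_(bump j i) v`_j; v`_(bump j (bump i 0)); v`_(bump j (bump i 1))].
  by congr (a _); apply: val_inj; rewrite /= !enum_ordSl enum_ord0.
rewrite ce_diff_nth.
under eq_bigr => j _ do rewrite big_mkcond /=.
under eq_bigr => j _ do under eq_bigr => i _ do rewrite E.
rewrite !big_ord_recl !big_ord0 /=.
rewrite /bump /= ?addSn ?add0n ?exprS ?expr0.
ring.
Qed.

Lemma ce_diff4E (a : kform V 4) (v : 5.-tuple V) :
  ce_diff br a v =
  - a [tuple br v`_0 v`_1; v`_2; v`_3; v`_4] + a [tuple br v`_0 v`_2; v`_1; v`_3; v`_4]
  - a [tuple br v`_0 v`_3; v`_1; v`_2; v`_4] + a [tuple br v`_0 v`_4; v`_1; v`_2; v`_3]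
  - a [tuple br v`_1 v`_2; v`_0; v`_3; v`_4] + a [tuple br v`_1 v`_3; v`_0; v`_2; v`_4]
  - a [tuple br v`_1 v`_4; v`_0; v`_2; v`_3] - a [tuple br v`_2 v`_3; v`_0; v`_1; v`_4]
  + a [tuple br v`_2 v`_4; v`_0; v`_1; v`_3] - a [tuple br v`_3 v`_4; v`_0; v`_1; v`_2].
Proof.
have E (j i : nat) : a [tuple of br v`_(bump j i) v`_j :: [tuple v`_(bump j (bump i h)) | h < 3]]
    = a [tuple br v`_(bump j i) v`_j; v`_(bump j (bump i 0)); v`_(bump j (bump i 1));
         v`_(bump j (bump i 2))].
  by congr (a _); apply: val_inj; rewrite /= !enum_ordSl enum_ord0.
rewrite ce_diff_nth.
under eq_bigr => j _ do rewrite big_mkcond /=.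
under eq_bigr => j _ do under eq_bigr => i _ do rewrite E.
rewrite !big_ord_recl !big_ord0 /=.
rewrite /bump /= ?addSn ?add0n ?exprS ?expr0.
ring.
Qed.

Hypothesis brC : forall x, br x x = 0.

Lemma alt_ce_diff1 (f : V -> R) : scalar f ->
  alt_form (ce_diff br (wedge1 (fun _ : 'I_1 => f))).
Proof.
move=> Hf; pose h : {scalar V} := HB.pack f (GRing.isLinear.Build _ _ _ _ f Hf).
have H : alt_form (fun v : 2.-tuple V => f (br (tnth v ord0) (tnth v ord_max))).
  apply: (@alt_form2 (fun x y => f (br x y))) => [x c y z|x c y z|x].
  - by rewrite linearPr Hf.
  - by rewrite linearPl Hf.
  - by rewrite brC; apply: (linear0 h).
apply: alt_ext (alt_formN H) _ => v.
by rewrite ce_diff1E /wedge1 det_mx11 mxE (tnth_nth 0) !(tnth_nth 0).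
Qed.

(** The Leibniz rule d(f_0 f_1 f_2) = df_0 f_1 f_2 - df_1 f_0 f_2 + df_2 f_0 f_1 exhibits the
    differential of a decomposable form as a combination of wedge products. *)
Lemma alt_ce_diff3 (a : kform V 3) : alt_form a -> alt_form (ce_diff br a).
Proof.
elim=> {a} [f Hf|c a b _ IHa _ IHb||a b _ IH E].
- pose F i := f (inord i).
  have HF i : scalar (F i) by apply: Hf.
  pose b i : kform V 2 := ce_diff br (wedge1 (fun _ : 'I_1 => F i)).
  have Hb i : alt_form (b i) by apply: alt_ce_diff1.
  pose G k i : V -> R := F (bump k i).
  have H : alt_form (fun v : 4.-tuple V =>
     (wedge (b 0) (wedge1 (fun i : 'I_2 => G 0 i)) v
      - wedge (b 1) (wedge1 (fun i : 'I_2 => G 1 i)) v)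
      + wedge (b 2) (wedge1 (fun i : 'I_2 => G 2 i)) v).
    apply: alt_formD; first apply: alt_formB;
    by apply: (@alt_wedge _ _ 2 2) => //; apply: alt_wedge1 => i; apply: HF.
  apply: alt_ext H _ => v; rewrite !wedge22E // ce_diff3E.
  pose M x y z i j := F i [:: x; y; z]`_j.
  have fE x y z : wedge1 f [tuple x; y; z] = \det (\matrix_(i < 3, j < 3) M x y z i j).
    by congr (\det _); apply/matrixP => i j; rewrite !mxE /M /F inord_val (tnth_nth 0).
  rewrite !fE !det3E /M /b !ce_diff1E /wedge1 !det_mx11 !mxE !(tnth_nth 0) /G /bump /=.
  ring.
- apply: alt_ext (alt_comb c IHa IHb) _ => v; rewrite !ce_diff3E; ring.
- apply: alt_ext (alt_zero _ _) _ => v; rewrite !ce_diff3E; ring.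
- by apply: alt_ext IH _ => v; rewrite !ce_diff3E !E.
Qed.

End CEDiff.

(** * The coordinate model *)
Fixpoint oddinv (K : seq nat) : bool :=
  if K is x :: K' then odd (count (fun y => (y < x)%N) K') (+) oddinv K' else false.

Fixpoint words k : seq (seq nat) :=
  if k is k'.+1 then [seq x :: w | x <- iota 1 7, w <- words k'] else [:: [::]].

Lemma mem_words k J : size J = k -> all rng J -> J \in words k.
Proof.
elim: k J => [|k IH] [|x J] // [sJ] /andP[rx rJ]; rewrite /words -/words.
by apply/allpairsP; exists (x, J); split; rewrite ?IH // -rng_iota.
Qed.

(** The sign in star(e^I) = +- e^J for J complementary to I; see [hodge_basis]. *)
Definition star_sign (J : seq nat) : bool := oddinv (compl J ++ J).

Definition star_ok k := all (fun J => uniq J ==>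
  ((size (compl J) == (7 - k)%N) && (eps (iota 1 7) (compl J ++ J) == (-1) ^+ star_sign J)))
  (words k).

Arguments star_ok k%_N.

Lemma star_ok3 : star_ok 3. Proof. by vm_compute. Qed.
Lemma star_ok4 : star_ok 4. Proof. by vm_compute. Qed.

Lemma compl_rng J : all rng (compl J).
Proof. by apply/allP => i; rewrite mem_filter -rng_iota => /andP[]. Qed.

(** The signs that turn the components of a wedge product with psi into contractions with phi;
    used in [wedge_psi]. *)
Lemma wedge_star_ok : all (fun w => all (fun I => all (fun T =>
   eps (I ++ compl T) (compl [:: w]) * (-1) ^+ star_sign (compl T)
     == (-1) ^+ odd w.+1 * eps T (I ++ [:: w]))
   (subs 3)) (subs 2)) (iota 1 7).
Proof. by vm_compute. Qed.

(** In an adapted basis every object in the theorem is determined by finitely many numbers: the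
    structure constants c i j k = g([e_i, e_j], e_k) and the components f i j k of the 3-form.
    The functions with suffix c compute the other objects from these two tables, and the lemmas
    of this part identify them with the invariant definitions. *)
Section Model.
Variables (R : numFieldType) (c f : nat -> nat -> nat -> R).

(* A fold, unlike a big operator, unfolds under conversion to an explicit sum. *)
Definition sumL (T : Type) (s : seq T) (F : T -> R) := foldr (fun m t => F m + t) 0 s.
Definition sg (b : bool) (x : R) := if b then - x else x.
Definition at3 (h : nat -> nat -> nat -> R) (J : seq nat) : R :=
  h (nth 0 J 0)%N (nth 0 J 1)%N (nth 0 J 2)%N.
Definition star_c (k : nat) (h : seq nat -> R) (J : seq nat) : R :=
  if uniq J then sg (star_sign J) (h (compl J)) else 0.
Definition psi_c := star_c 4 (at3 f).
Definition brk (h : seq nat -> R) (a b : nat) (J : seq nat) : R :=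
  sumL (iota 1 7) (fun m => c a b m * h (m :: J)).
Definition d3_c (h : seq nat -> R) (J : seq nat) : R :=
  let n := nth 0%N J in
  - brk h (n 0%N) (n 1%N) [:: n 2%N; n 3%N] + brk h (n 0%N) (n 2%N) [:: n 1%N; n 3%N]
  - brk h (n 0%N) (n 3%N) [:: n 1%N; n 2%N] - brk h (n 1%N) (n 2%N) [:: n 0%N; n 3%N]
  + brk h (n 1%N) (n 3%N) [:: n 0%N; n 2%N] - brk h (n 2%N) (n 3%N) [:: n 0%N; n 1%N].
Definition d4_c (h : seq nat -> R) (J : seq nat) : R :=
  let n := nth 0%N J in
  - brk h (n 0%N) (n 1%N) [:: n 2%N; n 3%N; n 4%N]
  + brk h (n 0%N) (n 2%N) [:: n 1%N; n 3%N; n 4%N]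
  - brk h (n 0%N) (n 3%N) [:: n 1%N; n 2%N; n 4%N]
  + brk h (n 0%N) (n 4%N) [:: n 1%N; n 2%N; n 3%N]
  - brk h (n 1%N) (n 2%N) [:: n 0%N; n 3%N; n 4%N]
  + brk h (n 1%N) (n 3%N) [:: n 0%N; n 2%N; n 4%N]
  - brk h (n 1%N) (n 4%N) [:: n 0%N; n 2%N; n 3%N]
  - brk h (n 2%N) (n 3%N) [:: n 0%N; n 1%N; n 4%N]
  + brk h (n 2%N) (n 4%N) [:: n 0%N; n 1%N; n 3%N]
  - brk h (n 3%N) (n 4%N) [:: n 0%N; n 1%N; n 2%N].
Definition dphi_c := d3_c (at3 f).
Definition star_dphi_c := star_c 3 dphi_c.
(** The scalar star(d phi /\ phi). *)
Definition tau_c : R := sumL (subs 3) (fun J => at3 f J * star_dphi_c J).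
Definition tor_c i j k : R := 6^-1 * tau_c * f i j k - star_dphi_c [:: i; j; k].
(** Christoffel symbols of the connection with parameter lam: the Koszul formula, plus the term of
    the torsion T. *)
Definition gam_c (T : nat -> nat -> nat -> R) (lam : R) i j k : R :=
  2^-1 * (c i j k - c j k i + c k i j) + lam / 2 * T i j k.
Definition curv_c (G : nat -> nat -> nat -> R) x y u v : R :=
  sumL (iota 1 7) (fun m => G y u m * G x m v - G x u m * G y m v - c x y m * G m u v).
(** Contraction of the curvature with phi. The map that sends a 2-form to its wedge product with psi
    is, up to a star and a sign, this contraction. *)
Definition inst_c (G : nat -> nat -> nat -> R) w u v : R :=
  sumL (subs 2) (fun I => at3 f (I ++ [:: w]) *
    curv_c G (nth 0%N I 0) (nth 0%N I 1) u v).

End Model.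

Lemma sumLE (R : numFieldType) (T : Type) (s : seq T) (F : T -> R) :
  sumL s F = \sum_(x <- s) F x.
Proof. exact: foldr_sum. Qed.

Section Frame.
Variables (R : rcfType) (V : vectType R) (br : {bilinear V -> V -> V}).
Variables (g : {dot V for idfun}) (vol : kform V 7) (phi : kform V 3).
Variables (e : 7.-tuple V).
Hypotheses (oB : orthonormal_basis g e) (brC : forall x, br x x = 0).
Hypotheses (vol_alt : alt_form vol) (vol1 : vol e = 1) (phi_alt : alt_form phi).

Let eB : basis_of {:V} e := proj1 oB.
Let dimV : \dim {:V} = 7%N := size_basis eB.

Notation b := (bv e).
Definition cst i j k : R := g (br (b i) (b j)) (b k).
Definition phc i j k : R := phi [tuple b i; b j; b k].

Lemma dot_bv i j : rng i -> rng j -> g (b i) (b j) = (i == j)%:R.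
Proof.
move=> ri rj; rewrite eq_sym -(coord_bv eB rj ri).
case: j rj => // j; rewrite /rng /= ltnS => j7.
have := coord_orthonormal (b i) (Ordinal (j7 : (j < 7)%N)) oB; rewrite -bv_tnth /= => <-.
by congr (coord e _ _); apply: val_inj; rewrite /= inordK.
Qed.

Lemma bv_expand x : x = \sum_(m <- iota 1 7) g x (b m) *: b m.
Proof.
rewrite {1}(coord_basis eB (memvf x)).
rewrite (iotaDl 1 0 7) big_map -[iota 0 7]/(index_iota 0 7) big_mkord.
apply: eq_bigr => i _; rewrite add1n -tnth_nth bv_tnth.
by rewrite (coord_orthonormal _ _ oB).
Qed.

Lemma alt_form_head k (a : kform V k.+1) (t : k.-tuple V) :
  alt_form a -> scalar (fun x => a [tuple of x :: t]).
Proof.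
move=> Ha d x y; have E z : [tuple of z :: t] = set_slot [tuple of 0 :: t] ord0 z.
  apply: eq_from_tnth => i; rewrite tnth_mktuple.
  by case: (unliftP ord0 i) => [j ->|->] /=; rewrite ?tnthS ?tnth0.
by rewrite (E (d *: x + y)) (E x) (E y) (alt_form_slot _ _ _ _ _ Ha).
Qed.

Lemma alt_form_head_bv k (a : kform V k.+1) (t : k.-tuple V) x :
  alt_form a ->
  a [tuple of x :: t] = \sum_(m <- iota 1 7) g x (b m) * a [tuple of b m :: t].
Proof.
move=> Ha; pose h : {scalar V} := HB.pack (fun x => a [tuple of x :: t])
  (GRing.isLinear.Build _ _ _ _ _ (alt_form_head t Ha)).
rewrite -[LHS]/(h x) {1}(bv_expand x) linear_sum.
by apply: eq_bigr => m _; rewrite linearZ.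
Qed.

Lemma bvs_val k J : size J = k -> tval (bvs e k J) = map b J.
Proof.
move=> sJ; apply: (@eq_from_nth _ 0); first by rewrite size_tuple size_map.
rewrite size_tuple => i ik.
rewrite (nth_map 0%N) ?sJ // -[i]/(val (Ordinal ik)) -tnth_nth.
by rewrite tnth_mktuple.
Qed.

Lemma at3_phc J : size J = 3%N -> phi (bvs e 3 J) = at3 phc J.
Proof.
move=> sJ; congr (phi _); apply: val_inj; apply: etrans (bvs_val sJ) _.
by move: J sJ => [|x [|y [|z [|? ?]]]].
Qed.

Lemma vol_bvs K : size K = 7%N -> all rng K -> vol (bvs e 7 K) = (eps (iota 1 7) K)%:~R.
Proof.
move=> sK rK; rewrite (top_form_det _ eB vol_alt) vol1 mul1r.
rewrite -(cform_bvs eB _ sK _ rK) //; congr (\det _); apply/matrixP => i j.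
by rewrite !mxE nth_iota // add1n inord_val.
Qed.

(** On a list without repetition this is [hodge_basis]; on a list with a repetition both sides
    vanish. *)
Lemma hodge_bvs k l (v : kform V (k + l)) a (h : seq nat -> R) J :
  (k + l)%N = 7%N -> alt_form v ->
  (forall K, size K = 7%N -> all rng K -> v (bvs e (k + l) K) = (eps (iota 1 7) K)%:~R) ->
  star_ok l -> alt_form a -> (forall I, size I = k -> all rng I -> a (bvs e k I) = h I) ->
  size J = l -> all rng J -> hodge g v a (bvs e l J) = star_c l h J.
Proof.
move=> kl Hv vE Hs Ha aE sJ rJ; rewrite /star_c; case: ifP => uJ.
  rewrite /star_ok in Hs; have /allP/(_ J (mem_words sJ rJ)) := Hs.
  rewrite uJ implyTb => /andP[/eqP sI /eqP epsE].
  have {}sI : size (compl J) = k by rewrite sI -kl addnK.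
  have E : [tuple of bvs e k (compl J) ++ bvs e l J] = bvs e (k + l) (compl J ++ J).
    by apply: val_inj; rewrite /= !bvs_val ?size_cat ?sI ?sJ // map_cat.
  have vJ : v [tuple of bvs e k (compl J) ++ bvs e l J] = (-1) ^+ star_sign J.
    rewrite E vE ?size_cat ?sI ?sJ // ?epsE; last by rewrite all_cat compl_rng.
    by rewrite intr_sign.
  rewrite (@hodge_basis _ _ _ _ _ _ _ _ _ _ (bvs e k (compl J))) //.
  - rewrite vJ aE ?compl_rng // /sg; case: (star_sign J).
      by rewrite expr1 invrN1 mulrN1.
    by rewrite expr0 divr1.
  - exact: dot_scalarr.
  - by rewrite dimV kl.
  - by rewrite vJ signr_eq0.
  - move=> i j; rewrite !tnth_mktuple.
    have iJ : nth 0%N J i \in J by rewrite mem_nth // sJ.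
    have jI : nth 0%N (compl J) j \in compl J by rewrite mem_nth // sI.
    rewrite (dot_bv (allP rJ _ iJ) (allP (compl_rng J) _ jI)).
    case: eqP => // E1; move: jI; rewrite mem_filter => /andP[/negP[]].
    by rewrite -E1.
  - move=> i j; rewrite !tnth_mktuple.
    have iJ (m : 'I_l) : nth 0%N J m \in J by rewrite mem_nth // sJ.
    by rewrite dot_bv ?(allP rJ _ (iJ _)) // nth_uniq ?sJ.
have [[i j] /= [nij vij]] : exists p : 'I_l * 'I_l,
    p.1 != p.2 /\ tnth (bvs e l J) p.1 = tnth (bvs e l J) p.2.
  move/negbT: uJ => /(uniqPn 0%N)[i [j [lij jJ E]]]; rewrite sJ in jJ.
  exists (Ordinal (ltn_trans lij jJ), Ordinal jJ); rewrite -val_eqE /= neq_ltn lij.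
  by rewrite !tnth_mktuple /= E.
apply: (alt_form_eq0 _ nij vij); apply: (@alt_hodge _ _ _ _ _ _ _ (bvs e (k + l) (iota 1 7))) => //.
- exact: dot_scalarr.
- exact: dot_scalarl.
- by rewrite dimV.
- by rewrite vE // (_ : eps _ _ = 1) ?oner_eq0 //; vm_compute.
Qed.

Lemma psi_bvs J : size J = 4%N -> all rng J ->
  g2_psi phi g vol (bvs e 4 J) = psi_c phc J.
Proof.
move=> sJ rJ; apply: (@hodge_bvs 3 4 _ _ _ _ erefl vol_alt vol_bvs star_ok4 phi_alt) => //.
by move=> I sI rI; apply: at3_phc.
Qed.

Lemma vol_neq0 : vol e != 0. Proof. by rewrite vol1 oner_eq0. Qed.

Lemma alt_psi : alt_form (g2_psi phi g vol).
Proof.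
apply: (@alt_hodge _ _ _ 3 4 _ _ e) => //.
- exact: dot_scalarr.
- exact: dot_scalarl.
- exact: vol_neq0.
Qed.

Lemma brk_form k (a : kform V k.+1) (h : seq nat -> R) (t : k.-tuple V) i j J :
  alt_form a -> (forall I, size I = k.+1 -> all rng I -> a (bvs e k.+1 I) = h I) ->
  size J = k -> all rng J -> tval t = map b J ->
  a [tuple of br (b i) (b j) :: t] = brk cst h i j J.
Proof.
move=> Ha aE sJ rJ tJ; rewrite (alt_form_head_bv _ _ Ha) /brk sumLE.
apply: eq_big_seq => m; rewrite -rng_iota => rm; congr (_ * _).
rewrite -aE /= ?sJ ?rm //; congr (a _); apply: val_inj.
by apply: etrans _ (esym (bvs_val _)); rewrite /= ?tJ ?sJ.
Qed.

Lemma dphi_bvs J : size J = 4%N -> all rng J ->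
  ce_diff br phi (bvs e 4 J) = dphi_c cst phc J.
Proof.
move=> sJ rJ; rewrite ce_diff3E /dphi_c /d3_c.
move: J sJ rJ => [|i0 [|i1 [|i2 [|i3 [|? ?]]]]] //= sJ /and5P[r0 r1 r2 r3 _].
have E x y z w : rng z -> rng w -> phi [tuple br (b x) (b y); b z; b w]
    = brk cst (at3 phc) x y [:: z; w].
  move=> rz rw; have H : all rng [:: z; w] by rewrite /= rz rw.
  rewrite -(@brk_form 2 phi (at3 phc) [tuple b z; b w] x y [:: z; w] phi_alt
    (fun I sI _ => at3_phc sI) erefl H erefl).
  by congr (phi _); apply: val_inj.
by rewrite bvs_val //= !E.
Qed.

Lemma dpsi_bvs J : size J = 5%N -> all rng J ->
  ce_diff br (g2_psi phi g vol) (bvs e 5 J) = d4_c cst (psi_c phc) J.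
Proof.
move=> sJ rJ; rewrite ce_diff4E /d4_c.
move: J sJ rJ => [|i0 [|i1 [|i2 [|i3 [|i4 [|? ?]]]]]] //= sJ.
move=> /andP[r0 /and5P[r1 r2 r3 r4 _]].
set psi := g2_psi phi g vol.
have E x y z w u : rng z -> rng w -> rng u ->
    psi [tuple br (b x) (b y); b z; b w; b u]
    = brk cst (psi_c phc) x y [:: z; w; u].
  move=> rz rw ru; have H : all rng [:: z; w; u] by rewrite /= rz rw ru.
  rewrite -(@brk_form 3 psi (psi_c phc) [tuple b z; b w; b u] x y [:: z; w; u] alt_psi
    psi_bvs erefl H erefl).
  by congr (psi _); apply: val_inj.
by rewrite bvs_val //= !E.
Qed.

Lemma star_dphi_bvs J : size J = 3%N -> all rng J ->
  hodge g (k := 4) (l := 3) vol (ce_diff br phi) (bvs e 3 J) = star_dphi_c cst phc J.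
Proof.
move=> sJ rJ; apply: (@hodge_bvs 4 3 _ _ _ _ erefl vol_alt vol_bvs star_ok3) => //.
- exact: alt_ce_diff3.
- by move=> I sI rI; apply: dphi_bvs.
Qed.

End Frame.

(** * The torsion, the connection and the instanton equations in coordinates *)
Section Frame.
Variables (R : rcfType) (V : vectType R) (br : {bilinear V -> V -> V}).
Variables (g : {dot V for idfun}) (vol : kform V 7) (phi : kform V 3).
Variables (e : 7.-tuple V).
Hypotheses (oB : orthonormal_basis g e) (brC : forall x, br x x = 0).
Hypotheses (vol_alt : alt_form vol) (vol1 : vol e = 1) (phi_alt : alt_form phi).

Let eB : basis_of {:V} e := proj1 oB.
Let dimV : \dim {:V} = 7%N := size_basis eB.

Notation b := (bv e).
Notation cst := (cst br g e).
Notation phc := (phc phi e).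

Lemma cform_dot k J : size J = k -> all rng J ->
  cform e k J =1 wedge1 (fun i => g (tnth (bvs e k J) i)).
Proof.
move=> sJ rJ v; congr (\det _); apply/matrixP => i j; rewrite !mxE tnth_mktuple.
have : rng (nth 0%N J i) by apply: (allP rJ); rewrite mem_nth // sJ.
case: (nth 0%N J i) => // m; rewrite /rng /= ltnS => m7.
rewrite (coord_orthonormal _ _ oB) dotC -bv_tnth; congr (g (bv e _.+1) _).
by rewrite inordK.
Qed.

Lemma wedge_dphi_phi : wedge (ce_diff br phi) phi e = tau_c cst phc.
Proof.
have phE := alt_form_subs eB subs3_check phi_alt.
rewrite (eq_wedge (frefl _) phE).
have W v : wedge (ce_diff br phi)
     (fun v => \sum_(J <- subs 3) phi (bvs e 3 J) * cform e 3 J v) v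
   = \sum_(J <- subs 3) phi (bvs e 3 J) * wedge (ce_diff br phi) (cform e 3 J) v.
  elim: (subs 3) => [|J s IH].
    rewrite big_nil -[RHS](@wedge0r _ _ 4 3 (ce_diff br phi) v).
    by apply: (eq_wedge (frefl _)) => x; rewrite big_nil.
  rewrite big_cons -IH -wedgeZr -wedgeDr.
  by apply: (eq_wedge (frefl _)) => x; rewrite big_cons.
rewrite W /tau_c sumLE; apply: eq_big_seq => J HJ.
have [sJ rJ] := (subs_size HJ, subs_rng HJ).
rewrite at3_phc //; congr (_ * _).
rewrite -(star_dphi_bvs oB brC vol_alt vol1 phi_alt sJ rJ).
rewrite (@hodgeE _ _ g 4 3 vol _ _ _ _ _ e) ?vol1 ?oner_eq0 ?divr1 //.
- by apply: eq_wedge => //; apply: cform_dot.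
- exact: dot_scalarr.
- exact: alt_ce_diff3.
Qed.

Lemma hodge_dphi_phi :
  hodge g (k := 7) (l := 0) vol (wedge (ce_diff br phi) phi) [tuple] = tau_c cst phc.
Proof.
have E : [tuple of e ++ [tuple]] = e :> (7 + 0).-tuple V.
  by apply: val_inj; rewrite /= cats0.
rewrite (@hodge_basis _ _ g 7 0 vol _ _ _ _ e [tuple]) //.
- by rewrite E vol1 divr1 wedge_dphi_phi.
- exact: dot_scalarr.
- by apply: (@alt_wedge _ _ 4 3) => //; apply: alt_ce_diff3.
- by rewrite E vol1 oner_eq0.
- by case.
- by case.
Qed.

Let T := g2_torsion br phi g vol.

Lemma alt_torsion : alt_form T.
Proof.
apply: alt_formB; first exact: alt_formZ.
apply: (@alt_hodge _ _ _ 4 3 _ _ e) => //.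
- exact: dot_scalarr.
- exact: dot_scalarl.
- by rewrite vol1 oner_eq0.
- exact: alt_ce_diff3.
Qed.

Lemma bvs3 i j k : bvs e 3 [:: i; j; k] = [tuple b i; b j; b k].
Proof. by apply: val_inj; rewrite /= bvs_val. Qed.

Lemma torsion_bv i j k : rng i -> rng j -> rng k ->
  T [tuple b i; b j; b k] = tor_c cst phc i j k.
Proof.
move=> ri rj rk; rewrite /T /g2_torsion hodge_dphi_phi /tor_c -bvs3.
rewrite star_dphi_bvs //=; last by rewrite ri rj rk.
by rewrite bvs3.
Qed.

Section Slots.
Variables (a : kform V 3).
Hypothesis Ha : alt_form a.

Let slot (t : 3.-tuple V) (i : 'I_3) c x y :
  a (set_slot t i (c *: x + y)) = c * a (set_slot t i x) + a (set_slot t i y).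
Proof. exact: alt_form_slot. Qed.

Lemma alt3_lin1 y z : scalar (fun x => a [tuple x; y; z]).
Proof.
move=> c x x'; have E u : set_slot [tuple 0; y; z] ord0 u = [tuple u; y; z].
  by apply: val_inj; rewrite /= !enum_ordSl enum_ord0.
by rewrite -(E (c *: x + x')) -(E x) -(E x') slot.
Qed.

Lemma alt3_lin2 x z : scalar (fun y => a [tuple x; y; z]).
Proof.
move=> c y y'; have E u : set_slot [tuple x; 0; z] (lift ord0 ord0) u = [tuple x; u; z].
  by apply: val_inj; rewrite /= !enum_ordSl enum_ord0.
by rewrite -(E (c *: y + y')) -(E y) -(E y') slot.
Qed.

Lemma alt3_lin3 x y : scalar (fun z => a [tuple x; y; z]).
Proof.
move=> c z z'; have E u : set_slot [tuple x; y; 0] (lift ord0 (lift ord0 ord0)) u = [tuple x; y; u].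
  by apply: val_inj; rewrite /= !enum_ordSl enum_ord0.
by rewrite -(E (c *: z + z')) -(E z) -(E z') slot.
Qed.

Lemma alt3_swap12 x y z : a [tuple y; x; z] = - a [tuple x; y; z].
Proof.
have a0 u : a [tuple u; u; z] = 0 by apply: (@alt_form_eq0 _ _ _ _ _ ord0 (lift ord0 ord0)).
have := a0 (1 *: x + y); rewrite alt3_lin1 !alt3_lin2 !a0 !mul1r add0r addr0 => /eqP.
by rewrite addrC addr_eq0 => /eqP.
Qed.

Lemma alt3_swap23 x y z : a [tuple x; z; y] = - a [tuple x; y; z].
Proof.
have a0 u : a [tuple x; u; u] = 0.
  by apply: (@alt_form_eq0 _ _ _ _ _ (lift ord0 ord0) (lift ord0 (lift ord0 ord0))).
have := a0 (1 *: y + z); rewrite alt3_lin2 !alt3_lin3 !a0 !mul1r add0r addr0 => /eqP.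
by rewrite addrC addr_eq0 => /eqP.
Qed.

Lemma alt3_diag x z : a [tuple x; x; z] = 0.
Proof. by apply: (@alt_form_eq0 _ _ _ _ _ ord0 (lift ord0 ord0)). Qed.

End Slots.

Variables (lambda : R) (D : {bilinear V -> V -> V}) (Dl : V -> V -> V).
Hypotheses (lcD : levi_civita br g D)
  (lDl : lambda_connection br phi g vol lambda D Dl).

Lemma DlE x y z : g (Dl x y) z = g (D x y) z + lambda / 2 * T [tuple x; y; z].
Proof. exact: lDl. Qed.

Lemma Dl_linl y : linear (Dl^~ y).
Proof.
move=> c x x'; apply: (dot_nondeg (g := g)) => z /=.
rewrite dotDl dotZl !DlE (alt3_lin1 alt_torsion) linearPl dotDl dotZl; ring.
Qed.

Lemma Dl_linr x : linear (Dl x).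
Proof.
move=> c y y'; apply: (dot_nondeg (g := g)) => z /=.
rewrite dotDl dotZl !DlE (alt3_lin2 alt_torsion) linearPr dotDl dotZl; ring.
Qed.

Lemma brN x y : br y x = - br x y.
Proof.
have := brC (x + y); rewrite linearDl !linearDr !brC addr0 add0r => /eqP.
by rewrite addrC addr_eq0 => /eqP.
Qed.

Lemma koszul x y z :
  g (D x y) z = 2^-1 * (g (br x y) z - g (br y z) x + g (br z x) y).
Proof.
have [met tor] := lcD.
have := met x y z; have := met y z x; have := met z x y.
rewrite -!tor !dotBl ![g _ (D _ _)]dotC.
move=> H1 H2 H3.
apply: (mulfI (_ : 2 != 0 :> R)); first by rewrite pnatr_eq0.
rewrite mulrA divff ?pnatr_eq0 // mul1r.
lra.
Qed.

Lemma Dl_bv i j k : rng i -> rng j -> rng k ->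
  g (Dl (b i) (b j)) (b k) = gam_c cst (tor_c cst phc) lambda i j k.
Proof. by move=> ri rj rk; rewrite DlE koszul torsion_bv. Qed.

Lemma curvature_bv x y u v : rng x -> rng y -> rng u -> rng v ->
  g (curvature br Dl (b x) (b y) (b u)) (b v) =
  curv_c cst (gam_c cst (tor_c cst phc) lambda) x y u v.
Proof.
move=> rx ry ru rv; rewrite /curvature !dotBl.
have Er p q : g (Dl p q) (b v) = \sum_(m <- iota 1 7) g q (b m) * g (Dl p (b m)) (b v).
  pose h : {linear V -> V} := HB.pack (Dl p) (GRing.isLinear.Build _ _ _ _ (Dl p) (Dl_linr p)).
  rewrite {1}(bv_expand oB q) -[Dl p _]/(h _) linear_sum dot_suml.
  by apply: eq_bigr => m _; rewrite linearZ dotZl.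
have El p q : g (Dl p q) (b v) = \sum_(m <- iota 1 7) g p (b m) * g (Dl (b m) q) (b v).
  pose h : {linear V -> V} := HB.pack (Dl^~ q) (GRing.isLinear.Build _ _ _ _ (Dl^~ q) (Dl_linl q)).
  rewrite {1}(bv_expand oB p) -[Dl _ q]/(h _) linear_sum dot_suml.
  by apply: eq_bigr => m _; rewrite linearZ dotZl.
rewrite (Er (b x)) (Er (b y)) (El (br _ _)) /curv_c sumLE -!sumrB.
by apply: eq_big_seq => m; rewrite -rng_iota => rm; rewrite !Dl_bv.
Qed.

Definition curv_form (u w : V) : kform V 2 := fun xy =>
  g (curvature br Dl (tnth xy ord0) (tnth xy ord_max) u) w.

Lemma curv_scalarr y u w : scalar (fun x => g (curvature br Dl x y u) w).
Proof.
move=> c x x'; rewrite /curvature linearPl !Dl_linl Dl_linr -dotZl -dotDl.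
congr (g _ w); rewrite !opprD.
by rewrite [X in X + _ = _]addrACA [LHS]addrACA -!scalerBr.
Qed.

Lemma curvN x y u : curvature br Dl y x u = - curvature br Dl x y u.
Proof.
rewrite /curvature [br y x]brN; pose h : {linear V -> V} :=
  HB.pack (Dl^~ u) (GRing.isLinear.Build _ _ _ _ (Dl^~ u) (Dl_linl u)).
rewrite -[Dl (- _) u]/(h _) linearN /= opprK !opprB.
by rewrite addrC addrA.
Qed.

Lemma alt_curv_form u w : alt_form (curv_form u w).
Proof.
apply: (@alt_form2 _ _ (fun x y => g (curvature br Dl x y u) w)).
- move=> x c y y'; rewrite /= ![curvature br Dl x _ u]curvN !dotNl.
  by rewrite curv_scalarr opprD mulrN.
- by move=> y; apply: curv_scalarr.
- move=> x; rewrite /curvature subrr brC.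
  pose h : {linear V -> V} :=
    HB.pack (Dl^~ u) (GRing.isLinear.Build _ _ _ _ (Dl^~ u) (Dl_linl u)).
  by rewrite -[Dl 0 u]/(h _) linear0 subrr dot0l.
Qed.

(** The value on the six basis vectors other than e_w. Expanding psi over the complements of the
    triples of indices, only the pairs I such that I and w form a triple of phi contribute. *)
Lemma wedge_psi (a : kform V 2) w : alt_form a -> rng w ->
  wedge a (g2_psi phi g vol) (bvs e 6 (compl [:: w])) =
  (-1) ^+ odd w.+1 * \sum_(I <- subs 2) a (bvs e 2 I) * at3 phc (I ++ [:: w]).
Proof.
move=> Ha rw.
have psiE : g2_psi phi g vol =1 fun v =>
    \sum_(J <- subs 3) ((-1) ^+ star_sign (compl J) * at3 phc J) * cform e 4 (compl J) v.
  move=> v; rewrite (alt_form_subs eB subs4_check (alt_psi oB vol_alt vol1 phi_alt)).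
  have P : perm_eq (subs 4) (map compl (subs 3)) by vm_compute.
  apply: etrans (perm_big _ P) _.
  rewrite big_map.
  apply: eq_big_seq => J HJ.
  congr (_ * _).
  have c2 : compl (compl J) = J /\ size (compl J) = 4%N /\ uniq (compl J).
    move: J HJ; suff : all (fun J => [&& compl (compl J) == J, size (compl J) == 4%N &
      uniq (compl J)]) (subs 3).
      by move/allP => H J /H /and3P[/eqP H1 /eqP H2 H3]; split; [exact: H1|split].
    by vm_compute.
  case: c2 => cc [s4 u4]; rewrite psi_bvs ?compl_rng //.
  rewrite /psi_c /star_c u4 cc /sg; case: (star_sign _); first by rewrite expr1 mulN1r.
  by rewrite expr0 mul1r.
rewrite (eq_wedge (alt_form_subs eB subs2_check Ha) psiE) wedge_sum mulr_sumr.
apply: eq_big_seq => I HI.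
have [sI rI] := (subs_size HI, subs_rng HI).
rewrite -at3_phc ?size_cat ?sI // (alt_form_subs eB subs3_check phi_alt).
rewrite !mulr_sumr; apply: eq_big_seq => J HJ.
have [sJ rJ] := (subs_size HJ, subs_rng HJ).
have /allP/(_ w) := wedge_star_ok; rewrite -rng_iota => /(_ rw).
move=> /allP/(_ _ HI)/allP/(_ _ HJ)/eqP/(congr1 (fun z : int => z%:~R : R)).
rewrite !intrM !intr_sign => EE.
have sc : size (compl J) = 4%N.
  move: J HJ {sJ rJ EE}; suff : all (fun J => size (compl J) == 4%N) (subs 3).
    by move/allP => H J /H /eqP.
  by vm_compute.
have sw : size (compl [:: w]) = 6%N.
  move: rw; rewrite rng_iota => rw; apply/eqP; move: w rw {EE}; apply/allP.
  by vm_compute.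
have rIw : all rng (I ++ [:: w]) by rewrite all_cat rI /all rw.
have sIw : size (I ++ [:: w]) = 3%N by rewrite size_cat sI.
have rIJ : all rng (I ++ compl J) by rewrite all_cat rI compl_rng.
have sIJ : size (I ++ compl J) = 6%N by rewrite size_cat sI sc.
rewrite (wedge_cform e sI sc) (cform_bvs eB sIJ sw rIJ (compl_rng _)).
rewrite (cform_bvs eB sJ sIw rJ rIw) (at3_phc phi e sJ).
have aux (x s p E1 E2 t : R) : E1 * s = t * E2 -> x * (s * p) * E1 = t * (x * (p * E2)).
  move=> E; transitivity (x * p * (E1 * s)); first ring.
  by rewrite E; ring.
exact: aux EE.
Qed.

Lemma curv_form_scalaru xy w : scalar (fun u => curv_form u w xy).
Proof.
move=> c u u'; rewrite /curv_form /curvature !Dl_linr -dotZl -dotDl.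
congr (g _ w); rewrite !opprD.
by rewrite [X in X + _ = _]addrACA [LHS]addrACA -!scalerBr.
Qed.

(** The wedge product with psi is a 6-form, so it is given by seven numbers, one for each omitted
    index w; these are the numbers of [wedge_psi]. Both sides are bilinear in u and v. *)
Lemma instantonP :
  g2_instanton br phi g vol Dl <->
  (forall w u v, rng w -> rng u -> rng v ->
     inst_c cst phc (gam_c cst (tor_c cst phc) lambda) w u v = 0).
Proof.
have key w u v : rng w -> rng u -> rng v ->
    inst_c cst phc (gam_c cst (tor_c cst phc) lambda) w u v =
    \sum_(I <- subs 2) curv_form (b u) (b v) (bvs e 2 I) * at3 phc (I ++ [:: w]).
  move=> rw ru rv; rewrite /inst_c sumLE; apply: eq_big_seq => I HI.
  have [sI rI] := (subs_size HI, subs_rng HI); rewrite mulrC; congr (_ * _).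
  rewrite /curv_form !tnth_mktuple curvature_bv //.
  - by apply: (allP rI); rewrite mem_nth // sI.
  - by apply: (allP rI); rewrite mem_nth // sI.
split=> [inst w u v rw ru rv|H u w v].
  rewrite key //; have := inst (b u) (b v) (bvs e 6 (compl [:: w])).
  rewrite (wedge_psi (alt_curv_form (b u) (b v)) rw) => /eqP.
  by rewrite mulf_eq0 signr_eq0 => /eqP.
have H2 : wedge (curv_form u w) (g2_psi phi g vol) =1 fun=> 0.
  have Halt : alt_form (wedge (curv_form u w) (g2_psi phi g vol)).
    by apply: alt_wedge; [apply: alt_curv_form | apply: (alt_psi oB)].
  apply: (@alt_form_eq_subs _ _ _ eB 6 _ _ Halt (alt_zero _ _)) => K HK.
  have [m rm ->] : exists2 m, rng m & K = compl [:: m].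
    have : K \in map (fun m => compl [:: m]) (iota 1 7).
      by rewrite -(perm_mem (_ : perm_eq (subs 6) _)) //; vm_compute.
    by case/mapP => m; rewrite -rng_iota; exists m.
  rewrite (wedge_psi (alt_curv_form u w) rm).
  apply/eqP; rewrite mulf_eq0 signr_eq0 /=; apply/eqP.
  pose S u w := \sum_(I <- subs 2) curv_form u w (bvs e 2 I) * at3 phc (I ++ [:: m]).
  have SE p q : S p q = \sum_(i <- iota 1 7) \sum_(j <- iota 1 7)
     g p (b i) * g q (b j) * S (b i) (b j).
    have Sp r : S p r = \sum_(i <- iota 1 7) g p (b i) * S (b i) r.
      under [RHS]eq_bigr do rewrite mulr_sumr.
      rewrite exchange_big; apply: eq_bigr => I _.
      under [RHS]eq_bigr do rewrite mulrA.
      rewrite -mulr_suml; congr (_ * _).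
      pose h : {scalar V} := HB.pack (fun u => curv_form u r (bvs e 2 I))
        (GRing.isLinear.Build _ _ _ _ _ (curv_form_scalaru (bvs e 2 I) r)).
      rewrite -[LHS]/(h p) {1}(bv_expand oB p) linear_sum.
      by apply: eq_bigr => i _; rewrite linearZ.
    rewrite Sp; apply: eq_bigr => i _.
    under [RHS]eq_bigr do rewrite -mulrA.
    rewrite -mulr_sumr; congr (_ * _).
    under [RHS]eq_bigr do rewrite mulr_sumr.
    rewrite exchange_big; apply: eq_bigr => I _.
    under [RHS]eq_bigr do rewrite mulrA.
    rewrite -mulr_suml; congr (_ * _).
    rewrite /curv_form {1}(bv_expand oB q) dot_sumr.
    by apply: eq_bigr => j _; rewrite dotZr.
  rewrite -[LHS]/(S u w) SE big1_seq // => i; rewrite -rng_iota => /= ri.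
  rewrite big1_seq // => j; rewrite -rng_iota => /= rj.
  by rewrite /S -key // H // mulr0.
exact: H2.
Qed.

End Frame.

(** * The cross product and adapted bases through given vectors *)
Section Cross.
Variables (R : rcfType) (V : vectType R) (g : {dot V for idfun}).
Variables (e : 7.-tuple V) (phi : kform V 3).
Hypotheses (oB : orthonormal_basis g e) (phiE : phi =1 g2_model e).

Notation b := (bv e).
Let eB : basis_of {:V} e := proj1 oB.
Let phi_alt : alt_form phi := alt_g2_model phiE.

Definition cross x y := \sum_(m <- iota 1 7) phi [tuple x; y; b m] *: b m.

Lemma dot_cross x y z : g (cross x y) z = phi [tuple x; y; z].
Proof.
pose h : {scalar V} := HB.pack (fun z => phi [tuple x; y; z])
  (GRing.isLinear.Build _ _ _ _ _ (alt3_lin3 phi_alt x y)).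
rewrite -[RHS]/(h z) (bv_expand oB z) (dot_sumr g) (linear_sum h).
apply: eq_big_seq => m; rewrite -rng_iota => rm; rewrite (dotZr g) (linearZ_LR h).
congr (_ * _); rewrite /cross dot_suml (bigD1_seq m) ?iota_uniq -?rng_iota //=.
rewrite dotZl (dot_bv oB rm rm) (eqxx m) mulr1 big1_seq ?addr0 // => i.
rewrite -rng_iota => /andP[nim ri].
by rewrite dotZl (dot_bv oB ri rm) (negPf nim) mulr0.
Qed.

Definition minor_poly (X Y Z : nat -> R) (p q r : nat) : R :=
  X p * (Y q * Z r - Y r * Z q) - Y p * (X q * Z r - X r * Z q)
  + Z p * (X q * Y r - X r * Y q).
Definition model_poly (X Y Z : nat -> R) : R :=
  let m := minor_poly X Y Z in
  (m 1 2 7)%N + (m 3 4 7)%N + (m 5 6 7)%N + (m 1 3 5)%N - (m 1 4 6)%N - (m 2 3 6)%N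
  - (m 2 4 5)%N.

Lemma phi_coord x y z : phi [tuple x; y; z] =
  model_poly (fun i => g x (b i)) (fun i => g y (b i)) (fun i => g z (b i)).
Proof.
rewrite phiE g2_model_sum /model3 !big_cons big_nil /model_poly.
set m := minor_poly _ _ _.
have E p q r : rng p -> rng q -> rng r ->
    cform e 3 [:: p; q; r] [tuple x; y; z] = m p q r.
  move=> rp rq rr; rewrite (cform_dot oB) //=; last by rewrite rp rq rr.
  pose M i j := g (b (nth 0%N [:: p; q; r] i)) [:: x; y; z]`_j.
  rewrite /wedge1 (_ : \matrix_(_, _) _ = \matrix_(i < 3, j < 3) M i j).
    rewrite det3E /M /m /minor_poly /= ![g (b _) _]dotC; ring.
  by apply/matrixP => i j; rewrite !mxE tnth_mktuple (tnth_nth 0).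
by rewrite !E // !mul1r !mulN1r addr0 !addrA.
Qed.

Lemma phi_coord_bv x y k : rng k -> phi [tuple x; y; b k] =
  model_poly (fun i => g x (b i)) (fun i => g y (b i)) (fun i => (k == i)%:R).
Proof. by move=> rk; rewrite phi_coord /model_poly /minor_poly !(dot_bv oB rk). Qed.

Lemma dot_bv_sum x y : g x y =
  g x (b 1) * g y (b 1) + g x (b 2) * g y (b 2) + g x (b 3) * g y (b 3)
  + g x (b 4) * g y (b 4) + g x (b 5) * g y (b 5) + g x (b 6) * g y (b 6)
  + g x (b 7) * g y (b 7).
Proof.
rewrite {1}(bv_expand oB y) (dot_sumr g).
transitivity (\sum_(m <- iota 1 7) g x (b m) * g y (b m)).
  by apply: eq_bigr => m _; rewrite dotZr mulrC.
by rewrite /= !big_cons big_nil addr0 !addrA.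
Qed.

(** A polynomial identity of degree 4 in the coordinates, checked in one adapted basis. *)
Lemma cross_norm a x y :
  g (cross a x) (cross a y) = g a a * g x y - g a x * g a y.
Proof.
rewrite (dot_bv_sum (cross a x)) !dot_cross !phi_coord_bv //.
rewrite (dot_bv_sum a a) (dot_bv_sum a x) (dot_bv_sum a y) (dot_bv_sum x y).
pose A i := g a (b i); pose X i := g x (b i); pose Y i := g y (b i).
rewrite -!/(A _) -!/(X _) -!/(Y _) /model_poly /minor_poly /=; ring.
Qed.

Lemma phi_rot x y z : phi [tuple x; y; z] = phi [tuple y; z; x].
Proof. by rewrite (alt3_swap12 phi_alt) (alt3_swap23 phi_alt) opprK. Qed.

Lemma cross_anti x y : cross y x = - cross x y.
Proof.
by apply: (dot_nondeg (g := g)) => z; rewrite dotNl !dot_cross (alt3_swap12 phi_alt).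
Qed.

Lemma cross_dotl x y : g (cross x y) x = 0.
Proof. by rewrite dot_cross phi_rot phi_rot alt3_diag. Qed.

Lemma cross_dotr x y : g (cross x y) y = 0.
Proof. by rewrite cross_anti dotNl cross_dotl oppr0. Qed.

Lemma cross_add x y z : cross (x + y) z = cross x z + cross y z.
Proof.
apply: (dot_nondeg (g := g)) => w; rewrite dotDl !dot_cross.
by rewrite -[x]scale1r (alt3_lin1 phi_alt) mul1r scale1r.
Qed.

Lemma cross_addr x y z : cross x (y + z) = cross x y + cross x z.
Proof. by rewrite cross_anti cross_add opprD -!cross_anti. Qed.

Lemma crossNr x y : cross x (- y) = - cross x y.
Proof.
apply: (dot_nondeg (g := g)) => z; rewrite dotNl !dot_cross.
pose h : {scalar V} := HB.pack (fun y => phi [tuple x; y; z])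
  (GRing.isLinear.Build _ _ _ _ _ (alt3_lin2 phi_alt x z)).
exact: (linearN h y).
Qed.

Lemma cross_cross a y : cross a (cross a y) = g a y *: a - g a a *: y.
Proof.
apply: (dot_nondeg (g := g)) => z.
rewrite dotBl !dotZl dot_cross alt3_swap23 // -dot_cross cross_norm (dotC g z y); ring.
Qed.

(** Polarization in a of the double cross product formula. *)
Lemma cross_swap a c y : g a c = 0 -> g a y = 0 -> g c y = 0 ->
  cross a (cross c y) = - cross c (cross a y).
Proof.
move=> ac ay cy; have := cross_cross (a + c) y.
rewrite !cross_add !cross_addr !cross_cross !(dotDl, dotDr) (dotC g c a) ac ay cy.
rewrite !addr0 add0r !scale0r !sub0r scalerDl opprD.
rewrite -!addrA => /addrI; rewrite !addrA => /(canRL (addrK _)).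
by rewrite subrr => /eqP; rewrite addr_eq0 => /eqP.
Qed.

(** G2 acts transitively on such triples: the other vectors are forced to be the cross products
    e_2 = e_7 x e_1, e_3 = e_5 x e_1 and e_4 = e_1 x e_6, and the double cross product formula
    gives all products of basis vectors, hence phi and the scalar products. *)
Lemma adapted_basis u v x :
  g u u = 1 -> g v v = 1 -> g x x = 1 -> g u v = 0 -> g u x = 0 -> g v x = 0 ->
  g (cross u v) x = 0 ->
  exists e' : 7.-tuple V,
    [/\ orthonormal_basis g e', phi =1 g2_model e' &
      [/\ bv e' 5 = u, bv e' 6 = v, bv e' 7 = cross u v & bv e' 1 = x]].
Proof.
move=> uu vv xx uv ux vx wx.
pose e1 := x; pose e5 := u; pose e6 := v; pose e7 := cross u v.
pose e2 := cross e7 x; pose e3 := cross u x; pose e4 := cross x v.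
have ww : g e7 e7 = 1 by rewrite /e7 cross_norm uu vv uv mulr0 subr0 mulr1.
have uw : g u e7 = 0 by rewrite dotC cross_dotl.
have vw : g v e7 = 0 by rewrite dotC cross_dotr.
have cc a y : g a a = 1 -> g a y = 0 -> cross a (cross a y) = - y.
  by move=> aa ay; rewrite cross_cross aa ay scale0r sub0r scale1r.

(* the multiplication table of the cross product on e_1, ..., e_7 *)
have t56 : cross e5 e6 = e7 by [].
have t67 : cross e6 e7 = e5.
  by rewrite /e7 (cross_anti v u) crossNr cc ?opprK // dotC.
have t75 : cross e7 e5 = e6 by rewrite cross_anti cc ?opprK.
have t71 : cross e7 e1 = e2 by [].
have t51 : cross e5 e1 = e3 by [].
have t16 : cross e1 e6 = e4 by [].
have xw : g x e7 = 0 by rewrite dotC.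
have xu : g x u = 0 by rewrite dotC.
have xv : g x v = 0 by rewrite dotC.
have vu : g v u = 0 by rewrite dotC.
have wu : g e7 u = 0 by rewrite dotC.
have wv : g e7 v = 0 by rewrite dotC.
have t12 : cross e1 e2 = e7 by rewrite /e2 (cross_anti x) crossNr cc ?opprK.
have t13 : cross e1 e3 = e5 by rewrite /e3 (cross_anti x) crossNr cc ?opprK.
have t14 : cross e1 e4 = - e6 by rewrite cc.
have t72 : cross e7 e2 = - e1 by rewrite cc.
have t53 : cross e5 e3 = - e1 by rewrite cc.
have t64 : cross e6 e4 = e1 by rewrite /e4 (cross_anti v) crossNr cc ?opprK.
have t54 : cross e5 e4 = e2.
  by rewrite /e4 cross_swap // t56 cross_anti opprK.
have t63 : cross e6 e3 = e2.
  by rewrite /e3 cross_swap // (cross_anti x v) crossNr opprK t54.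
have t74 : cross e7 e4 = - e3.
  by rewrite /e4 cross_swap // (cross_anti v e7) t67 crossNr opprK cross_anti.
have t62 : cross e6 e2 = - e3.
  by rewrite /e2 cross_swap // (cross_anti x v) crossNr opprK t74.
have t73 : cross e7 e3 = e4.
  by rewrite /e3 (cross_anti x u) crossNr cross_swap // opprK t75.
have t52 : cross e5 e2 = - e4 by rewrite /e2 cross_swap // t73.
have t34 : cross e3 e4 = e7.
  rewrite /e4 cross_swap //.
  - by rewrite (cross_anti v e3) t63 crossNr opprK t12.
  - by rewrite /e3 cross_dotr.
  - by rewrite /e3 dot_cross alt3_swap23 // -dot_cross wx oppr0.

pose t := [tuple e1; e2; e3; e4; e5; e6; e7].
have d11 : g e1 e1 = 1 by [].
have d12 : g e1 e2 = 0 by rewrite dotC cross_dotr.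
have d13 : g e1 e3 = 0 by rewrite dotC cross_dotr.
have d14 : g e1 e4 = 0 by rewrite dotC cross_dotl.
have d15 : g e1 e5 = 0 by [].
have d16 : g e1 e6 = 0 by [].
have d17 : g e1 e7 = 0 by [].
have d22 : g e2 e2 = 1 by rewrite /e2 cross_norm ww xx wx mulr0 subr0 mulr1.
have d23 : g e2 e3 = 0.
  by rewrite /e2 /e3 (cross_anti x e7) (cross_anti x u) dotNl dotNr opprK cross_norm
    wu xu mulr0 mulr0 subr0.
have d24 : g e2 e4 = 0.
  by rewrite /e2 /e4 (cross_anti x e7) dotNl cross_norm wv xv mulr0 mulr0 subr0 oppr0.
have d25 : g e2 e5 = 0 by rewrite -t54 cross_dotl.
have d26 : g e2 e6 = 0 by rewrite -t63 cross_dotl.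
have d27 : g e2 e7 = 0 by rewrite cross_dotl.
have d33 : g e3 e3 = 1 by rewrite /e3 cross_norm uu xx ux mulr0 subr0 mulr1.
have d34 : g e3 e4 = 0.
  by rewrite /e3 /e4 (cross_anti x u) dotNl cross_norm uv xv mulr0 mulr0 subr0 oppr0.
have d35 : g e3 e5 = 0 by rewrite cross_dotl.
have d36 : g e3 e6 = 0 by rewrite -[e3]opprK -t62 dotNl cross_dotl oppr0.
have d37 : g e3 e7 = 0 by rewrite -[e3]opprK -t74 dotNl cross_dotl oppr0.
have d44 : g e4 e4 = 1 by rewrite /e4 cross_norm vv xx xv mulr0 subr0 mulr1.
have d45 : g e4 e5 = 0 by rewrite -[e4]opprK -t52 dotNl cross_dotl oppr0.
have d46 : g e4 e6 = 0 by rewrite cross_dotr.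
have d47 : g e4 e7 = 0 by rewrite -t73 cross_dotl.
have d55 : g e5 e5 = 1 by [].
have d56 : g e5 e6 = 0 by [].
have d57 : g e5 e7 = 0 by [].
have d66 : g e6 e6 = 1 by [].
have d67 : g e6 e7 = 0 by [].
have d77 : g e7 e7 = 1 by [].
have f12 z : phi [tuple e1; e2; z] = g e7 z by rewrite -dot_cross t12.
have f13 z : phi [tuple e1; e3; z] = g e5 z by rewrite -dot_cross t13.
have f14 z : phi [tuple e1; e4; z] = - g e6 z by rewrite -dot_cross t14 dotNl.
have f51 z : phi [tuple e5; e1; z] = g e3 z by rewrite -dot_cross t51.
have f15 z : phi [tuple e1; e5; z] = - g e3 z by rewrite alt3_swap12 // f51.
have f16 z : phi [tuple e1; e6; z] = g e4 z by rewrite -dot_cross t16.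
have f71 z : phi [tuple e7; e1; z] = g e2 z by rewrite -dot_cross t71.
have f17 z : phi [tuple e1; e7; z] = - g e2 z by rewrite alt3_swap12 // f71.
have f52 z : phi [tuple e5; e2; z] = - g e4 z by rewrite -dot_cross t52 dotNl.
have f25 z : phi [tuple e2; e5; z] = g e4 z by rewrite alt3_swap12 // f52 opprK.
have f62 z : phi [tuple e6; e2; z] = - g e3 z by rewrite -dot_cross t62 dotNl.
have f26 z : phi [tuple e2; e6; z] = g e3 z by rewrite alt3_swap12 // f62 opprK.
have f72 z : phi [tuple e7; e2; z] = - g e1 z by rewrite -dot_cross t72 dotNl.
have f27 z : phi [tuple e2; e7; z] = g e1 z by rewrite alt3_swap12 // f72 opprK.
have f34 z : phi [tuple e3; e4; z] = g e7 z by rewrite -dot_cross t34.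
have f53 z : phi [tuple e5; e3; z] = - g e1 z by rewrite -dot_cross t53 dotNl.
have f35 z : phi [tuple e3; e5; z] = g e1 z by rewrite alt3_swap12 // f53 opprK.
have f63 z : phi [tuple e6; e3; z] = g e2 z by rewrite -dot_cross t63.
have f36 z : phi [tuple e3; e6; z] = - g e2 z by rewrite alt3_swap12 // f63.
have f73 z : phi [tuple e7; e3; z] = g e4 z by rewrite -dot_cross t73.
have f37 z : phi [tuple e3; e7; z] = - g e4 z by rewrite alt3_swap12 // f73.
have f54 z : phi [tuple e5; e4; z] = g e2 z by rewrite -dot_cross t54.
have f45 z : phi [tuple e4; e5; z] = - g e2 z by rewrite alt3_swap12 // f54.
have f64 z : phi [tuple e6; e4; z] = g e1 z by rewrite -dot_cross t64.
have f46 z : phi [tuple e4; e6; z] = - g e1 z by rewrite alt3_swap12 // f64.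
have f74 z : phi [tuple e7; e4; z] = - g e3 z by rewrite -dot_cross t74 dotNl.
have f47 z : phi [tuple e4; e7; z] = g e3 z by rewrite alt3_swap12 // f74 opprK.
have f56 z : phi [tuple e5; e6; z] = g e7 z by rewrite -dot_cross t56.
have f75 z : phi [tuple e7; e5; z] = g e6 z by rewrite -dot_cross t75.
have f57 z : phi [tuple e5; e7; z] = - g e6 z by rewrite alt3_swap12 // f75.
have f67 z : phi [tuple e6; e7; z] = g e5 z by rewrite -dot_cross t67.
have D := (d11,d12,d13,d14,d15,d16,d17,d22,d23,d24,d25,d26,d27,d33,
  d34,d35,d36,d37,d44,d45,d46,d47,d55,d56,d57,d66,d67,d77).
have oB' : orthonormal_basis g t.
  apply: orthonormal_basisP; first exact: size_basis eB.
  have dE p q : (q < 7)%N -> (p <= q)%N -> g [:: e1; e2; e3; e4; e5; e6; e7]`_p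
      [:: e1; e2; e3; e4; e5; e6; e7]`_q = (p == q)%:R.
    by move: p q => [|[|[|[|[|[|[|p]]]]]]] [|[|[|[|[|[|[|q]]]]]]] //= _ _; rewrite D.
  move=> i j; rewrite !(tnth_nth 0); have [ij|/ltnW ji] := leqP i j.
    by rewrite dE.
  by rewrite dotC eq_sym dE.
exists t; split=> //.
apply: (alt_form_eq_subs (proj1 oB')) => // [|I HI]; first exact: alt_g2_model.
rewrite (at3_phc phi t (subs_size HI)).
rewrite (g2_model_val (proj1 oB') (phi := g2_model t)) ?(subs_size HI) ?(subs_rng HI) //.
have F := (f12, f13, f14, f15, f16, f17, f25, f26, f27, f34, f35,
  f36, f37, f45, f46, f47, f56, f57, f67).
have F' := (f34, f35, f36, f37, f45, f46, f47, f56, f57, f67).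
move: I HI; apply: conj_allP; let l := eval vm_compute in (subs 3) in change (subs 3) with l.
cbv [conj_all]; repeat split; rewrite /at3 /phc /=;
first [rewrite F | rewrite phi_rot F'];
by first [rewrite D | rewrite dotC D]; rewrite ?oppr0.
Qed.

End Cross.

(** * The instanton equations when the commutator lies in an associative subspace *)
(** Tables are given on increasing indices and extended by antisymmetry in the first two indices, or
    in all three. *)
Definition alt2 (R : zmodType) (t : nat -> nat -> nat -> R) i j k : R :=
  match Nat.compare i j with
  | Lt => t i j k | Gt => - t j i k | Eq => 0 end.

Definition alt3 (R : zmodType) (t : nat -> nat -> nat -> R) i j k : R :=
  match Nat.compare i j, Nat.compare j k, Nat.compare i k with
  | Lt, Lt, _ => t i j k
  | Lt, Gt, Lt => - t i k j
  | Lt, Gt, Gt => t k i j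
  | Gt, Lt, Lt => - t j i k
  | Gt, Lt, Gt => t j k i
  | Gt, Gt, _ => - t k j i
  | _, _, _ => 0
  end.

(** Evaluation of the index combinatorics only: reducing everything would also unfold the operations
    of the field. *)
Ltac vmc := repeat match goal with
  | |- context [uniq ?J] => let v := eval vm_compute in (uniq J) in change (uniq J) with v
  | |- context [star_sign ?J] =>
    let v := eval vm_compute in (star_sign J) in change (star_sign J) with v
  | |- context [compl ?J] => let v := eval vm_compute in (compl J) in change (compl J) with v
  | |- context [subs ?J] => let v := eval vm_compute in (subs J) in change (subs J) with v
  end.
Ltac evb := cbv [dphi_c d3_c d4_c brk sumL foldr iota nth sg].

Section Cal.
Variables (R : rcfType) (x y : nat -> nat -> R).

Definition fstd_sorted (i j k : nat) : R :=
  (match i, j, k with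
  | 1, 2, 7 => 1%R | 3, 4, 7 => 1%R | 5, 6, 7 => 1%R | 1, 3, 5 => 1%R
  | 1, 4, 6 => (-1)%R | 2, 3, 6 => (-1)%R | 2, 4, 5 => (-1)%R
  | _, _, _ => 0%R
  end)%N.
Definition fstd := alt3 fstd_sorted.

(** The upper triangle of x, since coclosedness makes x symmetric. *)
Definition xs a j := (match a, j with
  | 2, 1 => x 1 2 | 3, 1 => x 1 3 | 3, 2 => x 2 3 | _, _ => x a j end)%N.

(** The component on e_i and e_j of the 2-form on <e_1, ..., e_4> whose coordinates are u in the
    self-dual basis e^13 - e^24, - e^14 - e^23, e^12 + e^34 and v in the anti-self-dual basis
    e^13 + e^24, e^14 - e^23, e^12 - e^34. *)
Definition sdasd (u v : nat -> R) (i j : nat) : R :=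
  (match i, j with
  | 1, 3 => (u 1%N + v 1%N)%R | 2, 4 => (v 1%N - u 1%N)%R
  | 1, 4 => (v 2%N - u 2%N)%R | 2, 3 => (- u 2%N - v 2%N)%R
  | 1, 2 => (u 3%N + v 3%N)%R | 3, 4 => (u 3%N - v 3%N)%R
  | _, _ => 0%R
  end)%N.

Definition idx k := (match k with 5 => 1 | 6 => 2 | 7 => 3 | _ => 0 end)%N.

(** The row a of x and of y describes the 2-form - de^(4+a). *)
Definition ccal_sorted (i j k : nat) : R :=
  (match k with
  | 5 | 6 | 7 => sdasd (xs (idx k)) (y (idx k)) i j
  | _ => 0%R
  end)%N.
Definition ccal := alt2 ccal_sorted.

Definition str := x 1%N 1%N + x 2%N 2%N + x 3%N 3%N.

(** The torsion has the same shape: x is replaced by x - (2/3) tr x, y by - y, and there is a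
    component on e_5, e_6, e_7. *)
Definition tcal_sorted (i j k : nat) : R :=
  (match i, j, k with
  | 5, 6, 7 => (4%R / 3%R * str)%R
  | _, _, (5 | 6 | 7) =>
     sdasd (fun m => xs (idx k) m - (if Nat.eqb m (idx k) then 2%R / 3%R * str else 0))%R
       (fun m => - y (idx k) m)%R i j
  | _, _, _ => 0%R
  end)%N.
Definition tcal := alt3 tcal_sorted.

Ltac evf := cbv [at3 fstd fstd_sorted alt3 Nat.compare nth].
Ltac evc := cbv [ccal ccal_sorted alt2 sdasd xs idx Nat.compare].

Lemma sum_fstd (D : seq nat -> R) : sumL (subs 3) (fun J => at3 fstd J * D J) =
  D [:: 1; 2; 7]%N + D [:: 3; 4; 7]%N + D [:: 5; 6; 7]%N + D [:: 1; 3; 5]%N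
  - D [:: 1; 4; 6]%N - D [:: 2; 3; 6]%N - D [:: 2; 4; 5]%N.
Proof. vmc; cbv [sumL foldr]; evf; ring. Qed.

Lemma tau_cal : tau_c ccal fstd = - 4 * str.
Proof.
rewrite /tau_c sum_fstd.
rewrite /star_dphi_c /star_c.
vmc; evb; evf; evc; rewrite /str; ring.
Qed.

Lemma tor_cal J : J \in subs 3 -> at3 (tor_c ccal fstd) J = at3 tcal J.
Proof.
move: J; apply: conj_allP; vmc; cbv [conj_all]; repeat split;
rewrite /at3 /= /tor_c tau_cal /star_dphi_c /star_c; vmc; evb; evf; evc;
cbv [tcal tcal_sorted alt3 sdasd xs Nat.eqb Nat.compare idx]; rewrite /str;
field; rewrite ?pnatr_eq0 //.
Qed.

Lemma inst_fstd (c : nat -> nat -> nat -> R) G w u v : rng w ->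
  inst_c c fstd G w u v =
  (let K i j := curv_c c G i j u v in
   match w with
   | 1 => (K 2 7)%N + (K 3 5)%N - (K 4 6)%N | 2 => - (K 1 7)%N - (K 3 6)%N - (K 4 5)%N
   | 3 => (K 4 7)%N - (K 1 5)%N + (K 2 6)%N | 4 => - (K 3 7)%N + (K 1 6)%N + (K 2 5)%N
   | 5 => (K 6 7)%N + (K 1 3)%N - (K 2 4)%N | 6 => - (K 5 7)%N - (K 1 4)%N - (K 2 3)%N
   | _ => (K 1 2)%N + (K 3 4)%N + (K 5 6)%N end).
Proof.
rewrite /inst_c; vmc.
by case: w => [|[|[|[|[|[|[|[|w]]]]]]]] // _; cbv [sumL foldr cat]; evf; ring.
Qed.

Ltac evT := cbv [tcal tcal_sorted alt3 sdasd xs Nat.eqb Nat.compare idx].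

Variable lam : R.
Let G := gam_c ccal tcal lam.
Let E := inst_c ccal fstd G.

Ltac evE := rewrite /E !inst_fstd // /curv_c; evb; rewrite /G /gam_c; evc; evT; rewrite /str.

(** The squared norms of x and y. *)
Definition asq : R := x 1%N 1%N ^+ 2 + x 2%N 2%N ^+ 2 + x 3%N 3%N ^+ 2
  + 2 * (x 1%N 2%N ^+ 2 + x 1%N 3%N ^+ 2 + x 2%N 3%N ^+ 2).
Definition bsq : R := y 1%N 1%N ^+ 2 + y 1%N 2%N ^+ 2 + y 1%N 3%N ^+ 2
  + (y 2%N 1%N ^+ 2 + y 2%N 2%N ^+ 2 + y 2%N 3%N ^+ 2)
  + (y 3%N 1%N ^+ 2 + y 3%N 2%N ^+ 2 + y 3%N 3%N ^+ 2).

(** Three contractions of the instanton equations that are invariant under the subgroup of G2 that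
    preserves <e_5, e_6, e_7>. By invariance they only involve |x|^2, |y|^2 and (tr x)^2. *)
Lemma trace_zzz : (E 5 6 7)%N + (E 6 7 5)%N + (E 7 5 6)%N =
  2^-1 * ((1 + lam) ^+ 2 * asq - (1 + 2 * lam - 5 / 3 * lam ^+ 2) * str ^+ 2).
Proof. evE; rewrite /asq; field; rewrite ?pnatr_eq0 //. Qed.

Lemma trace_zrr :
  (E 5 1 3)%N - (E 5 2 4)%N - (E 6 1 4)%N - (E 6 2 3)%N + (E 7 1 2)%N + (E 7 3 4)%N =
  (2 - 4 * lam) * asq + 3 / 2 * (1 - lam) ^+ 2 * bsq
  - (2^-1 - 5 / 3 * lam + 2^-1 * lam ^+ 2) * str ^+ 2.
Proof. evE; rewrite /asq /bsq; field; rewrite ?pnatr_eq0 //. Qed.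

Lemma trace_rrz :
  (E 1 3 5)%N - (E 3 1 5)%N - ((E 2 4 5)%N - (E 4 2 5)%N)
  - ((E 1 4 6)%N - (E 4 1 6)%N) - ((E 2 3 6)%N - (E 3 2 6)%N)
  + ((E 1 2 7)%N - (E 2 1 7)%N) + ((E 3 4 7)%N - (E 4 3 7)%N) =
  (lam ^+ 2 - 1) * (2 * asq + bsq) + (1 - 8 / 3 * lam + 5 / 3 * lam ^+ 2) * str ^+ 2.
Proof. evE; rewrite /asq /bsq; field; rewrite ?pnatr_eq0 //. Qed.

(** For lam <> 1 the third contraction can be divided by 1 - lam, and eliminating |x|^2 and |y|^2
    leaves lam (3 lam^2 - 4 lam + 5) (tr x)^2 = 0, where the quadratic factor has no real root.
    If lam = 0 or tr x = 0, the three relations force |x|^2 = |y|^2 = 0. *)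
Lemma cal_dichotomy : (forall w u v, rng w -> rng u -> rng v -> E w u v = 0) ->
  lam = 1 \/ asq = 0 /\ bsq = 0.
Proof.
move=> E0; have [->|lam1] := eqVneq lam 1; [by left|right].
have := trace_zzz; have := trace_zrr; have := trace_rrz.
rewrite !E0 // !(subr0, addr0) => W Rr G0.
have l1 : lam - 1 != 0 by rewrite subr_eq0.
have a0 : 0 <= asq by rewrite /asq; nra.
have b0 : 0 <= bsq by rewrite /bsq; nra.
move: (asq) (bsq) a0 b0 W Rr G0 => a b a0 b0 W Rr G0.
have t0 : 0 <= str ^+ 2 by rewrite sqr_ge0.
move: (str ^+ 2) t0 W Rr G0 => t t0 W Rr G0.
have {}G0 : (1 + lam) ^+ 2 * a = (1 + 2 * lam - 5 / 3 * lam ^+ 2) * t by lra.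
have {}W : (1 + lam) * (2 * a + b) = (1 - 5 / 3 * lam) * t.
  by apply: (mulfI l1); apply/eqP; rewrite -subr_eq0; apply/eqP; rewrite W; field.
have P : lam * (lam - 1) * (3 * lam ^+ 2 - 4 * lam + 5) * t = 0.
  apply: (mulfI (_ : 2 / 3 != 0 :> R)); first by rewrite mulf_neq0 ?invr_eq0 ?pnatr_eq0.
  rewrite mulr0; transitivity ((1 + lam) ^+ 2 * ((2 - 4 * lam) * a
      + 3 / 2 * (1 - lam) ^+ 2 * b - (2^-1 - 5 / 3 * lam + 2^-1 * lam ^+ 2) * t)
    - (2 - 4 * lam) * ((1 + lam) ^+ 2 * a - (1 + 2 * lam - 5 / 3 * lam ^+ 2) * t)
    - 3 / 2 * (1 - lam) ^+ 2 * ((1 + lam) * ((1 + lam) * (2 * a + b)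
      - (1 - 5 / 3 * lam) * t)
      - 2 * ((1 + lam) ^+ 2 * a - (1 + 2 * lam - 5 / 3 * lam ^+ 2) * t))).
    by field; rewrite ?pnatr_eq0.
  by rewrite -Rr G0 W !subrr !mulr0 !subrr !mulr0 subr0.
move/eqP: P; rewrite !mulf_eq0 (negPf l1) orbF.
have -> : (3 * lam ^+ 2 - 4 * lam + 5 == 0) = false by apply/negP => /eqP H; nra.
rewrite orbF => /orP[/eqP l0|/eqP t00].
  rewrite l0 in G0 W; lra.
rewrite t00 mulr0 in G0; rewrite t00 mulr0 in W; rewrite t00 mulr0 subr0 in Rr.
move/eqP: W; rewrite mulf_eq0 => /orP[/eqP lm|/eqP ab]; last by lra.
have lE : lam = -1 by lra.
rewrite lE in Rr; lra.
Qed.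

Hypothesis lam1 : lam = 1.
Hypothesis E0 : forall w u v, rng w -> rng u -> rng v -> E w u v = 0.

(** At lam = 1 the first contraction reads 3 |x|^2 = (tr x)^2, which is the equality case of the
    Cauchy-Schwarz inequality for x and the identity. *)
Lemma cal_scalar :
  [/\ x 1%N 1%N = str / 3, x 2%N 2%N = str / 3, x 3%N 3%N = str / 3,
      x 1%N 2%N = 0 & x 1%N 3%N = 0 /\ x 2%N 3%N = 0].
Proof.
have := trace_zzz; rewrite !E0 // lam1 !addr0 => /esym H.
have {}H : asq = str ^+ 2 / 3.
  move: H; rewrite /asq /str; move: (x _ _) (x _ _) (x _ _) (x _ _) (x _ _) (x _ _) => *; lra.
have S : (x 1%N 1%N - x 2%N 2%N) ^+ 2 + (x 1%N 1%N - x 3%N 3%N) ^+ 2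
   + (x 2%N 2%N - x 3%N 3%N) ^+ 2
   + 6 * (x 1%N 2%N ^+ 2 + x 1%N 3%N ^+ 2 + x 2%N 3%N ^+ 2) = 0.
  transitivity (3 * (asq - str ^+ 2 / 3)); last by rewrite H subrr mulr0.
  by rewrite /asq /str; field; rewrite ?pnatr_eq0.
have sq0 (p : R) : p ^+ 2 = 0 -> p = 0 by move/eqP; rewrite sqrf_eq0 => /eqP.
have p1 := sqr_ge0 (x 1%N 1%N - x 2%N 2%N).
have p2 := sqr_ge0 (x 1%N 1%N - x 3%N 3%N).
have p3 := sqr_ge0 (x 2%N 2%N - x 3%N 3%N).
have p4 := sqr_ge0 (x 1%N 2%N).
have p5 := sqr_ge0 (x 1%N 3%N).
have p6 := sqr_ge0 (x 2%N 3%N).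
have q1 : x 1%N 1%N - x 2%N 2%N = 0 by apply: sq0; lra.
have q2 : x 1%N 1%N - x 3%N 3%N = 0 by apply: sq0; lra.
by split; [rewrite /str; lra..| apply: sq0; lra | split; apply: sq0; lra].
Qed.

End Cal.

(** The connection is metric, so its curvature operators are skew. *)
Lemma inst_skew (R : numFieldType) (c f G : nat -> nat -> nat -> R) w u v :
  (forall i j k, rng i -> rng j -> rng k -> G i k j = - G i j k) -> rng u -> rng v ->
  inst_c c f G w v u = - inst_c c f G w u v.
Proof.
move=> GN ru rv; rewrite /inst_c !sumLE -sumrN; apply: eq_big_seq => I HI; rewrite -mulrN.
have [sI rI] := (subs_size HI, subs_rng HI).
have r0 : rng (nth 0%N I 0) by apply: (allP rI); rewrite mem_nth // sI.
have r1 : rng (nth 0%N I 1) by apply: (allP rI); rewrite mem_nth // sI.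
congr (_ * _); rewrite /curv_c !sumLE -sumrN; apply: eq_big_seq => m; rewrite -rng_iota => rm.
rewrite (GN (nth 0%N I 1) m v) // (GN (nth 0%N I 0) m v) // (GN (nth 0%N I 1) u m) //.
by rewrite (GN (nth 0%N I 0) u m) // (GN m u v) //; ring.
Qed.

Section Diag.
Variables (R : rcfType) (r : R) (y : nat -> nat -> R).

Definition xdiag (a j : nat) : R :=
  (match a, j with 1, 1 => r | 2, 2 => r | 3, 3 => r | _, _ => 0%R end)%N.

Notation c := (ccal xdiag y).
Notation T := (tcal xdiag y).
Let G := gam_c c T 1.
Let E := inst_c c (fstd R) G.

(** The number g(M e_i, e_j) for M = [j(e_a), j(e_b)] - (2/3) mu j(e_k) and mu = - 3 r. *)
Definition jrel (a b k i j : nat) : R :=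
  (c i 1%N a * c j 1%N b - c i 1%N b * c j 1%N a
  + (c i 2%N a * c j 2%N b - c i 2%N b * c j 2%N a)
  + (c i 3%N a * c j 3%N b - c i 3%N b * c j 3%N a)
  + (c i 4%N a * c j 4%N b - c i 4%N b * c j 4%N a)
  + 2 * r * c i j k).

(** For lam = 1 and x = r id the connection is trivial along <e_1, ..., e_4>, and along
    <e_5, e_6, e_7> it is - j on <e_1, ..., e_4> and 2 r times the cross product on
    <e_5, e_6, e_7>. *)
Definition g1 (i j k : nat) : R :=
  (if Nat.leb i 4 then 0%R else if Nat.leb j 4 then (if Nat.leb k 4 then - c j k i else 0)%R
   else if Nat.leb k 4 then 0%R else alt3 (fun _ _ _ => 2 * r)%R i j k)%N.

Lemma gam_diag J : J \in words 3 -> at3 G J = at3 g1 J.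
Proof.
move: J; apply: conj_allP; let l := eval vm_compute in (words 3) in change (words 3) with l.
cbv [conj_all].
repeat split; rewrite /at3 /= /G /gam_c /g1;
cbv [Nat.leb ccal ccal_sorted alt2 sdasd xs idx Nat.compare];
cbv [tcal tcal_sorted alt3 sdasd xs Nat.eqb Nat.compare idx]; rewrite /str /xdiag;
field; rewrite ?pnatr_eq0 //.
Qed.

(** What remains of the instanton equations: the contraction of the curvature with phi along e_w
    acts on <e_1, ..., e_4> only, by the defect of the bracket relation for j. *)
Definition instT (w u v : nat) : R :=
  (if Nat.leb u 4 then if Nat.leb v 4 then
     match w with 5 => jrel 6 7 5 u v | 6 => jrel 7 5 6 u v | 7 => jrel 5 6 7 u v | _ => 0%R end
   else 0%R else 0%R)%N.

Lemma alt2_anti (t : nat -> nat -> nat -> R) i j k : alt2 t j i k = - alt2 t i j k.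
Proof.
rewrite /alt2 (PeanoNat.Nat.compare_antisym i j).
by case: (Nat.compare i j); rewrite ?oppr0 ?opprK.
Qed.

Lemma g1_skew i j k : rng i -> rng j -> rng k -> g1 i k j = - g1 i j k.
Proof.
have L p : Nat.leb p 4 = (p <= 4)%N by move: p => [|[|[|[|[|p]]]]].
rewrite /g1 !L => ri rj rk; have [_|i4] := leqP i 4; first by rewrite oppr0.
have [_|j4] := leqP j 4; have [_|k4] := leqP k 4; rewrite ?oppr0 //.
  by rewrite /ccal alt2_anti.
move: i i4 ri => [|[|[|[|[|[|[|[|i]]]]]]]] // _ _;
move: j j4 rj => [|[|[|[|[|[|[|[|j]]]]]]]] // _ _;
by move: k k4 rk => [|[|[|[|[|[|[|[|k]]]]]]]] // _ _; rewrite /alt3 /= ?oppr0 ?opprK.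
Qed.

Lemma instT_skew w u v : instT w v u = - instT w u v.
Proof.
have J a b k i j : jrel a b k j i = - jrel a b k i j.
  by rewrite /jrel /ccal (alt2_anti _ i j); ring.
rewrite /instT; case: (Nat.leb u 4); case: (Nat.leb v 4); rewrite ?oppr0 //.
by move: w => [|[|[|[|[|[|[|[|w]]]]]]]]; rewrite ?oppr0 ?(J _ _ _ u v).
Qed.

Lemma inst_diag J : J \in [seq w :: K | w <- iota 1 7, K <- subs 2] ->
  at3 (inst_c c (fstd R) g1) J = at3 instT J.
Proof.
move: J; apply: conj_allP.
let l := eval vm_compute in [seq w :: K | w <- iota 1 7, K <- subs 2] in
  change [seq w :: K | w <- iota 1 7, K <- subs 2] with l.
cbv [conj_all].
repeat split; cbv [at3 nth]; rewrite inst_fstd // /curv_c /instT /jrel; evb; rewrite /g1;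
cbv [Nat.leb ccal ccal_sorted alt2 alt3 sdasd xs idx Nat.compare]; rewrite /xdiag; ring.
Qed.
End Diag.

(** * The instanton equations when the commutator lies in no associative subspace *)

(** The commutator is then spanned by e_5, e_6 and C e_7 + Z e_1 with C^2 + Z^2 = 1, Z <> 0, and
    the tables refer to the orthonormal basis

      e_4, e_3, C e_1 - Z e_7;  e_5, e_6, C e_7 + Z e_1;  e_2

    of two triples, the second one spanning the commutator, and a last vector. *)
Section NonCal.
Variables (R : rcfType) (S : nat -> nat -> R) (C Z lam : R).
Hypothesis CZ : C ^+ 2 + Z ^+ 2 = 1.

Definition fnc_sorted (i j k : nat) : R :=
  (match i, j, k with
  | 1, 2, 3 => (Z)%R
  | 1, 2, 6 => (- C)%R
  | 1, 3, 5 => (C)%R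
  | 1, 4, 7 => (- 1)%R
  | 1, 5, 6 => (- Z)%R
  | 2, 3, 4 => (- C)%R
  | 2, 4, 6 => (Z)%R
  | 2, 5, 7 => (- 1)%R
  | 3, 4, 5 => (- Z)%R
  | 3, 6, 7 => (- 1)%R
  | 4, 5, 6 => (C)%R
  | _, _, _ => 0%R
  end)%N.
Definition fnc := alt3 fnc_sorted.

(** The upper triangle of S, since coclosedness makes S symmetric. *)
Definition ss i j := (match i, j with
  | 2, 1 => S 1 2 | 3, 1 => S 1 3 | 3, 2 => S 2 3 | _, _ => S i j end)%N.

(** Coclosedness leaves only the brackets of the first triple with the last vector. *)
Definition cnc_sorted (i j k : nat) : R :=
  (match j, i, k with
  | 7, (1 | 2 | 3), 4 => (- ss i 1%N)%R
  | 7, (1 | 2 | 3), 5 => (- ss i 2%N)%R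
  | 7, (1 | 2 | 3), 6 => (- ss i 3%N)%R
  | _, _, _ => 0%R
  end)%N.
Definition cnc := alt2 cnc_sorted.

Definition tnc_sorted (i j k : nat) : R :=
  (match i, j, k with
  | 1, 2, 3 => ((1 / 3) * S 1%N 1%N * Z + (1 / 3) * S 2%N 2%N * Z + (1 / 3) * S 3%N 3%N * Z)%R
  | 1, 2, 4 => (C * S 1%N 3%N)%R
  | 1, 2, 5 => (C * S 2%N 3%N)%R
  | 1, 2, 6 => (- (1 / 3) * C * S 1%N 1%N - (1 / 3) * C * S 2%N 2%N + (2 / 3) * C * S 3%N 3%N)%R
  | 1, 3, 4 => (- C * S 1%N 2%N)%R
  | 1, 3, 5 => ((1 / 3) * C * S 1%N 1%N - (2 / 3) * C * S 2%N 2%N + (1 / 3) * C * S 3%N 3%N)%R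
  | 1, 3, 6 => (- C * S 2%N 3%N)%R
  | 1, 4, 5 => (- S 1%N 3%N * Z)%R
  | 1, 4, 6 => (S 1%N 2%N * Z)%R
  | 1, 4, 7 => (- (1 / 3) * S 1%N 1%N - (1 / 3) * S 2%N 2%N - (1 / 3) * S 3%N 3%N)%R
  | 1, 5, 6 => (- (1 / 3) * S 1%N 1%N * Z + (2 / 3) * S 2%N 2%N * Z + (2 / 3) * S 3%N 3%N * Z)%R
  | 2, 3, 4 => ((2 / 3) * C * S 1%N 1%N - (1 / 3) * C * S 2%N 2%N - (1 / 3) * C * S 3%N 3%N)%R
  | 2, 3, 5 => (C * S 1%N 2%N)%R
  | 2, 3, 6 => (C * S 1%N 3%N)%R
  | 2, 4, 5 => (- S 2%N 3%N * Z)%R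
  | 2, 4, 6 => (- (2 / 3) * S 1%N 1%N * Z + (1 / 3) * S 2%N 2%N * Z - (2 / 3) * S 3%N 3%N * Z)%R
  | 2, 5, 6 => (- S 1%N 2%N * Z)%R
  | 2, 5, 7 => (- (1 / 3) * S 1%N 1%N - (1 / 3) * S 2%N 2%N - (1 / 3) * S 3%N 3%N)%R
  | 3, 4, 5 => ((2 / 3) * S 1%N 1%N * Z + (2 / 3) * S 2%N 2%N * Z - (1 / 3) * S 3%N 3%N * Z)%R
  | 3, 4, 6 => (S 2%N 3%N * Z)%R
  | 3, 5, 6 => (- S 1%N 3%N * Z)%R
  | 3, 6, 7 => (- (1 / 3) * S 1%N 1%N - (1 / 3) * S 2%N 2%N - (1 / 3) * S 3%N 3%N)%R
  | 4, 5, 6 => (- (2 / 3) * C * S 1%N 1%N - (2 / 3) * C * S 2%N 2%N - (2 / 3) * C * S 3%N 3%N)%R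
  | _, _, _ => 0%R
  end)%N.
Definition tnc := alt3 tnc_sorted.

Definition str_nc := S 1%N 1%N + S 2%N 2%N + S 3%N 3%N.

Ltac evf := cbv [at3 fnc fnc_sorted alt3 Nat.compare nth].
Ltac evc := cbv [cnc cnc_sorted alt2 ss Nat.compare].
Ltac evT := cbv [tnc tnc_sorted alt3 Nat.compare].

Lemma sum_fnc (D : seq nat -> R) : sumL (subs 3) (fun J => at3 fnc J * D J) =
  (Z) * D [:: 1; 2; 3]%N
  + (- C) * D [:: 1; 2; 6]%N
  + (C) * D [:: 1; 3; 5]%N
  + (- 1) * D [:: 1; 4; 7]%N
  + (- Z) * D [:: 1; 5; 6]%N
  + (- C) * D [:: 2; 3; 4]%N
  + (Z) * D [:: 2; 4; 6]%N
  + (- 1) * D [:: 2; 5; 7]%N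
  + (- Z) * D [:: 3; 4; 5]%N
  + (- 1) * D [:: 3; 6; 7]%N
  + (C) * D [:: 4; 5; 6]%N.
Proof. vmc; cbv [sumL foldr]; evf; ring. Qed.

Lemma tau_nc : tau_c cnc fnc = 2 * str_nc.
Proof.
transitivity (2 * (C ^+ 2 + Z ^+ 2) * str_nc); last by rewrite CZ mulr1.
rewrite /tau_c sum_fnc /star_dphi_c /star_c; vmc; evb; evf; evc; rewrite /str_nc; ring.
Qed.

Lemma tor_nc J : J \in subs 3 -> at3 (tor_c cnc fnc) J = at3 tnc J.
Proof.
move: J; apply: conj_allP; vmc; cbv [conj_all]; repeat split;
rewrite /at3 /= /tor_c tau_nc /star_dphi_c /star_c; vmc; evb; evf; evc; evT;
rewrite /str_nc; field; rewrite ?pnatr_eq0 //.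
Qed.

Lemma inst_fnc (c : nat -> nat -> nat -> R) G w u v : rng w ->
  inst_c c fnc G w u v =
  (let K i j := curv_c c G i j u v in
   match w with
   | 1 => Z * (K 2 3)%N - C * (K 2 6)%N + C * (K 3 5)%N - (K 4 7)%N - Z * (K 5 6)%N
   | 2 => - Z * (K 1 3)%N + C * (K 1 6)%N - C * (K 3 4)%N + Z * (K 4 6)%N - (K 5 7)%N
   | 3 => Z * (K 1 2)%N - C * (K 1 5)%N + C * (K 2 4)%N - Z * (K 4 5)%N - (K 6 7)%N
   | 4 => (K 1 7)%N - C * (K 2 3)%N - Z * (K 2 6)%N + Z * (K 3 5)%N + C * (K 5 6)%N
   | 5 => C * (K 1 3)%N + Z * (K 1 6)%N + (K 2 7)%N - Z * (K 3 4)%N - C * (K 4 6)%N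
   | 6 => - C * (K 1 2)%N - Z * (K 1 5)%N + Z * (K 2 4)%N + (K 3 7)%N + C * (K 4 5)%N
   | _ => - (K 1 4)%N - (K 2 5)%N - (K 3 6)%N
   end).
Proof.
rewrite /inst_c; vmc.
by case: w => [|[|[|[|[|[|[|[|w]]]]]]]] // _; cbv [sumL foldr cat]; evf; ring.
Qed.

Let G := gam_c cnc tnc lam.
Let E := inst_c cnc fnc G.
Ltac evE := rewrite /E !inst_fnc // /curv_c; evb; rewrite /G /gam_c; evc; evT.

(** |S|^2 and the second elementary symmetric function of S. *)
Definition qS : R := S 1%N 1%N ^+ 2 + S 2%N 2%N ^+ 2 + S 3%N 3%N ^+ 2
  + 2 * (S 1%N 2%N ^+ 2 + S 1%N 3%N ^+ 2 + S 2%N 3%N ^+ 2).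
Definition hS : R := S 1%N 1%N * S 2%N 2%N + S 1%N 1%N * S 3%N 3%N + S 2%N 2%N * S 3%N 3%N
  - (S 1%N 2%N ^+ 2 + S 1%N 3%N ^+ 2 + S 2%N 3%N ^+ 2).

Let w0 := C ^+ 2 + Z ^+ 2 - 1.
Let w00 : w0 = 0. Proof. by rewrite /w0 CZ subrr. Qed.

(** Three invariant contractions of the instanton equations, as polynomials in lam, C, |S|^2 and
    the second symmetric function of S. Each holds modulo C^2 + Z^2 = 1, and the term with
    [w0] is the multiple of that relation. *)
Lemma trace_bwv : (E 7 4 1)%N + (E 7 5 2)%N + (E 7 6 3)%N = 4^-1 * (lam ^+ 2 - 1) * qS.
Proof.
transitivity (4^-1 * (lam ^+ 2 - 1) * qS + w0 * (lam ^+ 2 * (qS - hS) / 6)).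
  evE; rewrite /w0 /qS /hS; field; rewrite ?pnatr_eq0 //.
by rewrite w00 mul0r addr0.
Qed.

Lemma trace_wbv : (E 4 7 1)%N + (E 5 7 2)%N + (E 6 7 3)%N =
  - C ^+ 2 * lam * hS + lam / 2 * (hS + qS) - lam ^+ 2 * (hS / 6 + qS / 12) - 3 / 4 * qS.
Proof.
transitivity (- C ^+ 2 * lam * hS + lam / 2 * (hS + qS) - lam ^+ 2 * (hS / 6 + qS / 12)
  - 3 / 4 * qS + w0 * (lam / 2 * (qS + hS))).
  evE; rewrite /w0 /qS /hS; field; rewrite ?pnatr_eq0 //.
by rewrite w00 mul0r addr0.
Qed.

Lemma trace_alt : (E 4 7 1)%N + (E 5 7 2)%N + (E 6 7 3)%N
  - ((E 1 7 4)%N + (E 2 7 5)%N + (E 3 7 6)%N) =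
  lam * qS - lam ^+ 2 * (hS + qS / 2) - qS / 2.
Proof.
transitivity (lam * qS - lam ^+ 2 * (hS + qS / 2) - qS / 2
   + w0 * (lam * qS - lam ^+ 2 * (2 / 3 * hS + qS / 3))).
  evE; rewrite /w0 /qS /hS; field; rewrite ?pnatr_eq0 //.
by rewrite w00 mul0r addr0.
Qed.

(** The first contraction gives lam = 1 or lam = -1 unless S = 0. At lam = 1 the third one gives
    that the second symmetric function vanishes, and then the second one gives S = 0; at lam = -1
    the third one contradicts |S|^2 + 2 h = (tr S)^2 >= 0. *)
Lemma nc_zero : (forall w u v, rng w -> rng u -> rng v -> E w u v = 0) -> qS = 0.
Proof.
move=> E0; have := trace_bwv; have := trace_wbv; have := trace_alt.
rewrite !E0 // !(subr0, addr0).
have q0 : 0 <= qS by rewrite /qS; nra.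
have hq : 0 <= qS + 2 * hS.
  have -> : qS + 2 * hS = str_nc ^+ 2 by rewrite /qS /hS /str_nc; ring.
  exact: sqr_ge0.
move: (qS) (hS) q0 hq => q h q0 hq A B D.
have [//|nq] := eqVneq q 0.
have /eqP : (lam - 1) * (lam + 1) = 0.
  apply: (mulIf nq); rewrite mul0r.
  have -> : (lam - 1) * (lam + 1) * q = 4 * (4^-1 * (lam ^+ 2 - 1) * q).
    by field; rewrite ?pnatr_eq0.
  by rewrite -D mulr0.
rewrite mulf_eq0 => /orP[/eqP l|/eqP l].
- have lE : lam = 1 by lra.
  rewrite lE in A B; have h0 : h = 0 by lra.
  rewrite h0 in B; lra.
- have lE : lam = -1 by lra.
  rewrite lE in A; lra.
Qed.

End NonCal.

(** * From tables to a Lie algebra with an orthonormal basis *)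
Section Ext.
Variables (R : numFieldType).
Implicit Types (c f G : nat -> nat -> nat -> R).

Definition eq_rng f f' := forall i j k, rng i -> rng j -> rng k -> f i j k = f' i j k.

Lemma eq_sumL (T : eqType) (s : seq T) (F F' : T -> R) :
  (forall x, x \in s -> F x = F' x) -> sumL s F = sumL s F'.
Proof. by move=> H; rewrite !sumLE; apply: eq_big_seq. Qed.

Lemma at3_ext f f' J : eq_rng f f' -> size J = 3%N -> all rng J -> at3 f J = at3 f' J.
Proof.
move=> H; case: J => [|i [|j [|k [|? ?]]]] //= _ /and4P[ri rj rk _].
by rewrite /at3 /= H.
Qed.

Lemma brk_ext c c' (h h' : seq nat -> R) n a b J :
  eq_rng c c' -> (forall I, size I = n.+1 -> all rng I -> h I = h' I) ->
  rng a -> rng b -> size J = n -> all rng J -> brk c h a b J = brk c' h' a b J.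
Proof.
move=> Hc Hh ra rb sJ rJ; apply: eq_sumL => m; rewrite -rng_iota => rm.
by rewrite Hc // Hh //= ?sJ // rm.
Qed.

Lemma d3_ext c c' (h h' : seq nat -> R) J :
  eq_rng c c' -> (forall I, size I = 3%N -> all rng I -> h I = h' I) ->
  size J = 4%N -> all rng J -> d3_c c h J = d3_c c' h' J.
Proof.
move=> Hc Hh; case: J => [|i0 [|i1 [|i2 [|i3 [|? ?]]]]] //= _ /and5P[r0 r1 r2 r3 _].
have B a b p q : rng a -> rng b -> rng p -> rng q ->
    brk c h a b [:: p; q] = brk c' h' a b [:: p; q].
  by move=> ra rb rp rq; apply: (brk_ext (n := 2) Hc Hh) => //; rewrite /all rp rq.
by rewrite /d3_c /= !B.
Qed.

Lemma d4_ext c c' (h h' : seq nat -> R) J :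
  eq_rng c c' -> (forall I, size I = 4%N -> all rng I -> h I = h' I) ->
  size J = 5%N -> all rng J -> d4_c c h J = d4_c c' h' J.
Proof.
move=> Hc Hh; case: J => [|i0 [|i1 [|i2 [|i3 [|i4 [|? ?]]]]]] //= _.
move=> /andP[r0 /and5P[r1 r2 r3 r4 _]].
have B a b p q r : rng a -> rng b -> rng p -> rng q -> rng r ->
    brk c h a b [:: p; q; r] = brk c' h' a b [:: p; q; r].
  by move=> ra rb rp rq rr; apply: (brk_ext (n := 3) Hc Hh) => //; rewrite /all rp rq rr.
by rewrite /d4_c /= !B.
Qed.

Lemma star_ext k (h h' : seq nat -> R) J : star_ok k ->
  (forall I, size I = (7 - k)%N -> all rng I -> h I = h' I) ->
  size J = k -> all rng J -> star_c k h J = star_c k h' J.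
Proof.
rewrite /star_ok => /allP ok H sJ rJ; rewrite /star_c; case: ifP => // uJ.
have := ok _ (mem_words sJ rJ); rewrite uJ implyTb => /andP[/eqP sc _].
by rewrite H ?compl_rng.
Qed.

Lemma psi_ext f f' J : eq_rng f f' -> size J = 4%N -> all rng J -> psi_c f J = psi_c f' J.
Proof.
move=> H; apply: star_ext; first exact: star_ok4.
by move=> I sI rI; apply: at3_ext.
Qed.

Lemma star_dphi_ext c c' f f' J : eq_rng c c' -> eq_rng f f' ->
  size J = 3%N -> all rng J -> star_dphi_c c f J = star_dphi_c c' f' J.
Proof.
move=> Hc Hf; apply: star_ext; first exact: star_ok3.
move=> I sI rI; apply: d3_ext => // K sK rK; exact: at3_ext.
Qed.

Lemma tor_ext c c' f f' : eq_rng c c' -> eq_rng f f' -> eq_rng (tor_c c f) (tor_c c' f').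
Proof.
move=> Hc Hf i j k ri rj rk; rewrite /tor_c Hf //.
rewrite (star_dphi_ext Hc Hf) //; last by rewrite /all ri rj rk.
congr (_ * _ * _ - _); apply: eq_sumL => J HJ.
by rewrite (at3_ext Hf) ?(subs_size HJ) ?(subs_rng HJ) // (star_dphi_ext Hc Hf)
  ?(subs_size HJ) ?(subs_rng HJ).
Qed.

Lemma gam_ext c c' T T' lam : eq_rng c c' -> eq_rng T T' ->
  eq_rng (gam_c c T lam) (gam_c c' T' lam).
Proof. by move=> Hc HT i j k ri rj rk; rewrite /gam_c !Hc // HT. Qed.

Lemma inst_ext c c' f f' G G' : eq_rng c c' -> eq_rng f f' -> eq_rng G G' ->
  eq_rng (inst_c c f G) (inst_c c' f' G').
Proof.
move=> Hc Hf HG w u v rw ru rv; apply: eq_sumL => I HI.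
have [sI rI] := (subs_size HI, subs_rng HI).
rewrite (at3_ext Hf) ?size_cat ?sI ?all_cat ?rI ?/all ?rw //; congr (_ * _).
have r0 : rng (nth 0%N I 0) by apply: (allP rI); rewrite mem_nth // sI.
have r1 : rng (nth 0%N I 1) by apply: (allP rI); rewrite mem_nth // sI.
by apply: eq_sumL => m; rewrite -rng_iota => rm; rewrite !HG // Hc.
Qed.

Lemma compareP_lt i j : Nat.compare i j = Lt -> (i < j)%N.
Proof. by move/PeanoNat.Nat.compare_lt_iff/ssrnat.ltP. Qed.
Lemma compareP_gt i j : Nat.compare i j = Gt -> (j < i)%N.
Proof. by move/PeanoNat.Nat.compare_gt_iff/ssrnat.ltP. Qed.
Lemma compareP_eq i j : Nat.compare i j = Eq -> i = j.
Proof. by move/PeanoNat.Nat.compare_eq_iff. Qed.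

Lemma eq_opp0 (x : R) : x = - x -> x = 0.
Proof.
by move=> E; apply/eqP; move/eqP: E; rewrite -addr_eq0 -mulr2n mulrn_eq0.
Qed.

Lemma alt3_eq_rng (h t : nat -> nat -> nat -> R) :
  (forall i j k, h j i k = - h i j k) -> (forall i j k, h i k j = - h i j k) ->
  (forall J, J \in subs 3 -> at3 h J = at3 (alt3 t) J) -> eq_rng h (alt3 t).
Proof.
move=> h12 h23 H i j k ri rj rk.
have d12 p q : h p p q = 0 by exact: eq_opp0.
have d23 p q : h p q q = 0 by exact: eq_opp0.
have S p q r : rng p -> rng q -> rng r -> (p < q)%N -> (q < r)%N -> h p q r = t p q r.
  move=> rp rq rr pq qr; have := H [:: p; q; r]; rewrite /at3 /= => ->.
    rewrite /alt3; case E1: (Nat.compare p q).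
    - by move: pq; rewrite (compareP_eq E1) ltnn.
    - case E2: (Nat.compare q r) => //.
      + by move: qr; rewrite (compareP_eq E2) ltnn.
      + by move: (ltn_trans qr (compareP_gt E2)); rewrite ltnn.
    - by move: (ltn_trans pq (compareP_gt E1)); rewrite ltnn.
  by apply: mem_subs => //=; rewrite ?pq ?qr ?rp ?rq ?rr.
have d13 p q : h p q p = 0 by rewrite h23 d12 oppr0.
rewrite /alt3; case E1: (Nat.compare i j).
- by rewrite (compareP_eq E1) d12.
- have ij := compareP_lt E1; case E2: (Nat.compare j k).
  + by rewrite (compareP_eq E2) d23.
  + exact: S ij (compareP_lt E2).
  + have kj := compareP_gt E2; case E3: (Nat.compare i k).
    * by rewrite (compareP_eq E3) d13.
    * by rewrite h23 S // compareP_lt.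
    * by rewrite h23 h12 opprK S // compareP_gt.
- have ji := compareP_gt E1; case E2: (Nat.compare j k).
  + by rewrite (compareP_eq E2) d23.
  + have jk := compareP_lt E2; case E3: (Nat.compare i k).
    * by rewrite (compareP_eq E3) d13.
    * by rewrite h12 S // compareP_lt.
    * by rewrite h12 h23 opprK S // compareP_gt.
  + have kj := compareP_gt E2.
    by rewrite h12 h23 opprK h12 S.
Qed.

Lemma alt2_eq (h t : nat -> nat -> nat -> R) :
  (forall i j k, h j i k = - h i j k) ->
  (forall i j k, rng i -> rng j -> rng k -> (i < j)%N -> h i j k = t i j k) ->
  eq_rng h (alt2 t).
Proof.
move=> h12 H i j k ri rj rk; rewrite /alt2; case E: (Nat.compare i j).
- by rewrite (compareP_eq E); apply: eq_opp0.
- exact: H (compareP_lt E).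
- by rewrite h12 H // compareP_gt.
Qed.

End Ext.

Section Frame.
Variables (R : rcfType) (V : vectType R) (br : {bilinear V -> V -> V}).
Variables (g : {dot V for idfun}) (vol : kform V 7) (phi : kform V 3).
Variables (e : 7.-tuple V).
Hypotheses (oB : orthonormal_basis g e) (brC : forall x, br x x = 0).
Hypotheses (vol_alt : alt_form vol) (vol1 : vol e = 1) (phi_alt : alt_form phi).
Variables (lambda : R) (D : {bilinear V -> V -> V}) (Dl : V -> V -> V).
Hypotheses (lcD : levi_civita br g D)
  (lDl : lambda_connection br phi g vol lambda D Dl).
Variables (c : nat -> nat -> nat -> R) (f t : nat -> nat -> nat -> R).
Hypotheses (cE : eq_rng (cst br g e) c) (fE : eq_rng (phc phi e) f).
Hypothesis tE : forall J, J \in subs 3 -> at3 (tor_c c f) J = at3 (alt3 t) J.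

(** The form in which the tables of the previous parts are used: the torsion needs to be compared
    on increasing indices only, as both sides are alternating. *)
Lemma instanton_tableP :
  g2_instanton br phi g vol Dl <->
  (forall w u v, rng w -> rng u -> rng v ->
     inst_c c f (gam_c c (alt3 t) lambda) w u v = 0).
Proof.
have Ha := alt_torsion oB brC vol_alt vol1 phi_alt.
have TE : eq_rng (tor_c (cst br g e) (phc phi e)) (alt3 t).
  have H := torsion_bv oB brC vol_alt vol1 phi_alt.
  pose h i j k := g2_torsion br phi g vol [tuple bv e i; bv e j; bv e k].
  have Hh : eq_rng h (alt3 t).
    apply: alt3_eq_rng => [i j k|i j k|J HJ].
    - exact: alt3_swap12.
    - exact: alt3_swap23.
    rewrite -tE //; move: (subs_size HJ) (subs_rng HJ).
    case: J {HJ} => [|i [|j [|k [|? ?]]]] //= _ /and4P[ri rj rk _].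
    by rewrite /at3 /= /h H // (tor_ext cE fE).
  by move=> i j k ri rj rk; rewrite -H // -[LHS]/(h i j k) Hh.
have IE : eq_rng (inst_c (cst br g e) (phc phi e)
    (gam_c (cst br g e) (tor_c (cst br g e) (phc phi e)) lambda))
    (inst_c c f (gam_c c (alt3 t) lambda)).
  by apply: inst_ext => //; apply: gam_ext.
rewrite (instantonP oB brC vol_alt vol1 phi_alt lcD lDl).
split=> H w u v rw ru rv; first by rewrite -IE // H.
by rewrite IE // H.
Qed.

Lemma coclosed_table J : coclosed br phi g vol -> size J = 5%N -> all rng J ->
  d4_c c (psi_c f) J = 0.
Proof.
move=> cc sJ rJ.
rewrite -(d4_ext cE (h := psi_c (phc phi e))) ?sJ //.
  by rewrite -(dpsi_bvs br oB vol_alt vol1 phi_alt sJ rJ).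
by move=> I sI rI; apply: psi_ext.
Qed.

End Frame.

Section Subspaces.
Variables (R : rcfType) (V : vectType R) (g : {dot V for idfun}).

(** Each orthogonality condition lowers the dimension by at most one. *)
Lemma unit_perp (U : {vspace V}) (s : seq V) : (size s < \dim U)%N ->
  exists x, [/\ x \in U, g x x = 1 & forall y, y \in s -> g x y = 0].
Proof.
move=> sU.
have [W [WU dW Ws]] : exists W : {vspace V}, [/\ (W <= U)%VS, (\dim U <= \dim W + size s)%N &
    forall x y, x \in W -> y \in s -> g x y = 0].
  elim: s {sU} => [|z s [W [WU dW Ws]]]; first by exists U; split; rewrite // addn0.
  exists (W :&: orthov g <[z]>)%VS; split.
  - exact: subv_trans (capvSl _ _) WU.
  - have := leq_dim_orthov1 g z W; rewrite /= addnS; move: dW.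
    move: (\dim (W :&: _)) (\dim W) (\dim U) (size s) => a b d n; lia.
  - move=> x y; rewrite memv_cap mem_orthov1 => /andP[xW /eqP xz].
    by rewrite inE => /orP[/eqP->//|]; apply: Ws.
have W0 : W != 0%VS by rewrite -dimv_eq0; apply/eqP; lia.
pose x := vpick W; have x0 : x != 0 by rewrite vpick0.
have gx : 0 < g x x := dot_gt0 g x0.
exists ((Num.sqrt (g x x))^-1 *: x); split.
- by apply: memvZ; apply: (subvP WU); apply: memv_pick.
- rewrite dotZl dotZr mulrA -expr2 exprVn sqr_sqrtr ?ltW // mulVf //.
  by rewrite gt_eqF.
- by move=> y ys; rewrite dotZl (Ws x y) ?mulr0 // /x memv_pick.
Qed.

Lemma orthonormal_basis_of n (U : {vspace V}) (e : n.-tuple V) :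
  \dim U = n -> {subset e <= U} ->
  (forall i j, g (tnth e i) (tnth e j) = (i == j)%:R) -> basis_of U e.
Proof.
move=> dU eU oe.
rewrite basisEfree size_tuple dU leqnn andbT; apply/andP; split; last exact/span_subvP.
apply/freeP => k k0 i; have := congr1 (g^~ (tnth e i)) k0.
rewrite dot0l dot_suml (bigD1 i) //= big1 ?addr0 => [|j nji].
  by rewrite dotZl -tnth_nth oe eqxx /= mulr1.
by rewrite dotZl -tnth_nth oe (negPf nji) /= mulr0.
Qed.

Variable br : {bilinear V -> V -> V}.

Lemma br_derived x y : br x y \in derivedv br.
Proof.
rewrite (coord_vbasis (memvf x)) linear_sumlz memv_suml // => i _.
rewrite (coord_vbasis (memvf y)) linear_sumr memv_suml // => j _.
rewrite linearZl_LR linearZr_LR; apply/memvZ/memvZ/memv_span/allpairs_f; exact: memt_nth.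
Qed.

Lemma derived_sub (U : {vspace V}) : (forall x y, br x y \in U) -> (derivedv br <= U)%VS.
Proof. by move=> H; apply/span_subvP => _ /allpairsP[p [_ _ ->]]. Qed.

Hypotheses (brC : forall x, br x x = 0) (nil : two_step_nilpotent br).

Lemma br_central x z : z \in derivedv br -> br x z = 0.
Proof.
move=> zD; have H y w : y \in fullv -> w \in derivedv br ->
    br y w \in bracketv br fullv (derivedv br).
  move=> yV wD; rewrite (coord_vbasis yV) linear_sumlz memv_suml // => i _.
  rewrite (coord_vbasis wD) linear_sumr memv_suml // => j _.
  rewrite linearZl_LR linearZr_LR; apply/memvZ/memvZ/memv_span/allpairs_f; exact: memt_nth.
by have := H x z (memvf x) zD; rewrite (proj2 nil) memv0 => /eqP.
Qed.

Lemma br_central_l x z : z \in derivedv br -> br z x = 0.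
Proof. by move=> zD; rewrite (brN brC) br_central ?oppr0. Qed.

Lemma derived_neq0 : (forall x y, br x y = 0) -> False.
Proof.
move=> H; apply: (proj1 nil); apply/eqP; rewrite -subv0; apply: derived_sub => x y.
by rewrite H mem0v.
Qed.

Lemma br_bv_mem (e : 7.-tuple V) (U : {vspace V}) : basis_of {:V} e ->
  (forall i j, rng i -> rng j -> br (bv e i) (bv e j) \in U) -> forall x y, br x y \in U.
Proof.
move=> eB H x y; rewrite (coord_basis eB (memvf x)) linear_sumlz memv_suml // => i _.
rewrite (coord_basis eB (memvf y)) linear_sumr memv_suml // => j _.
rewrite linearZl_LR linearZr_LR; apply/memvZ/memvZ.
by rewrite -!tnth_nth -!bv_tnth H // /rng /= ltn_ord.
Qed.

Lemma cst_neq0 (e : 7.-tuple V) : orthonormal_basis g e ->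
  eq_rng (cst br g e) (fun _ _ _ => 0) -> False.
Proof.
move=> oB c0; apply: derived_neq0 => x y; apply/eqP; rewrite -memv0; move: x y.
apply: (br_bv_mem (proj1 oB)) => i j ri rj; rewrite memv0; apply/eqP.
rewrite (bv_expand oB (br _ _)) big1_seq // => m /andP[_]; rewrite -rng_iota => rm.
by rewrite -[g _ _]/(cst br g e i j m) c0 // scale0r.
Qed.

Lemma basis_of_bv (e : 7.-tuple V) (U : {vspace V}) (K : seq nat) :
  orthonormal_basis g e -> uniq K -> all rng K -> \dim U = size K ->
  (forall k, k \in K -> bv e k \in U) -> basis_of U [seq bv e k | k <- K].
Proof.
move=> oB uK rK dU KU.
apply: (@orthonormal_basis_of _ _ [tuple of [seq bv e k | k <- in_tuple K]] dU).
  by move=> _ /mapP[k kK ->]; apply: KU.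
move=> i j; rewrite !tnth_map (dot_bv oB) ?(allP rK) ?mem_tnth //.
by rewrite !(tnth_nth 0%N) nth_uniq.
Qed.

Lemma perp_bv (e : 7.-tuple V) (U : {vspace V}) (K : seq nat) q z :
  orthonormal_basis g e -> uniq K -> all rng K -> \dim U = size K ->
  (forall k, k \in K -> bv e k \in U) -> rng q -> q \notin K -> z \in U ->
  g z (bv e q) = 0.
Proof.
move=> oB uK rK dU KU rq qK zU.
suff : (U <= orthov g <[bv e q]>)%VS by move/subvP/(_ z zU); rewrite mem_orthov1 => /eqP.
rewrite -(span_basis (basis_of_bv oB uK rK dU KU)).
apply/span_subvP => _ /mapP[k kK ->]; rewrite mem_orthov1; apply/eqP.
apply: etrans (dot_bv oB (allP rK k kK) rq) _.
by case: eqP qK => // <-; rewrite kK.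
Qed.

End Subspaces.

(** * No instantons when the commutator lies in no associative subspace *)

(** The shape of the structure constants that follows from nilpotency alone: the indices 4, 5, 6
    are those of the commutator. *)
Definition rot_sorted (R : rcfType) (t : nat -> nat -> nat -> R) (i j k : nat) : R :=
  (match k with
  | 4 | 5 | 6 => match i, j with
     | 1, 2 => t i j k | 1, 3 => t i j k | 2, 3 => t i j k
     | 1, 7 => t i j k | 2, 7 => t i j k | 3, 7 => t i j k
     | _, _ => 0%R end
  | _ => 0%R
  end)%N.

(** Up to the factor Z the first nine of these components of d psi are the brackets of vectors of
    the first triple; once these vanish, the last three say that the brackets with the last vector
    are given by a symmetric matrix. *)
Lemma d4_rot (R : rcfType) (C Z : R) (t : nat -> nat -> nat -> R) :
  map (d4_c (alt2 (rot_sorted t)) (psi_c (fnc C Z)))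
    [:: [:: 1; 2; 4; 5; 7]; [:: 1; 2; 4; 6; 7]; [:: 1; 2; 5; 6; 7];
        [:: 1; 3; 4; 5; 7]; [:: 1; 3; 4; 6; 7]; [:: 1; 3; 5; 6; 7];
        [:: 2; 3; 4; 5; 7]; [:: 2; 3; 4; 6; 7]; [:: 2; 3; 5; 6; 7];
        [:: 1; 2; 3; 4; 7]; [:: 1; 2; 3; 5; 7]; [:: 1; 2; 3; 6; 7]]%N =
  [:: - ((t 1 2 6)%N * Z); (t 1 2 5)%N * Z; - ((t 1 2 4)%N * Z);
      - ((t 1 3 6)%N * Z); (t 1 3 5)%N * Z; - ((t 1 3 4)%N * Z);
      - ((t 2 3 6)%N * Z); (t 2 3 5)%N * Z; - ((t 2 3 4)%N * Z);
      - ((t 1 2 5)%N * C) - (t 1 3 6)%N * C - (t 2 7 6)%N + (t 3 7 5)%N;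
      (t 1 2 4)%N * C + (t 1 7 6)%N - (t 2 3 6)%N * C - (t 3 7 4)%N;
      (t 1 3 4)%N * C - (t 1 7 5)%N + (t 2 3 5)%N * C + (t 2 7 4)%N].
Proof.
rewrite /map; do !congr (_ :: _); rewrite /psi_c /star_c; evb; vmc;
cbv [star_c sg at3 nth alt2 rot_sorted fnc fnc_sorted alt3 Nat.compare]; ring.
Qed.

Section NonCalFrame.
Variables (R : rcfType) (V : vectType R) (br : {bilinear V -> V -> V}).
Variables (g : {dot V for idfun}) (vol : kform V 7) (phi : kform V 3).
Variables (e : 7.-tuple V) (C Z : R).
Hypotheses (oB : orthonormal_basis g e) (phiE : phi =1 g2_model e).
Hypotheses (vol_alt : alt_form vol) (vol1 : vol e = 1).
Hypothesis CZ : C ^+ 2 + Z ^+ 2 = 1.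

Notation b := (bv e).
Let eB : basis_of {:V} e := proj1 oB.
Let phi_alt : alt_form phi := alt_g2_model phiE.

Definition rot1 : V := C *: b 1 + (- Z) *: b 7.
Definition rot7 : V := Z *: b 1 + C *: b 7.
Definition rot_frame : 7.-tuple V :=
  [tuple b 4; b 3; rot1; b 5; b 6; rot7; b 2].

Definition rot_coord (i m : nat) : R :=
  (match i, m with
  | 1, 4 => 1%R | 2, 3 => 1%R | 3, 1 => C | 3, 7 => (- Z)%R
  | 4, 5 => 1%R | 5, 6 => 1%R | 6, 1 => Z | 6, 7 => C | 7, 2 => 1%R
  | _, _ => 0%R end)%N.

Lemma rot_coordE i m : rng i -> rng m -> g (bv rot_frame i) (b m) = rot_coord i m.
Proof.
move=> ri rm; have -> : bv rot_frame i = match i with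
  | 1 => b 4 | 2 => b 3 | 3 => rot1 | 4 => b 5 | 5 => b 6 | 6 => rot7 | 7 => b 2
  | _ => 0%R end%N by case: i ri => [|[|[|[|[|[|[|[|i]]]]]]]].
have H p : rng p -> g (b p) (b m) = (p == m)%:R by move=> rp; apply: (dot_bv oB).
case: i ri => [|[|[|[|[|[|[|[|i]]]]]]]] // _; rewrite /rot1 /rot7 ?dotDl ?dotZl !H //;
by move: m rm {H} => [|[|[|[|[|[|[|[|m]]]]]]]] // _ /=;
   rewrite ?mulr1 ?mulr0 ?addr0 ?add0r.
Qed.

Lemma rot_frame_orthonormal : orthonormal_basis g rot_frame.
Proof.
apply: orthonormal_basisP; first exact: size_basis eB.
have H i j : rng i -> rng j -> g (bv rot_frame i) (bv rot_frame j) = (i == j)%:R.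
  move=> ri rj; rewrite (dot_bv_sum oB) !rot_coordE //.
  by move: i j ri rj => [|[|[|[|[|[|[|[|i]]]]]]]] [|[|[|[|[|[|[|[|j]]]]]]]] //= _ _;
    rewrite ?(mulr0, mul0r, addr0, add0r, mulr1) -?expr2 ?sqrrN ?(addrC (Z ^+ 2)) ?CZ //; ring.
by move=> i j; rewrite -!bv_tnth H // /rng /= ltn_ord.
Qed.

Lemma alt_form_slot2 k (a : kform V k) (v : k.-tuple V) i c d x y : alt_form a ->
  a (set_slot v i (c *: x + d *: y)) = c * a (set_slot v i x) + d * a (set_slot v i y).
Proof.
move=> Ha; rewrite alt_form_slot // -[d *: y]addr0 alt_form_slot //.
suff -> : a (set_slot v i 0) = 0 by rewrite addr0.
have := alt_form_slot v i (-1) 0 0 Ha.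
by rewrite scaler0 addr0 mulN1r addNr.
Qed.

Lemma vol_rot_frame : vol rot_frame = 1.
Proof.
have s3 u w : set_slot [tuple b 4; b 3; w; b 5; b 6; u; b 2] (inord 2) w
   = [tuple b 4; b 3; w; b 5; b 6; u; b 2].
  by apply: val_inj; rewrite /= !enum_ordSl enum_ord0 /= -!val_eqE /= !inordK.
have S3 u x y c d : vol [tuple b 4; b 3; c *: x + d *: y; b 5; b 6; u; b 2]
  = c * vol [tuple b 4; b 3; x; b 5; b 6; u; b 2]
    + d * vol [tuple b 4; b 3; y; b 5; b 6; u; b 2].
  have E w : [tuple b 4; b 3; w; b 5; b 6; u; b 2]
     = set_slot [tuple b 4; b 3; 0; b 5; b 6; u; b 2] (inord 2) w.
    by apply: val_inj; rewrite /= !enum_ordSl enum_ord0 /= -!val_eqE /= !inordK.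
  by rewrite (E (c *: x + d *: y)) (E x) (E y) alt_form_slot2.
have S6 u x y c d : vol [tuple b 4; b 3; u; b 5; b 6; c *: x + d *: y; b 2]
  = c * vol [tuple b 4; b 3; u; b 5; b 6; x; b 2]
    + d * vol [tuple b 4; b 3; u; b 5; b 6; y; b 2].
  have E w : [tuple b 4; b 3; u; b 5; b 6; w; b 2]
     = set_slot [tuple b 4; b 3; u; b 5; b 6; 0; b 2] (inord 5) w.
    by apply: val_inj; rewrite /= !enum_ordSl enum_ord0 /= -!val_eqE /= !inordK.
  by rewrite (E (c *: x + d *: y)) (E x) (E y) alt_form_slot2.
have B i j : rng i -> rng j -> vol [tuple b 4; b 3; b i; b 5; b 6; b j; b 2]
   = (eps (iota 1 7) [:: 4; 3; i; 5; 6; j; 2]%N)%:~R.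
  move=> ri rj; rewrite -(vol_bvs oB vol_alt vol1) //.
    by congr (vol _); apply: val_inj; apply: esym; apply: etrans (bvs_val _ _) _.
  by rewrite /all ri rj.
rewrite /rot_frame /rot1 /rot7 S3 !S6 !B //.
rewrite (_ : eps (iota 1 7) [:: 4; 3; 1; 5; 6; 1; 2]%N = 0); last by vm_compute.
rewrite (_ : eps (iota 1 7) [:: 4; 3; 1; 5; 6; 7; 2]%N = 1); last by vm_compute.
rewrite (_ : eps (iota 1 7) [:: 4; 3; 7; 5; 6; 1; 2]%N = -1); last by vm_compute.
rewrite (_ : eps (iota 1 7) [:: 4; 3; 7; 5; 6; 7; 2]%N = 0); last by vm_compute.
rewrite !(mulr0z, mulr1z, mulrN1z); transitivity (C ^+ 2 + Z ^+ 2); [ring | exact: CZ].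
Qed.

Lemma phc_rot_frame : eq_rng (phc phi rot_frame) (fnc C Z).
Proof.
apply: alt3_eq_rng => [i j k|i j k|J HJ].
- exact: alt3_swap12.
- exact: alt3_swap23.
have P i j k : rng i -> rng j -> rng k -> phc phi rot_frame i j k =
    model_poly (rot_coord i) (rot_coord j) (rot_coord k).
  move=> ri rj rk; rewrite /phc (phi_coord oB phiE) /model_poly /minor_poly.
  by rewrite !rot_coordE.
have -> : at3 (phc phi rot_frame) J =
    at3 (fun i j k => model_poly (rot_coord i) (rot_coord j) (rot_coord k)) J.
  exact: at3_ext P (subs_size HJ) (subs_rng HJ).
move: J HJ; apply: conj_allP; vmc; cbv [conj_all]; repeat split;
cbv [at3 nth fnc_sorted alt3 Nat.compare model_poly minor_poly rot_coord];
first [ring | (transitivity (- (C ^+ 2 + Z ^+ 2)); [ring | by rewrite CZ])].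
Qed.

Hypotheses (brC : forall x, br x x = 0) (nil : two_step_nilpotent br).
Hypotheses (Z0 : Z != 0).
Hypotheses (d5 : b 5 \in derivedv br) (d6 : b 6 \in derivedv br)
  (d7 : rot7 \in derivedv br) (dim3 : \dim (derivedv br) = 3%N).
Hypothesis cc : coclosed br phi g vol.

Notation c := (cst br g rot_frame).

Lemma cst_rot_frame : eq_rng c (alt2 (rot_sorted c)).
Proof.
have fo := rot_frame_orthonormal.
apply: alt2_eq => [i j k|i j k ri rj rk ij]; first by rewrite /cst brN // dotNl.
have z i' : (3 < i' < 7)%N -> bv rot_frame i' \in derivedv br.
  by move: i' => [|[|[|[|[|[|[|i']]]]]]].
have zi m n q : (3 < m < 7)%N -> c m n q = 0.
  by move=> mz; rewrite /cst (br_central_l brC nil _ (z _ mz)) dot0l.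
have zj m n q : (3 < n < 7)%N -> c m n q = 0.
  by move=> mz; rewrite /cst (br_central nil _ (z _ mz)) dot0l.
have zk m n q : rng q -> ~~ (3 < q < 7)%N -> c m n q = 0.
  move=> rq nq; apply: (perp_bv (K := [:: 4; 5; 6]%N) fo _ _ dim3 _ rq) => //.
  - by move=> k'; rewrite !inE => /or3P[] /eqP ->; apply: z.
  - by move: q rq nq => [|[|[|[|[|[|[|[|q]]]]]]]].
  - exact: br_derived.
rewrite /rot_sorted.
move: k rk => [|[|[|[|[|[|[|[|k]]]]]]]] // rk; try (by rewrite zk);
move: i ri ij => [|[|[|[|[|[|[|[|i]]]]]]]] // ri ij; try (by rewrite zi);
move: j rj ij => [|[|[|[|[|[|[|[|j]]]]]]]] // rj ij; try (by rewrite zj).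
Qed.
Lemma rot_closed :
  [/\ (c 1 2 4)%N = 0 /\ (c 1 2 5)%N = 0 /\ (c 1 2 6)%N = 0,
      (c 1 3 4)%N = 0 /\ (c 1 3 5)%N = 0 /\ (c 1 3 6)%N = 0,
      (c 2 3 4)%N = 0 /\ (c 2 3 5)%N = 0 /\ (c 2 3 6)%N = 0
    & (c 2 7 4)%N = (c 1 7 5)%N /\ (c 3 7 4)%N = (c 1 7 6)%N /\ (c 3 7 5)%N = (c 2 7 6)%N].
Proof.
have va := vol_rot_frame; have fo := rot_frame_orthonormal.
have H J : size J = 5%N -> all rng J ->
    d4_c (alt2 (rot_sorted c)) (psi_c (fnc C Z)) J = 0.
  exact: (coclosed_table fo vol_alt va phi_alt cst_rot_frame phc_rot_frame cc).
have Z1 t : - (t * Z) = 0 -> t = 0.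
  by move/eqP; rewrite oppr_eq0 mulf_eq0 (negPf Z0) orbF => /eqP.
have Z2 t : t * Z = 0 -> t = 0.
  by move/eqP; rewrite mulf_eq0 (negPf Z0) orbF => /eqP.
have := d4_rot C Z c; rewrite /map !H //.
case=> /esym/Z1-> /esym/Z2-> /esym/Z1-> /esym/Z1-> /esym/Z2-> /esym/Z1->.
case=> /esym/Z1-> /esym/Z2-> /esym/Z1->; rewrite !mul0r => E1 E2 E3.
by do ![split]; lra.
Qed.

Variables (lambda : R) (D : {bilinear V -> V -> V}) (Dl : V -> V -> V).
Hypotheses (lcD : levi_civita br g D)
  (lDl : lambda_connection br phi g vol lambda D Dl).

Lemma rot_frame_not_instanton : ~ g2_instanton br phi g vol Dl.
Proof.
have fo := rot_frame_orthonormal; have va := vol_rot_frame.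
have [[c1 [c2 c3]] [c4 [c5 c6]] [c7 [c8 c9]] [s1 [s2 s3]]] := rot_closed.
(* S_ij is minus the component of [v_i, e_2] on w_j, for the two triples v and w *)
pose S i j := - c i 7 (3 + j)%N.
have SE : eq_rng c (cnc S).
  move=> i j k ri rj rk; rewrite cst_rot_frame // /cnc.
  have H p q r : rng p -> rng q -> rng r -> rot_sorted c p q r = cnc_sorted S p q r.
    move: p q r => [|[|[|[|[|[|[|[|p]]]]]]]] [|[|[|[|[|[|[|[|q]]]]]]]]
      [|[|[|[|[|[|[|[|r]]]]]]]] // _ _ _;
    by rewrite /rot_sorted /cnc_sorted /ss /S ?opprK.
  by rewrite /alt2 !H.
move=> inst.
have q0 : qS S = 0.
  apply: (nc_zero CZ (lam := lambda)).
  exact/(instanton_tableP fo brC vol_alt va phi_alt lcD lDl SE phc_rot_frame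
    (@tor_nc _ S _ _ CZ)).
have S0 : [/\ S 1%N 1%N = 0, S 2%N 2%N = 0 & S 3%N 3%N = 0] /\
          [/\ S 1%N 2%N = 0, S 1%N 3%N = 0 & S 2%N 3%N = 0].
  by move: q0; rewrite /qS => q0; split; split; apply/eqP; rewrite -sqrf_eq0; nra.
move: S0 => [[S1 S2 S3] [S4 S5 S6]].
apply: (cst_neq0 (br := br) nil fo) => i j k ri rj rk; rewrite SE // /cnc.
have H p q r : cnc_sorted S p q r = 0.
  rewrite /cnc_sorted; case: q => [|[|[|[|[|[|[|[|q]]]]]]]] //.
  case: p => [|[|[|[|p]]]] //; case: r => [|[|[|[|[|[|[|r]]]]]]] //;
  by rewrite /ss ?S1 ?S2 ?S3 ?S4 ?S5 ?S6 oppr0.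
by rewrite /alt2 !H oppr0; case: (Nat.compare _ _).
Qed.

End NonCalFrame.

(** * Coclosed structures when the commutator lies in an associative subspace *)
Section CalTables.
Variables (R : rcfType) (t : nat -> nat -> nat -> R).

(** The shape of the structure constants for the commutator <e_5, e_6>; in the next definition
    <e_5, e_6, e_7> is central and contains the commutator. *)
Definition dim2_sorted (i j k : nat) : R :=
  (match k with
  | 5 | 6 => match i, j with
     | 1, 2 | 1, 3 | 2, 3 | 1, 4 | 2, 4 | 3, 4 | 1, 7 | 2, 7 | 3, 7 | 4, 7 => t i j k
     | _, _ => 0%R end
  | _ => 0%R
  end)%N.

Definition cal_sorted (i j k : nat) : R :=
  (match k with
  | 5 | 6 | 7 => match i, j with
     | 1, 2 | 1, 3 | 2, 3 | 1, 4 | 2, 4 | 3, 4 => t i j k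
     | _, _ => 0%R end
  | _ => 0%R
  end)%N.

(** In dimension 2, d psi = 0 says in particular that e_7 is central. *)
Lemma d4_dim2 :
  map (d4_c (alt2 dim2_sorted) (psi_c (fstd R)))
    [:: [:: 1; 2; 3; 5; 7]; [:: 1; 2; 3; 6; 7]; [:: 1; 2; 4; 5; 7]; [:: 1; 2; 4; 6; 7];
        [:: 1; 3; 4; 5; 7]; [:: 1; 3; 4; 6; 7]; [:: 2; 3; 4; 5; 7]; [:: 2; 3; 4; 6; 7]]%N
  = [:: - (t 3 7 6)%N; (t 3 7 5)%N; - (t 4 7 6)%N; (t 4 7 5)%N;
        - (t 1 7 6)%N; (t 1 7 5)%N; - (t 2 7 6)%N; (t 2 7 5)%N].
Proof.
rewrite /map; do !congr (_ :: _); rewrite /psi_c /star_c; evb; vmc;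
cbv [star_c sg at3 nth alt2 dim2_sorted fstd fstd_sorted alt3 Nat.compare]; ring.
Qed.

(** These three components of d psi are the antisymmetric part of the matrix of self-dual
    coordinates of the forms - de^5, - de^6, - de^7. *)
Lemma d4_cal :
  map (d4_c (alt2 cal_sorted) (psi_c (fstd R)))
    [:: [:: 1; 2; 3; 4; 5]; [:: 1; 2; 3; 4; 6]; [:: 1; 2; 3; 4; 7]]%N
  = [:: (t 1 2 6)%N + (t 1 4 7)%N + (t 2 3 7)%N + (t 3 4 6)%N;
        - (t 1 2 5)%N + (t 1 3 7)%N - (t 2 4 7)%N - (t 3 4 5)%N;
        - (t 1 3 6)%N - (t 1 4 5)%N - (t 2 3 5)%N + (t 2 4 6)%N].
Proof.
rewrite /map; do !congr (_ :: _); rewrite /psi_c /star_c; evb; vmc;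
cbv [star_c sg at3 nth alt2 cal_sorted fstd fstd_sorted alt3 Nat.compare]; ring.
Qed.

(* Row a holds the self-dual, respectively anti-self-dual, coordinates of t _ _ (4 + a). *)
Definition xt (a m : nat) : R :=
  (let k := (4 + a)%N in match m with
  | 1 => (t 1 3 k)%N / 2%R - (t 2 4 k)%N / 2%R | 2 => - (t 1 4 k)%N / 2%R - (t 2 3 k)%N / 2%R
  | 3 => (t 1 2 k)%N / 2%R + (t 3 4 k)%N / 2%R | _ => 0 end)%R%N.
Definition yt (a m : nat) : R :=
  (let k := (4 + a)%N in match m with
  | 1 => (t 1 3 k)%N / 2%R + (t 2 4 k)%N / 2%R | 2 => (t 1 4 k)%N / 2%R - (t 2 3 k)%N / 2%R
  | 3 => (t 1 2 k)%N / 2%R - (t 3 4 k)%N / 2%R | _ => 0 end)%R%N.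

Lemma cal_sorted_ccal :
  (t 1 2 6)%N + (t 1 4 7)%N + (t 2 3 7)%N + (t 3 4 6)%N = 0 ->
  - (t 1 2 5)%N + (t 1 3 7)%N - (t 2 4 7)%N - (t 3 4 5)%N = 0 ->
  - (t 1 3 6)%N - (t 1 4 5)%N - (t 2 3 5)%N + (t 2 4 6)%N = 0 ->
  eq_rng (alt2 cal_sorted) (ccal xt yt).
Proof.
move=> E1 E2 E3.
have H p q r : rng p -> rng q -> rng r -> cal_sorted p q r = ccal_sorted xt yt p q r.
  move: p q r => [|[|[|[|[|[|[|[|p]]]]]]]] [|[|[|[|[|[|[|[|q]]]]]]]]
    [|[|[|[|[|[|[|[|r]]]]]]]] // _ _ _;
  cbv [cal_sorted ccal_sorted idx sdasd xs xt yt addn Nat.add]; lra.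
by move=> i j k ri rj rk; rewrite /ccal /alt2 !H.
Qed.

End CalTables.

Section Diag0.
Variables (R : rcfType) (r : R) (y : nat -> nat -> R).

(** The self-dual parts of the j(e_a) satisfy the bracket relation already; what is left is the
    relation y_a x y_b = r y_c between the anti-self-dual parts, for (a, b, c) cyclic. *)
Lemma jrel_cross : let F := jrel r y in
  let X a b m n := y a m * y b n - y a n * y b m in
  [/\ [/\ (F 6 7 5 1 3)%N = - 2 * (X 2 3 2 3)%N + 2 * r * y 1%N 1%N,
          (F 6 7 5 1 4)%N = - 2 * (X 2 3 3 1)%N + 2 * r * y 1%N 2%N &
          (F 6 7 5 1 2)%N = - 2 * (X 2 3 1 2)%N + 2 * r * y 1%N 3%N],
      [/\ (F 7 5 6 1 3)%N = - 2 * (X 3 1 2 3)%N + 2 * r * y 2%N 1%N,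
          (F 7 5 6 1 4)%N = - 2 * (X 3 1 3 1)%N + 2 * r * y 2%N 2%N &
          (F 7 5 6 1 2)%N = - 2 * (X 3 1 1 2)%N + 2 * r * y 2%N 3%N] &
      [/\ (F 5 6 7 1 3)%N = - 2 * (X 1 2 2 3)%N + 2 * r * y 3%N 1%N,
          (F 5 6 7 1 4)%N = - 2 * (X 1 2 3 1)%N + 2 * r * y 3%N 2%N &
          (F 5 6 7 1 2)%N = - 2 * (X 1 2 1 2)%N + 2 * r * y 3%N 3%N]].
Proof.
by cbv zeta; do ![split]; rewrite /jrel;
cbv [Nat.leb ccal ccal_sorted alt2 alt3 sdasd xs idx Nat.compare]; rewrite /xdiag; ring.
Qed.

Definition yk (k m : nat) : R := if (4 < k)%N then y (idx k) m else 0.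

Definition asd (m i j : nat) : R :=
  alt2 (fun i j _ => sdasd (fun=> 0) (fun n => if Nat.eqb n m then 1 else 0) i j) i j 0.

Lemma ccal0 i j k : rng i -> rng j -> rng k -> r = 0 ->
  ccal (xdiag r) y i j k = asd 1 i j * yk k 1 + asd 2 i j * yk k 2 + asd 3 i j * yk k 3.
Proof.
move=> ri rj rk ->.
have H p q : rng p -> rng q -> ccal_sorted (xdiag 0) y p q k
  = sdasd (fun=> 0) (fun n => if Nat.eqb n 1 then 1 else 0) p q * yk k 1
  + sdasd (fun=> 0) (fun n => if Nat.eqb n 2 then 1 else 0) p q * yk k 2
  + sdasd (fun=> 0) (fun n => if Nat.eqb n 3 then 1 else 0) p q * yk k 3.
  move: k rk => [|[|[|[|[|[|[|[|k]]]]]]]] // _;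
  rewrite /yk /ccal_sorted /= ?mulr0 ?addr0 //;
  move: p q => [|[|[|[|[|[|[|[|p]]]]]]]] [|[|[|[|[|[|[|[|q]]]]]]]] // _ _;
  cbv [idx sdasd xs xdiag Nat.eqb]; ring.
rewrite /ccal /asd /alt2; case: (Nat.compare _ _); rewrite ?H //; ring.
Qed.

(** When r = 0 the relations say that the vectors y_1, y_2, y_3 are parallel, so that the
    bracket has rank at most one. *)
Lemma ccal_rank1 i j p q k l : rng i -> rng j -> rng p -> rng q -> rng k -> rng l -> r = 0 ->
  (forall u v, (0 < u <= 4)%N -> (0 < v <= 4)%N ->
     [/\ jrel r y 6 7 5 u v = 0, jrel r y 7 5 6 u v = 0 & jrel r y 5 6 7 u v = 0]) ->
  let c := ccal (xdiag r) y in c i j k * c p q l = c i j l * c p q k.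
Proof.
move=> ri rj rp rq rk rl r0 J /=.
have [/= [a1 a2 a3] [b1 b2 b3] [d1 d2 d3]] := jrel_cross.
have [A1 B1 D1] := J 1%N 3%N isT isT; have [A2 B2 D2] := J 1%N 4%N isT isT.
have [A3 B3 D3] := J 1%N 2%N isT isT.
rewrite A1 A2 A3 B1 B2 B3 D1 D2 D3 r0 mulr0 !mul0r !addr0 in a1 a2 a3 b1 b2 b3 d1 d2 d3.
have X a b m n : rng a -> rng b -> (0 < m < 4)%N -> (0 < n < 4)%N ->
    yk a m * yk b n = yk a n * yk b m.
  have Y a' b' : (0 < a' < 4)%N -> (0 < b' < 4)%N -> (0 < m < 4)%N -> (0 < n < 4)%N ->
      y a' m * y b' n = y a' n * y b' m.
    clear -a1 a2 a3 b1 b2 b3 d1 d2 d3.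
    move: a' b' m n => [|[|[|[|a']]]] [|[|[|[|b']]]] [|[|[|[|m]]]] [|[|[|[|n]]]] // _ _ _ _;
    first [exact: mulrC | lra].
  move=> ra rb rm rn; rewrite /yk; case: ifP => ka; case: ifP => kb; rewrite ?mul0r ?mulr0 //.
  apply: Y => //.
    by move: a ra ka => [|[|[|[|[|[|[|[|a]]]]]]]].
  by move: b rb kb => [|[|[|[|[|[|[|[|b]]]]]]]].
rewrite !ccal0 //.
have := X k l 1%N 2%N rk rl isT isT; have := X k l 1%N 3%N rk rl isT isT.
have := X k l 2%N 3%N rk rl isT isT; clear.
move: (yk k 1) (yk k 2) (yk k 3) (yk l 1) (yk l 2) (yk l 3) (asd 1 i j) (asd 2 i j) (asd 3 i j)
  (asd 1 p q) (asd 2 p q) (asd 3 p q) => z1 z2 z3 w1 w2 w3 s1 s2 s3 t1 t2 t3 E1 E2 E3.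
apply/eqP; rewrite -subr_eq0; apply/eqP.
transitivity ((s1 * t2 - s2 * t1) * (z1 * w2 - z2 * w1)
  + (s1 * t3 - s3 * t1) * (z1 * w3 - z3 * w1) + (s2 * t3 - s3 * t2) * (z2 * w3 - z3 * w2)).
  ring.
by rewrite E1 E2 E3 !subrr !mulr0 !addr0.
Qed.

End Diag0.

(** * Instantons when the commutator lies in an associative subspace *)
Section CalFrame.
Variables (R : rcfType) (V : vectType R) (br : {bilinear V -> V -> V}).
Variables (g : {dot V for idfun}) (vol : kform V 7) (phi : kform V 3).
Variables (e : 7.-tuple V).
Hypotheses (oB : orthonormal_basis g e) (phiE : phi =1 g2_model e).
Hypotheses (vol_alt : alt_form vol) (vol1 : vol e = 1).
Hypotheses (brC : forall x, br x x = 0) (nil : two_step_nilpotent br).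

Notation b := (bv e).
Notation c := (cst br g e).
Let phi_alt : alt_form phi := alt_g2_model phiE.

Lemma phc_std : eq_rng (phc phi e) (fstd R).
Proof.
apply: alt3_eq_rng => [i j k|i j k|J HJ].
- exact: alt3_swap12.
- exact: alt3_swap23.
pose dl i m : R := if Nat.eqb i m then 1 else 0.
have dlE i m : (i == m)%:R = dl i m.
  by rewrite /dl; case: PeanoNat.Nat.eqb_spec => [->|/eqP/negPf->]; rewrite ?eqxx.
have P i j k : rng i -> rng j -> rng k -> phc phi e i j k =
    model_poly (dl i) (dl j) (dl k).
  move=> ri rj rk; rewrite /phc (phi_coord oB phiE) /model_poly /minor_poly.
  by rewrite !(dot_bv oB) // !dlE.
have -> : at3 (phc phi e) J = at3 (fun i j k => model_poly (dl i) (dl j) (dl k)) J.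
  exact: at3_ext P (subs_size HJ) (subs_rng HJ).
move: J HJ; apply: conj_allP; vmc; cbv [conj_all]; repeat split;
cbv [at3 nth fstd_sorted alt3 Nat.compare model_poly minor_poly dl Nat.eqb]; ring.
Qed.

(** The commutator is central, and a basis vector outside a spanning set of basis vectors is
    orthogonal to it. *)
Lemma cst_derived (K : seq nat) i j k :
  uniq K -> all rng K -> \dim (derivedv br) = size K ->
  (forall m, m \in K -> b m \in derivedv br) ->
  rng k -> [|| i \in K, j \in K | k \notin K] -> c i j k = 0.
Proof.
move=> uK rK dK KD rk; rewrite /cst => /or3P[iK|jK|kK].
- by rewrite (br_central_l brC nil) ?dot0l ?KD.
- by rewrite (br_central nil) ?dot0l ?KD.
- exact: perp_bv oB uK rK dK KD rk kK (br_derived _ _ _).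
Qed.

Lemma cst_anti i j k : c j i k = - c i j k.
Proof. by rewrite /cst (brN brC) dotNl. Qed.

Hypotheses (d5 : b 5 \in derivedv br) (d6 : b 6 \in derivedv br).
Hypothesis cc : coclosed br phi g vol.

Lemma cst_dim3 : \dim (derivedv br) = 3%N -> b 7 \in derivedv br ->
  eq_rng c (alt2 (cal_sorted c)).
Proof.
move=> dD d7.
have z := @cst_derived [:: 5; 6; 7]%N _ _ _ erefl erefl dD _.
apply: alt2_eq => [|i j k ri rj rk ij]; first exact: cst_anti.
have {}z : forall i j k, rng k -> [|| i \in [:: 5; 6; 7]%N, j \in [:: 5; 6; 7]%N
    | k \notin [:: 5; 6; 7]%N] -> c i j k = 0.
  by move=> p q r; apply: z => m; rewrite !inE => /or3P[] /eqP ->.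
by move: i j k ri rj rk ij => [|[|[|[|[|[|[|[|i]]]]]]]] [|[|[|[|[|[|[|[|j]]]]]]]]
  [|[|[|[|[|[|[|[|k]]]]]]]] // _ _ _ _; rewrite /cal_sorted // z.
Qed.

Lemma cst_dim2 : \dim (derivedv br) = 2%N ->
  eq_rng c (alt2 (cal_sorted c)) /\ forall i j, rng i -> rng j -> c i j 7 = 0.
Proof.
move=> dD.
have z : forall i j k, rng k -> [|| i \in [:: 5; 6]%N, j \in [:: 5; 6]%N
    | k \notin [:: 5; 6]%N] -> c i j k = 0.
  move=> p q r; apply: (@cst_derived [:: 5; 6]%N _ _ _ erefl erefl dD _) => m.
  by rewrite !inE => /orP[] /eqP ->.
have cE : eq_rng c (alt2 (dim2_sorted c)).
  apply: alt2_eq => [|i j k ri rj rk ij]; first exact: cst_anti.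
  by move: i j k ri rj rk ij => [|[|[|[|[|[|[|[|i]]]]]]]] [|[|[|[|[|[|[|[|j]]]]]]]]
    [|[|[|[|[|[|[|[|k]]]]]]]] // _ _ _ _; rewrite /dim2_sorted // z.
have H J : size J = 5%N -> all rng J -> d4_c (alt2 (dim2_sorted c)) (psi_c (fstd R)) J = 0.
  exact: (coclosed_table oB vol_alt vol1 phi_alt cE phc_std cc).
have N0 (t : R) : 0 = - t -> t = 0 by lra.
have := d4_dim2 c; rewrite /map !H //.
case=> /N0 E1 /esym E2 /N0 E3 /esym E4 /N0 E5 /esym E6 /N0 E7 /esym E8.
split; last by move=> i j _ _; apply: z => //; rewrite !inE /= !orbT.
apply: alt2_eq => [|i j k ri rj rk ij]; first exact: cst_anti.
by move: i j k ri rj rk ij => [|[|[|[|[|[|[|[|i]]]]]]]] [|[|[|[|[|[|[|[|j]]]]]]]]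
    [|[|[|[|[|[|[|[|k]]]]]]]] // _ _ _ _; rewrite /cal_sorted /= ?z.
Qed.

Hypothesis cE : eq_rng c (alt2 (cal_sorted c)).

Lemma cst_ccal : eq_rng c (ccal (xt c) (yt c)).
Proof.
have H J : size J = 5%N -> all rng J -> d4_c (alt2 (cal_sorted c)) (psi_c (fstd R)) J = 0.
  exact: (coclosed_table oB vol_alt vol1 phi_alt cE phc_std cc).
have := d4_cal c; rewrite /map !H //; case=> E1 E2 E3 i j k ri rj rk.
by rewrite cE // cal_sorted_ccal.
Qed.

Variables (lambda : R) (D : {bilinear V -> V -> V}) (Dl : V -> V -> V).
Hypotheses (lcD : levi_civita br g D)
  (lDl : lambda_connection br phi g vol lambda D Dl).

Lemma words_eq_rng (h h' : nat -> nat -> nat -> R) :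
  (forall J, J \in words 3 -> at3 h J = at3 h' J) -> eq_rng h h'.
Proof.
move=> H i j k ri rj rk; apply: (H [:: i; j; k]).
by apply: mem_words; rewrite //= ri rj rk.
Qed.

Lemma words_rng k J : J \in words k -> size J = k /\ all rng J.
Proof.
elim: k J => [|k IH] J; first by rewrite inE => /eqP ->.
case/allpairsP => -[x w] [ix /IH[sw rw] ->].
by split; [rewrite /= sw | apply/andP; split=> //; rewrite rng_iota].
Qed.

Lemma ccal_ext (x x' y : nat -> nat -> R) :
  (forall a m, (0 < a < 4)%N -> (0 < m < 4)%N -> xs x a m = xs x' a m) ->
  eq_rng (ccal x y) (ccal x' y).
Proof.
move=> xx.
have H p q r : rng p -> rng q -> rng r -> ccal_sorted x y p q r = ccal_sorted x' y p q r.
  move: r => [|[|[|[|[|[|[|[|r]]]]]]]] // _ _ _;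
  by rewrite /ccal_sorted /= /sdasd !xx.
by move=> i j k ri rj rk; rewrite /ccal /alt2 !H.
Qed.

Lemma ccal_zero (x y : nat -> nat -> R) : asq x = 0 -> bsq y = 0 ->
  eq_rng (ccal x y) (fun _ _ _ => 0).
Proof.
move=> a0 b0.
have [X1 X2 X3 X4 [X5 X6]] : [/\ x 1%N 1%N = 0, x 2%N 2%N = 0, x 3%N 3%N = 0, x 1%N 2%N = 0
    & x 1%N 3%N = 0 /\ x 2%N 3%N = 0].
  by move: a0; rewrite /asq => a0; split; [..|split]; apply/eqP; rewrite -sqrf_eq0; nra.
have Y a m : (0 < a < 4)%N -> (0 < m < 4)%N -> y a m = 0.
  move: b0; rewrite /bsq => b0.
  by move: a m => [|[|[|[|a]]]] [|[|[|[|m]]]] // _ _; apply/eqP; rewrite -sqrf_eq0; nra.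
have H p q r : ccal_sorted x y p q r = 0.
  have S k : (0 < k < 4)%N -> sdasd (xs x k) (y k) p q = 0.
    by move: k => [|[|[|[|k]]]] // _; rewrite /sdasd /xs /= !Y // ?X1 ?X2 ?X3 ?X4 ?X5 ?X6
       ?subr0 ?addr0 ?oppr0; move: p q => [|[|[|[|[|p]]]]] [|[|[|[|[|q]]]]].
  by move: r => [|[|[|[|[|[|[|[|r]]]]]]]] //; rewrite /ccal_sorted /= S.
by move=> i j k ri rj rk; rewrite /ccal /alt2 !H oppr0; case: (Nat.compare _ _).
Qed.

Lemma inst_diag_rng (r : R) (y : nat -> nat -> R) :
  eq_rng (inst_c (ccal (xdiag r) y) (fstd R) (g1 r y)) (instT r y).
Proof.
have lt w u v : rng w -> rng u -> rng v -> (u < v)%N ->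
    inst_c (ccal (xdiag r) y) (fstd R) (g1 r y) w u v = instT r y w u v.
  move=> rw ru rv uv; apply: (@inst_diag _ r y [:: w; u; v]).
  apply/allpairsP; exists (w, [:: u; v]); split=> //; first by rewrite -rng_iota.
  by apply: mem_subs; rewrite //= ?uv ?ru ?rv.
move=> w u v rw ru rv; have S p q := @inst_skew _ (ccal (xdiag r) y) (fstd R) _ w p q (@g1_skew _ r y).
case: (ltngtP u v) => [uv|vu|<-]; first exact: lt.
  by rewrite S // instT_skew lt.
by rewrite (eq_opp0 (S u u ru ru)) (eq_opp0 (instT_skew r y w u u)).
Qed.

(** This is where the condition on j comes from: for x = r id and lambda = 1 it is equivalent to the
    instanton equations. *)
Lemma diag_instanton (r : R) (y : nat -> nat -> R) : lambda = 1 ->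
  eq_rng c (ccal (xdiag r) y) ->
  g2_instanton br phi g vol Dl <->
  (forall u v, (0 < u <= 4)%N -> (0 < v <= 4)%N ->
    [/\ jrel r y 6 7 5 u v = 0, jrel r y 7 5 6 u v = 0 & jrel r y 5 6 7 u v = 0]).
Proof.
move=> lE rE.
have IE : eq_rng (inst_c (ccal (xdiag r) y) (fstd R)
    (gam_c (ccal (xdiag r) y) (tcal (xdiag r) y) lambda)) (instT r y).
  move=> w u v rw ru rv; rewrite lE.
  transitivity (inst_c (ccal (xdiag r) y) (fstd R) (g1 r y) w u v).
    by apply: inst_ext => //; apply: words_eq_rng => J; exact: gam_diag.
  exact: inst_diag_rng.
rewrite (instanton_tableP oB brC vol_alt vol1 phi_alt lcD lDl rE phc_std
  (@tor_cal _ (xdiag r) y)).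
split=> [H u v u4 v4|J w u v rw ru rv].
  have ru : rng u by move: u u4 => [|[|[|[|[|u]]]]].
  have rv : rng v by move: v v4 => [|[|[|[|[|v]]]]].
  have L p : (0 < p <= 4)%N -> Nat.leb p 4 = true by move: p => [|[|[|[|[|p]]]]].
  have T w : rng w -> instT r y w u v = 0 by move=> rw; rewrite -IE // H.
  by split; [move: (T 5%N isT)|move: (T 6%N isT)|move: (T 7%N isT)];
    rewrite /instT !L.
rewrite IE // /instT; case: PeanoNat.Nat.leb_spec => // /ssrnat.leP u4.
case: PeanoNat.Nat.leb_spec => // /ssrnat.leP v4.
have [||J1 J2 J3] := J u v; [by rewrite u4 andbT; case/andP: ru|
  by rewrite v4 andbT; case/andP: rv|].
by move: w {rw} => [|[|[|[|[|[|[|[|w]]]]]]]].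
Qed.

(** If r = 0, then all brackets are multiples of one vector, by [ccal_rank1], and the commutator is
    a line. *)
Lemma cal_instanton : (1 < \dim (derivedv br))%N -> g2_instanton br phi g vol Dl ->
  lambda = 1 /\ exists r y, r != 0 /\ eq_rng c (ccal (xdiag r) y).
Proof.
move=> dD inst; pose x := xt c; pose y := yt c.
have E0 := (instanton_tableP oB brC vol_alt vol1 phi_alt lcD lDl cst_ccal phc_std
  (@tor_cal _ x y)).1 inst.
have [lE|[a0 b0]] := cal_dichotomy E0; last first.
  case: (cst_neq0 (br := br) nil oB) => i j k ri rj rk.
  by rewrite cst_ccal // ccal_zero.
have [X1 X2 X3 X4 [X5 X6]] := cal_scalar lE E0.
split=> //; exists (str x / 3), y.
have rE : eq_rng c (ccal (xdiag (str x / 3)) y).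
  move=> i j k ri rj rk; rewrite cst_ccal //; move: i j k ri rj rk; apply: ccal_ext.
  by move=> [|[|[|[|a]]]] [|[|[|[|m]]]] //= _ _; rewrite /xs /xdiag.
split=> //; apply/negP => /eqP r0.
have J := (diag_instanton lE rE).1 inst.
have [i0 [j0 [k0 [ri0 rj0 rk0 c0]]]] : exists i j k,
    [/\ rng i, rng j, rng k & c i j k != 0].
  have [/allP N|/allPn[J']] := boolP (all (fun J => at3 c J == 0) (words 3)).
    case: (cst_neq0 (br := br) nil oB) => i j k ri rj rk; apply/eqP; apply: (N [:: i; j; k]).
    by apply: mem_words; rewrite //= ri rj rk.
  move/words_rng => []; case: J' => [|i [|j' [|k [|? ?]]]] //= _ /and4P[ri rj rk _] cn.
  by exists i, j', k.
apply/negP: dD; rewrite -leqNgt.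
have : (derivedv br <= <[br (b i0) (b j0)]>)%VS.
  apply: derived_sub; apply: (br_bv_mem (proj1 oB)) => i j ri rj.
  apply/vlineP; exists (c i j k0 / c i0 j0 k0).
  rewrite (bv_expand oB (br (b i) (b j))) (bv_expand oB (br (b i0) (b j0))) scaler_sumr.
  apply: eq_big_seq => m; rewrite -rng_iota => rm; rewrite scalerA.
  congr (_ *: _); rewrite -[LHS]/(c i j m) -[g _ _]/(c i0 j0 m).
  apply: (mulIf c0); rewrite mulrAC divfK // !rE //.
  exact: ccal_rank1.
by move/dimvS => H; apply: leq_trans H _; rewrite dim_vline leq_b1.
Qed.

End CalFrame.

(** * The orthogonal complement of the commutator *)
Lemma alt_restrictf (R : numFieldType) (V : vectType R) (U : {vspace V}) k (a : kform V k) :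
  alt_form a -> alt_form (restrictf (U := U) a).
Proof.
elim=> {a} [f Hf|c a b _ IHa _ IHb||a b _ IH E].
- apply: alt_ext (alt_wedge1 (f := fun i (x : subvs_of U) => f i (vsval x)) _) _.
    by move=> i c x y; rewrite linearP Hf.
  move=> v; congr (\det _); apply/matrixP => i j; rewrite !mxE.
  by rewrite tnth_mktuple.
- exact: alt_comb.
- exact: alt_zero.
- by apply: alt_ext IH _ => v; apply: E.
Qed.

Lemma span_zero (R : numFieldType) (V : vectType R) (f : V -> R) (s : seq V) x :
  scalar f -> (forall y, y \in s -> f y = 0) -> x \in <<s>>%VS -> f x = 0.
Proof.
move=> Hf f0 xs; pose h : {scalar V} := HB.pack f (GRing.isLinear.Build _ _ _ _ f Hf).
rewrite (coord_span (X := in_tuple s) xs) -[f _]/(h _) linear_sum big1 // => i _.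
by rewrite linearZ -[h _]/(f _) f0; [exact: mulr0 | apply: mem_nth; apply: ltn_ord].
Qed.

Section OrthFrame.
Variables (R : rcfType) (V : vectType R) (br : {bilinear V -> V -> V}).
Variables (g : {dot V for idfun}) (phi : kform V 3) (e : 7.-tuple V).
Hypotheses (oB : orthonormal_basis g e) (phiE : phi =1 g2_model e).
Hypotheses (brC : forall x, br x x = 0) (nil : two_step_nilpotent br).
Hypotheses (dD : \dim (derivedv br) = 3%N).
Hypothesis bD : forall k, k \in [:: 5; 6; 7]%N -> bv e k \in derivedv br.

Notation b := (bv e).
Notation r := (orth_derivedv br g).
Notation d := (derivedv br).
Let eB : basis_of {:V} e := proj1 oB.

Lemma derived_basis : basis_of d [seq b k | k <- [:: 5; 6; 7]%N].
Proof. exact: (basis_of_bv (K := [:: 5; 6; 7]%N) oB isT isT dD bD). Qed.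

Lemma orth_basis : basis_of r [seq b k | k <- [:: 1; 2; 3; 4]%N].
Proof.
have E : tval e = [seq b k | k <- [:: 1; 2; 3; 4]%N] ++ [seq b k | k <- [:: 5; 6; 7]%N].
  apply: (@eq_from_nth _ 0); first by rewrite size_tuple.
  by rewrite size_tuple; move=> [|[|[|[|[|[|[|i]]]]]]].
apply/andP; split; last first.
  by move: (basis_free eB); rewrite E; apply: catl_free.
rewrite eqEsubv; apply/andP; split.
  apply/span_subvP => _ /mapP[k kK ->]; apply/mem_orthovP => z zd.
  apply: etrans (dotC g _ _) _; apply: (perp_bv (K := [:: 5; 6; 7]%N) oB isT isT dD bD) => //.
    by move: kK; rewrite !inE => /or4P[] /eqP ->.
  by move: kK; rewrite !inE => /or4P[] /eqP ->.
apply/subvP => x /mem_orthovP xr; rewrite (bv_expand oB x).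
rewrite big_seq_cond; apply: memv_suml => m; rewrite andbT mem_iota => mI.
have [m5|m4] := leqP 5 m.
  rewrite (xr (b m)) ?scale0r ?mem0v //; apply: bD.
  by move: m mI m5 => [|[|[|[|[|[|[|[|m]]]]]]]].
apply/memvZ/memv_span/map_f.
by move: m mI m4 => [|[|[|[|[|m]]]]].
Qed.

Lemma orth_proj x : x \in r -> x = \sum_(m <- iota 1 4) g x (b m) *: b m.
Proof.
move=> /mem_orthovP xo; rewrite {1}(bv_expand oB x) (iotaD 1 4 3) big_cat /=.
rewrite [X in _ + X]big1_seq ?addr0 // => m /andP[_ mI].
by rewrite (_ : g x (b m) = 0) ?scale0r //; exact: xo _ (bD mI).
Qed.

Lemma dim_orth : \dim r = 4%N.
Proof. exact: (size_basis (X := [tuple b 1; b 2; b 3; b 4]) orth_basis). Qed.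

Lemma b_orth k : k \in [:: 1; 2; 3; 4]%N -> b k \in r.
Proof. by move=> kK; apply: (basis_mem orth_basis); apply: map_f. Qed.

Definition orth_frame : 4.-tuple (subvs_of r) := [tuple vsproj r (b i.+1) | i < 4].

Lemma orth_frameE i : vsval (tnth orth_frame i) = b i.+1.
Proof.
by rewrite tnth_mktuple vsprojK // b_orth //; case: i => [[|[|[|[|?]]]]].
Qed.

Lemma orth_frame_basis : basis_of {:subvs_of r} orth_frame.
Proof.
rewrite basisEfree size_tuple dimvf subvf /= -[dim _]/(\dim r) dim_orth leqnn andbT.
apply/(@freeP _ _ 4 orth_frame) => k k0 i; have := congr1 (fun x => g (vsval x) (b i.+1)) k0.
have bi (p : 'I_4) : rng p.+1 by case: p => [[|[|[|[|?]]]]].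
rewrite linear0 dot0l linear_sum dot_suml.
have -> : \sum_(j < 4) g (vsval (k j *: orth_frame`_j)) (b i.+1)
    = \sum_(j < 4) k j * (j == i)%:R.
  apply: eq_bigr => j _; rewrite -tnth_nth.
  have -> : vsval (k j *: tnth orth_frame j) = k j *: b j.+1.
    by rewrite -orth_frameE; apply: linearZ.
  by rewrite dotZl (dot_bv oB).
rewrite (bigD1 i) //= eqxx mulr1 big1 ?addr0 // => j nji.
by rewrite (negPf nji) mulr0.
Qed.

End OrthFrame.

(** * The self-duality condition in coordinates *)
Ltac ev_eps := repeat match goal with
  | |- context [eps ?I ?J] =>
    let v := eval vm_compute in (eps I J) in
    match v with
    | Posz O => change (eps I J) with (0 : int)
    | Posz (S O) => change (eps I J) with (1 : int)
    | Negz O => change (eps I J) with (-1 : int)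
    end
  end.

Section SelfDual.
Variables (R : rcfType) (V : vectType R) (br : {bilinear V -> V -> V}).
Variables (g : {dot V for idfun}) (e : 7.-tuple V).
Hypotheses (oB : orthonormal_basis g e).
Hypotheses (brC : forall x, br x x = 0).
Hypotheses (dD : \dim (derivedv br) = 3%N).
Hypothesis bD : forall k, k \in [:: 5; 6; 7]%N -> bv e k \in derivedv br.

Notation b := (bv e).
Notation c := (cst br g e).
Notation r := (orth_derivedv br g).
Let eB : basis_of {:V} e := proj1 oB.

Definition de (k : nat) : kform (subvs_of r) 2 :=
  restrictf (U := r) (ce_diff br (eform e [tuple k])).
Definition tb (k : nat) : subvs_of r := vsproj r (b k).
Definition gr (x y : subvs_of r) : R := g (vsval x) (vsval y).
Definition vr : kform (subvs_of r) 4 := restrictf (U := r) (eform e [tuple 1; 2; 3; 4]%N).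

Lemma tbE k : (0 < k < 5)%N -> vsval (tb k) = b k.
Proof.
move=> k4; apply: vsprojK; apply: b_orth oB dD bD _ _.
by move: k k4 => [|[|[|[|[|k]]]]].
Qed.

Lemma alt_de k : alt_form (de k).
Proof.
apply: alt_restrictf.
apply: alt_ext (alt_ce_diff1 (br := br) brC (f := coord e (inord k.-1)) _) _.
  by move=> a x y; rewrite linearP.
move=> v; rewrite !ce_diff1E; congr (- \det _); apply/matrixP => i j; rewrite !mxE.
by rewrite (ord1 i).
Qed.

Lemma restrict_tb k (a : kform V k) (K : seq nat) : size K = k ->
  all (fun i => 0 < i < 5)%N K ->
  restrictf (U := r) a [tuple tb (nth 0%N K i) | i < k] = a (bvs e k K).
Proof.
move=> sK K4; congr (a _); apply: eq_from_tnth => i; rewrite !tnth_mktuple tbE //.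
by apply: (allP K4); rewrite mem_nth // sK.
Qed.

Lemma de_tb k p q : rng k -> (0 < p < 5)%N -> (0 < q < 5)%N ->
  de k [tuple tb p; tb q] = - c p q k.
Proof.
move=> rk p4 q4; rewrite /de /restrictf ce_diff1E eformE (cform_dot oB) //=; last by rewrite rk.
congr (- _).
rewrite /wedge1 det_mx11 mxE tnth_mktuple dotC (tnth_nth 0) /=.
by rewrite !enum_ordSl /= !(tnth_nth 0) /= !tbE.
Qed.

Lemma vr_tb (K : seq nat) : size K = 4%N -> all (fun i => 0 < i < 5)%N K ->
  vr [tuple tb (nth 0%N K i) | i < 4] = (eps [:: 1; 2; 3; 4]%N K)%:~R.
Proof.
move=> sK K4; rewrite /vr restrict_tb // eformE cform_bvs //.
apply/allP => k /(allP K4) /andP[k0 k4]; rewrite /rng k0 /=; exact: leq_trans (ltnW k4) _.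
Qed.

Lemma gr_tb p q : (0 < p < 5)%N -> (0 < q < 5)%N -> gr (tb p) (tb q) = (p == q)%:R.
Proof.
move=> p4 q4; rewrite /gr !tbE // (dot_bv oB) //.
  by move: p p4 => [|[|[|[|[|p]]]]].
by move: q q4 => [|[|[|[|[|q]]]]].
Qed.

(** The star of a 2-form in dimension 4 exchanges complementary pairs of indices, with the sign s of
    the permutation. *)
Lemma self_dual_tb k p q p' q' (s : bool) : rng k ->
  all (fun i => 0 < i < 5)%N [:: p'; q'; p; q] ->
  p != q -> [&& p' != p, p' != q, q' != p & q' != q] ->
  eps [:: 1; 2; 3; 4]%N [:: p'; q'; p; q] = (-1) ^+ s ->
  self_dual_part gr vr (de k) [tuple tb p; tb q] = - (c p q k + (-1) ^+ s * c p' q' k) / 2.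
Proof.
move=> rk K4 pq /and4P[n1 n2 n3 n4] ep; rewrite /self_dual_part.
have vE : vr [tuple of [tuple tb p'; tb q'] ++ [tuple tb p; tb q]] = (-1) ^+ s.
  transitivity (vr [tuple tb (nth 0%N [:: p'; q'; p; q] i) | i < 4]).
    congr (vr _); apply: eq_from_tnth => i; rewrite tnth_mktuple (tnth_nth 0).
    by case: i => [[|[|[|[|i]]]]].
  by rewrite vr_tb // ep rmorph_sign.
have /and5P[p'4 q'4 p4 q4 _] := K4.
have grl x : scalar (gr x).
  by move=> a y z; rewrite /gr (linearP (vsval : {linear _ -> _})) dotDr dotZr.
have dimr : \dim {:subvs_of r} = (2 + 2)%N.
  by rewrite dimvf /= -[dim _]/(\dim r) (dim_orth oB dD bD).
have vA : alt_form vr by apply/alt_restrictf/alt_eform.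
rewrite (hodge_basis grl dimr vA (w := [tuple tb p'; tb q'])) ?vE
  ?signr_eq0 //.
- by rewrite !de_tb // invr_sign; move: ((-1) ^+ s) => t; field.
- exact: alt_de.
- by move=> [[|[|i]] Hi] [[|[|j]] Hj] //=; rewrite gr_tb // eq_sym
    ?(negPf n1) ?(negPf n2) ?(negPf n3) ?(negPf n4).
- move=> [[|[|i]] Hi] [[|[|j]] Hj] //=; rewrite gr_tb ?eqxx //.
    by rewrite (negPf pq).
  by rewrite eq_sym (negPf pq).
Qed.

Lemma sigma_tb a p q : (0 < a < 4)%N -> (0 < p < 5)%N -> (0 < q < 5)%N ->
  restrictf (U := r) (sigma_plus e a) [tuple tb p; tb q] =
  match a with
  | 1%N => (eps [:: 1; 3]%N [:: p; q])%:~R - (eps [:: 2; 4]%N [:: p; q])%:~R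
  | 2%N => - (eps [:: 1; 4]%N [:: p; q])%:~R - (eps [:: 2; 3]%N [:: p; q])%:~R
  | _ => (eps [:: 1; 2]%N [:: p; q])%:~R + (eps [:: 3; 4]%N [:: p; q])%:~R
  end.
Proof.
move=> a4 p4 q4.
have rr k : (0 < k < 5)%N -> rng k by move: k => [|[|[|[|[|k]]]]].
have E (I : 2.-tuple nat) : all rng I ->
    restrictf (U := r) (eform e I) [tuple tb p; tb q] = (eps I [:: p; q])%:~R.
  move=> rI; rewrite -(cform_bvs eB (k := 2)) ?size_tuple //; last by rewrite /= !rr.
  rewrite -eformE -restrict_tb //; last by rewrite /= p4 q4.
  by congr (restrictf _ _); apply: eq_from_tnth => i; rewrite tnth_mktuple (tnth_nth 0);
     case: i => [[|[|?]]].
rewrite -!E //; move: a a4 => [|[|[|[|a]]]] //.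
Qed.

Lemma alt_sigma a : alt_form (sigma_plus e a).
Proof.
have A I : alt_form (eform e (k := 2) I) := alt_eform e I.
move: a => [|[|[|[|a]]]] /=; first exact: alt_zero.
- exact: alt_formB.
- exact: alt_formB (alt_formN (A _)) (A _).
- exact: alt_formD.
- exact: alt_zero.
Qed.

Lemma eq_forms_tb (a a' : kform (subvs_of r) 2) : alt_form a -> alt_form a' ->
  (forall p q, (0 < p < 5)%N -> (0 < q < 5)%N -> (p < q)%N ->
     a [tuple tb p; tb q] = a' [tuple tb p; tb q]) -> a =1 a'.
Proof.
move=> Ha Ha' E; apply: (alt_form_eq_basis (orth_frame_basis oB dD bD) Ha Ha').
move=> f sf; have Ef (h : kform (subvs_of r) 2) :
    h [tuple tnth (orth_frame br g e) (tnth f i) | i < 2] =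
    h [tuple tb (tnth f ord0).+1; tb (tnth f ord_max).+1].
  congr (h _); apply: eq_from_tnth => i; rewrite !tnth_mktuple [RHS](tnth_nth 0).
  by case: i => [[|[|?]] Hi] //; congr (tb (val (tnth f _)).+1); apply: val_inj.
have o (i : 'I_4) : (0 < i.+1 < 5)%N by apply/andP; split; last exact: (ltn_ord i).
rewrite !Ef; apply: E (o _) (o _) _; move: sf; rewrite !(tnth_nth ord0).
by case: f {Ef} => [[|x [|y [|? ?]]]] //= _; rewrite andbT.
Qed.

(** The condition says that the matrix of self-dual coordinates of the forms - de^(4+a) is scalar;
    since structure constants are the components of - de, it is - mu/3 times the identity. *)
Lemma self_dual_conditionP mu : self_dual_condition br g e mu <->
  (forall a m, (0 < a < 4)%N -> (0 < m < 4)%N -> xt c a m = xdiag (- (mu / 3)) a m).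
Proof.
have rk a : (0 < a < 4)%N -> rng (a + 4) by move: a => [|[|[|[|a]]]].
have S a p q := @sigma_tb a p q.
have H k p q p' q' s := @self_dual_tb k p q p' q' s.
have P k : rng k -> let d p q := self_dual_part gr vr (de k) [tuple tb p; tb q] in
  [/\ d 1%N 2%N = - (c 1 2 k + c 3 4 k) / 2, d 1%N 3%N = - (c 1 3 k - c 2 4 k) / 2,
      d 1%N 4%N = - (c 1 4 k + c 2 3 k) / 2, d 2%N 3%N = - (c 2 3 k + c 1 4 k) / 2 &
      d 2%N 4%N = - (c 2 4 k - c 1 3 k) / 2 /\ d 3%N 4%N = - (c 3 4 k + c 1 2 k) / 2].
  move=> rk' d; split; last split; rewrite /d.
  - by rewrite (H k _ _ 3%N 4%N false) ?expr0 ?mul1r.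
  - by rewrite (H k _ _ 2%N 4%N true) ?expr1 ?mulN1r.
  - by rewrite (H k _ _ 2%N 3%N false) ?expr0 ?mul1r.
  - by rewrite (H k _ _ 1%N 4%N false) ?expr0 ?mul1r.
  - by rewrite (H k _ _ 1%N 3%N true) ?expr1 ?mulN1r.
  - by rewrite (H k _ _ 1%N 2%N false) ?expr0 ?mul1r.
split=> [SD a m a4 m4|X r0 a a3 v].
  have {}SD p q : self_dual_part gr vr (de (a + 4)) [tuple tb p; tb q]
     = mu / 3 * restrictf (U := r) (sigma_plus e a) [tuple tb p; tb q].
    by apply: SD; move: a a4 => [|[|[|[|a]]]].
  have [] := P _ (rk _ a4); rewrite !SD !S // => s12 s13 s14 _ _.
  have k4 : (4 + a)%N = (a + 4)%N by rewrite addnC.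
  move: s12 s13 s14; rewrite /xt k4; move: (c) => t.
  move: a m a4 m4 {SD k4} => [|[|[|[|a]]]] [|[|[|[|m]]]] // _ _;
  ev_eps; cbv [xdiag]; rewrite ?mulr1z ?mulrN1z ?mulr0z => s12 s13 s14; lra.
rewrite -[LHS]/(self_dual_part gr vr (de (a + 4)) v).
move: v; apply: (@eq_forms_tb _ (fun v => mu / 3 * restrictf (U := r) (sigma_plus e a) v)).
- have grl x : scalar (gr x).
    by move=> t y z; rewrite /gr (linearP (vsval : {linear _ -> _})) dotDr dotZr.
  have grr x : scalar (gr^~ x).
    by move=> t y z; rewrite /gr (linearP (vsval : {linear _ -> _})) dotDl dotZl.
  have dimr : \dim {:subvs_of r} = (2 + 2)%N.
    by rewrite dimvf /= -[dim _]/(\dim r) (dim_orth oB dD bD).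
  have v1 : vr [tuple tb (nth 0%N [:: 1; 2; 3; 4]%N i) | i < 4] != 0.
    by rewrite vr_tb //; ev_eps; rewrite mulr1z oner_eq0.
  have vA : alt_form vr by apply/alt_restrictf/alt_eform.
  apply/alt_formZ/alt_formD; first exact: alt_de.
  exact: (alt_hodge (k := 2) (l := 2) grl grr dimr vA v1 (alt_de _)).
- by apply/alt_formZ/alt_restrictf/alt_sigma.
move=> p q p4 q4 pq; rewrite S //.
have [s12 s13 s14 s23 [s24 s34]] := P _ (rk _ a3).
have := X a 3%N a3 isT; have := X a 2%N a3 isT; have := X a 1%N a3 isT.
rewrite /xt (addnC 4 a).
move: p q p4 q4 pq => [|[|[|[|[|p]]]]] [|[|[|[|[|q]]]]] // _ _ _;
rewrite ?s12 ?s13 ?s14 ?s23 ?s24 ?s34; clear X P H S s12 s13 s14 s23 s24 s34;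
move: (c) => t;
move: a a3 => [|[|[|[|a]]]] // _; ev_eps; cbv [xdiag]; rewrite ?mulr1z ?mulrN1z ?mulr0z; lra.
Qed.

End SelfDual.

(** * The bracket relation for j in coordinates *)
Section JRelation.
Variables (R : rcfType) (V : vectType R) (br : {bilinear V -> V -> V}).
Variables (g : {dot V for idfun}) (phi : kform V 3) (e : 7.-tuple V).
Hypotheses (oB : orthonormal_basis g e) (phiE : phi =1 g2_model e).
Hypotheses (brC : forall x, br x x = 0) (nil : two_step_nilpotent br).
Hypotheses (dD : \dim (derivedv br) = 3%N).
Hypothesis bD : forall k, k \in [:: 5; 6; 7]%N -> bv e k \in derivedv br.

Notation b := (bv e).
Notation c := (cst br g e).
Notation r := (orth_derivedv br g).
Notation d := (derivedv br).
Let phi_alt : alt_form phi := alt_g2_model phiE.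

Variables (j : subvs_of d -> 'End(subvs_of r)) (tau : subvs_of d -> 'End(subvs_of d)).
Hypotheses (jE : is_j j) (tauE : is_tau phi g tau).
Variables (rho : R) (y : nat -> nat -> R).
Hypothesis cE : eq_rng c (ccal (xdiag rho) y).

(** The bilinear form of j(z) j(z') on the orthogonal complement of the commutator, see [jjE],
    written without j: it is then defined, and multilinear, on the whole Lie algebra. *)
Definition jj (z z' x w : V) : R :=
  \sum_(m <- iota 1 4) g z' (br x (b m)) * g z (br (b m) w).
Definition jF (z z' x w : V) : R :=
  jj z z' x w - jj z' z x w + 2 * rho * phi [tuple z; z'; br x w].

Lemma jjE (z z' : subvs_of d) (x w : subvs_of r) :
  g (vsval (j z (j z' x))) (vsval w) = jj (vsval z) (vsval z') (vsval x) (vsval w).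
Proof.
rewrite jE (orth_proj oB bD (subvsP (j z' x))).
rewrite linear_sumlz dot_sumr /jj; apply: eq_big_seq => m mI.
rewrite linearZl_LR dotZr; congr (_ * _).
by rewrite -(tbE oB dD bD (k := m)) -?jE //; move: mI; rewrite mem_iota.
Qed.

Lemma jrel_jF : (forall z z' : subvs_of d,
    ((j z \o j z') - (j z' \o j z))%VF = (2 / 3 * (- 3 * rho)) *: j (tau z z')) <->
  (forall z z' x w, z \in d -> z' \in d -> x \in r -> w \in r -> jF z z' x w = 0).
Proof.
have K (z z' : subvs_of d) (x w : subvs_of r) :
    g (vsval ((((j z \o j z') - (j z' \o j z))%VF
       - (2 / 3 * (- 3 * rho)) *: j (tau z z')) x)) (vsval w)
    = jF (vsval z) (vsval z') (vsval x) (vsval w).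
  rewrite !(add_lfunE, opp_lfunE, scale_lfunE, comp_lfunE).
  rewrite !(linearB (vsval : {linear _ -> _})) (linearZ_LR (vsval : {linear _ -> _})).
  rewrite !dotBl dotZl !jjE jE /jF.
  have brD : br (vsval x) (vsval w) = vsval (vsproj d (br (vsval x) (vsval w))).
    by rewrite vsprojK // br_derived.
  by rewrite {1}brD tauE -brD; field; rewrite ?pnatr_eq0.
split=> [H z z' x w zd zd' xr wr|H z z'].
  by rewrite -(vsprojK zd) -(vsprojK zd') -(vsprojK xr) -(vsprojK wr) -K H subrr
     zero_lfunE (linear0 (vsval : {linear _ -> _})) dot0l.
apply/eqP; rewrite -subr_eq0; apply/eqP/lfunP => x; rewrite [RHS]lfunE /=.
set u := (LHS in LHS = _); apply: val_inj; apply/eqP/negPn/negP => /(dot_gt0 g).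
by rewrite K H ?subvsP // ltxx.
Qed.

Lemma jj_linear1 z' x w : scalar (fun z => jj z z' x w).
Proof.
move=> t u v; rewrite /jj mulr_sumr -big_split; apply: eq_bigr => m _ /=.
by rewrite dotDl dotZl; ring.
Qed.

Lemma jj_linear2 z x w : scalar (fun z' => jj z z' x w).
Proof.
move=> t u v; rewrite /jj mulr_sumr -big_split; apply: eq_bigr => m _ /=.
by rewrite dotDl dotZl; ring.
Qed.

Lemma jj_linear3 z z' w : scalar (fun x => jj z z' x w).
Proof.
move=> t u v; rewrite /jj mulr_sumr -big_split; apply: eq_bigr => m _ /=.
by rewrite linearPl dotDr dotZr; ring.
Qed.

Lemma jj_linear4 z z' x : scalar (jj z z' x).
Proof.
move=> t u v; rewrite /jj mulr_sumr -big_split; apply: eq_bigr => m _ /=.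
by rewrite linearPr dotDr dotZr; ring.
Qed.

Lemma jF_basis : 
  (forall z z' x w, z \in d -> z' \in d -> x \in r -> w \in r -> jF z z' x w = 0) <->
  (forall p q u v, p \in [:: 5; 6; 7]%N -> q \in [:: 5; 6; 7]%N ->
     (0 < u <= 4)%N -> (0 < v <= 4)%N -> jF (b p) (b q) (b u) (b v) = 0).
Proof.
have b4 k : (0 < k <= 4)%N -> b k \in r.
  by move=> k4; apply: b_orth oB dD bD _ _; move: k k4 => [|[|[|[|[|k]]]]].
split=> [H p q u v p3 q3 u4 v4|H z z' x w zd zd' xr wr].
  by apply: H; rewrite ?bD ?b4.
move: zd zd' xr wr; rewrite -(span_basis (derived_basis oB dD bD)).
rewrite -(span_basis (orth_basis oB dD bD)) => zd zd' xr wr.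
have i4 k : k \in [:: 1; 2; 3; 4]%N -> (0 < k <= 4)%N by move: k => [|[|[|[|[|k]]]]].
apply: (span_zero (f := fun z => jF z z' x w) _ _ zd) => [t u v|_ /mapP[p p3 ->]].
  by rewrite /jF (alt3_lin1 phi_alt) jj_linear1 jj_linear2; ring.
apply: (span_zero (f := fun z' => jF (b p) z' x w) _ _ zd') => [t u v|_ /mapP[q q3 ->]].
  by rewrite /jF (alt3_lin2 phi_alt) jj_linear1 jj_linear2; ring.
apply: (span_zero (f := fun x => jF (b p) (b q) x w) _ _ xr) => [t u v|_ /mapP[k k3 ->]].
  by rewrite /jF linearPl (alt3_lin3 phi_alt) !jj_linear3; ring.
apply: (span_zero (f := jF (b p) (b q) (b k)) _ _ wr) => [t u v|_ /mapP[l l3 ->]].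
  by rewrite /jF linearPr (alt3_lin3 phi_alt) !jj_linear4; ring.
by apply: H => //; apply: i4.
Qed.

(** By multilinearity it is enough to compare both sides on basis vectors, and by antisymmetry on
    the three pairs of vectors e_5, e_6, e_7. *)
Lemma j_relationP : (forall z z' : subvs_of d,
    ((j z \o j z') - (j z' \o j z))%VF = (2 / 3 * (- 3 * rho)) *: j (tau z z')) <->
  (forall u v, (0 < u <= 4)%N -> (0 < v <= 4)%N ->
    [/\ jrel rho y 6 7 5 u v = 0, jrel rho y 7 5 6 u v = 0 & jrel rho y 5 6 7 u v = 0]).
Proof.
rewrite jrel_jF jF_basis.
have rI k : k \in [:: 5; 6; 7]%N -> rng k by move: k => [|[|[|[|[|[|[|[|k]]]]]]]].
have r4 k : (0 < k <= 4)%N -> rng k by move: k => [|[|[|[|[|k]]]]].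
pose t := ccal (xdiag rho) y.
have P p q u v : p \in [:: 5; 6; 7]%N -> q \in [:: 5; 6; 7]%N ->
    (0 < u <= 4)%N -> (0 < v <= 4)%N ->
    phi [tuple b p; b q; br (b u) (b v)] = \sum_(k <- [:: 5; 6; 7]%N) t u v k * fstd R p q k.
  move=> p3 q3 u4 v4.
  pose h : {scalar V} := HB.pack (fun z => phi [tuple b p; b q; z])
    (GRing.isLinear.Build _ _ _ _ _ (alt3_lin3 phi_alt (b p) (b q))).
  rewrite -[LHS]/(h _) (bv_expand oB (br _ _)) linear_sum.
  have -> : \sum_(m <- iota 1 7) h (g (br (b u) (b v)) (b m) *: b m)
      = \sum_(m <- iota 1 7) t u v m * fstd R p q m.
    apply: eq_big_seq => m; rewrite -rng_iota => rm.
    have -> : h (g (br (b u) (b v)) (b m) *: b m) = c u v m * phc phi e p q m.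
      exact: linearZ_LR.
    by rewrite (cE (r4 u u4) (r4 v v4) rm) (phc_std oB phiE (rI p p3) (rI q q3) rm).
  rewrite (iotaD 1 4 3) big_cat /= big1_seq ?add0r // => m /andP[_ m4].
  rewrite /t /ccal /alt2 /ccal_sorted.
  by move: m m4 => [|[|[|[|[|m]]]]] // _; rewrite oppr0; case: (Nat.compare _ _); rewrite mul0r.
have J p q u v : p \in [:: 5; 6; 7]%N -> q \in [:: 5; 6; 7]%N ->
    (0 < u <= 4)%N -> (0 < v <= 4)%N ->
    jj (b p) (b q) (b u) (b v) = - \sum_(m <- iota 1 4) t u m q * t v m p.
  move=> p3 q3 u4 v4; rewrite -sumrN; apply: eq_big_seq => m m4.
  have rm : rng m by apply: r4; rewrite mem_iota in m4.
  rewrite ![g (b _) _]dotC -[g _ _]/(c u m q) -[g (br _ _) (b p)]/(c m v p).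
  rewrite (cst_anti g e brC v m p) (cE (r4 u u4) rm (rI q q3)).
  by rewrite (cE (r4 v v4) rm (rI p p3)) mulrN.
have F p q u v : p \in [:: 5; 6; 7]%N -> q \in [:: 5; 6; 7]%N ->
    (0 < u <= 4)%N -> (0 < v <= 4)%N -> jF (b p) (b q) (b u) (b v) =
    \sum_(m <- iota 1 4) (t u m p * t v m q - t u m q * t v m p)
    + 2 * rho * \sum_(k <- [:: 5; 6; 7]%N) t u v k * fstd R p q k.
  move=> p3 q3 u4 v4; rewrite /jF P // !J // sumrB; congr (_ + _).
  by rewrite opprK addrC.
split=> [H u v u4 v4|H p q u v p3 q3 u4 v4].
  split; [have := H 6%N 7%N u v isT isT u4 v4 | have := H 7%N 5%N u v isT isT u4 v4
    | have := H 5%N 6%N u v isT isT u4 v4]; rewrite F // !big_cons !big_nil;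
  cbv [fstd fstd_sorted alt3 Nat.compare] => E; rewrite -[RHS]E /jrel -/t; ring.
rewrite F // !big_cons !big_nil; have [] := H u v u4 v4; rewrite /jrel -/t.
have i3 k : k \in [:: 5; 6; 7]%N -> [\/ k = 5%N, k = 6%N | k = 7%N].
  by rewrite !inE => /or3P[] /eqP ->; [exact: Or31|exact: Or32|exact: Or33].
move=> E1 E2 E3.
by case: (i3 p p3) => ->; case: (i3 q q3) => ->; cbv [fstd fstd_sorted alt3 Nat.compare]; lra.
Qed.

End JRelation.

(** * The choice of the basis and the proof of the theorem *)
Section Main.
Variables (R : rcfType) (V : vectType R) (br : {bilinear V -> V -> V}).
Variables (phi : kform V 3) (g : {dot V for idfun}) (vol : kform V 7).
Variables (lambda : R) (D : {bilinear V -> V -> V}) (Dl : V -> V -> V).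
Hypotheses (brC : forall x, br x x = 0) (nil : two_step_nilpotent br).
Hypotheses (dimV : \dim {:V} = 7%N) (phi_g2 : g2_structure phi) (gphi : g2_metric phi g vol).
Hypotheses (cc : coclosed br phi g vol) (lcD : levi_civita br g D)
  (lDl : lambda_connection br phi g vol lambda D Dl).

Notation d := (derivedv br).

Lemma vol_adapted e : orthonormal_basis g e -> phi =1 g2_model e ->
  alt_form vol /\ vol e = 1.
Proof.
by move=> oB phiE; have [_ ? ?] := g2_basis_orthonormal (proj1 oB) phiE gphi.
Qed.

Lemma orthonormal_pair : (1 < \dim d)%N ->
  exists u v, [/\ u \in d, v \in d, g u u = 1, g v v = 1 & g u v = 0].
Proof.
move=> d2; have [|u [ud uu _]] := @unit_perp _ _ g d [::]; first exact: ltnW d2.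
have [|v [vd vv vu]] := @unit_perp _ _ g d [:: u]; first exact: d2.
exists u, v; split=> //; rewrite dotC; apply: vu; exact: mem_head.
Qed.

(** For a commutator <e_5, e_6> the vector e_7 is central and orthogonal to the commutator, so that
    de^7 = 0 and the scalar matrix r id of self-dual coordinates vanishes. *)
Lemma instanton_dim2 : \dim d = 2%N -> ~ g2_instanton br phi g vol Dl.
Proof.
move=> d2 inst; have [|u [v [ud vd uu vv uv]]] := orthonormal_pair; first by rewrite d2.
have [e0 e0B phi0] := phi_g2; have [oB0 _ _] := g2_basis_orthonormal e0B phi0 gphi.
pose w := cross e0 phi u v.
have [|x [_ xx xo]] := @unit_perp _ _ g {:V} [:: u; v; w]; first by rewrite dimV.
have xu : g u x = 0 by rewrite dotC xo ?inE ?eqxx.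
have xv : g v x = 0 by rewrite dotC xo ?inE ?eqxx ?orbT.
have xw : g w x = 0 by rewrite dotC xo ?inE ?eqxx ?orbT.
have [e [oB phiE [b5 b6 b7 b1]]] := adapted_basis oB0 phi0 uu vv xx uv xu xv xw.
have [vol_alt vol1] := vol_adapted oB phiE.
rewrite -b5 in ud; rewrite -b6 in vd.
have [cE c7] := cst_dim2 oB phiE vol_alt vol1 brC nil ud vd cc d2.
have [|_ [r [y [r0 rE]]]] := cal_instanton oB phiE vol_alt vol1 brC nil cc cE lcD lDl _ inst.
  by rewrite d2.
have E1 := rE 1%N 2%N 7%N isT isT isT; have E2 := rE 3%N 4%N 7%N isT isT isT.
rewrite c7 // in E1; rewrite c7 // in E2; move: E1 E2.
cbv [ccal ccal_sorted alt2 sdasd xs xdiag idx Nat.compare] => E1 E2.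
by case/eqP: r0; lra.
Qed.

(** Let u, v, f be an orthonormal basis of the commutator, w = u x v and C = phi(u, v, f). Either
    f = C w, and the commutator is spanned by u, v and u x v, or f - C w has a direction x with
    which u and v can be completed to an adapted basis, and f = C w + Z x with Z <> 0. *)
Lemma instanton_frame : \dim d = 3%N -> g2_instanton br phi g vol Dl ->
  lambda = 1 /\ exists e r y, [/\ orthonormal_basis g e, phi =1 g2_model e,
    forall k, k \in [:: 5; 6; 7]%N -> bv e k \in d, r != 0 &
    eq_rng (cst br g e) (ccal (xdiag r) y)].
Proof.
move=> d3 inst; have [|u [v [ud vd uu vv uv]]] := orthonormal_pair; first by rewrite d3.
have [e0 e0B phi0] := phi_g2; have [oB0 _ _] := g2_basis_orthonormal e0B phi0 gphi.
pose w := cross e0 phi u v.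
have uw : g w u = 0 := cross_dotl oB0 phi0 u v.
have vw : g w v = 0 := cross_dotr oB0 phi0 u v.
have ww : g w w = 1 by rewrite (cross_norm oB0 phi0) uu vv uv mul1r mul0r subr0.
have [|f [fd ff fs]] := @unit_perp _ _ g d [:: u; v]; first by rewrite d3.
have fu : g f u = 0 by apply: fs; rewrite !inE eqxx.
have fv : g f v = 0 by apply: fs; rewrite !inE eqxx orbT.
pose C := g f w; pose f' := f - C *: w.
have f'f' : g f' f' = 1 - C ^+ 2.
  by rewrite /f' dotBl !dotBr !dotZl !dotZr ff ww (dotC g w f) -/C; ring.
have f'u : g f' u = 0 by rewrite /f' dotBl dotZl fu uw mulr0 subr0.
have f'v : g f' v = 0 by rewrite /f' dotBl dotZl fv vw mulr0 subr0.
have f'w : g f' w = 0 by rewrite /f' dotBl dotZl ww mulr1 subrr.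
have [f'0|f'0] := eqVneq f' 0.
- have [|x [_ xx xo]] := @unit_perp _ _ g {:V} [:: u; v; w]; first by rewrite dimV.
  have xu : g u x = 0 by rewrite dotC xo ?inE ?eqxx.
  have xv : g v x = 0 by rewrite dotC xo ?inE ?eqxx ?orbT.
  have xw : g w x = 0 by rewrite dotC xo ?inE ?eqxx ?orbT.
  have [e [oB phiE [b5 b6 b7 b1]]] := adapted_basis oB0 phi0 uu vv xx uv xu xv xw.
  have [vol_alt vol1] := vol_adapted oB phiE.
  have C0 : C != 0.
    apply/eqP => C0; move: f'f'; rewrite f'0 dot0l C0 expr0n subr0 => /eqP.
    by rewrite eq_sym oner_eq0.
  have wd : w \in d.
    have -> : w = C^-1 *: f.
      by rewrite -[f](subrK (C *: w)) -/f' f'0 add0r scalerA mulVf // scale1r.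
    exact: memvZ.
  have bD k : k \in [:: 5; 6; 7]%N -> bv e k \in d.
    by rewrite !inE => /or3P[] /eqP ->; rewrite ?b5 ?b6 ?b7.
  have cE := cst_dim3 oB brC nil (bD 5%N isT) (bD 6%N isT) d3 (bD 7%N isT).
  have [|-> [r [y [r0 rE]]]] :=
    cal_instanton oB phiE vol_alt vol1 brC nil cc cE lcD lDl _ inst; first by rewrite d3.
  by split=> //; exists e, r, y.
exfalso.
have q0 : 0 < 1 - C ^+ 2 by rewrite -f'f'; apply: dot_gt0.
pose Z := Num.sqrt (1 - C ^+ 2); have Z0 : Z != 0 by rewrite sqrtr_eq0 -ltNge.
have Z2 : Z ^+ 2 = 1 - C ^+ 2 by rewrite sqr_sqrtr // ltW.
pose x := Z^-1 *: f'.
have xx : g x x = 1 by rewrite dotZl dotZr f'f' -Z2 mulrA -expr2 exprVn mulVf ?expf_neq0.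
have xp z : g f' z = 0 -> g z x = 0 by move=> E; rewrite dotC dotZl E mulr0.
have [e [oB phiE [b5 b6 b7 b1]]] :=
  adapted_basis oB0 phi0 uu vv xx uv (xp _ f'u) (xp _ f'v) (xp _ f'w).
have [vol_alt vol1] := vol_adapted oB phiE.
have CZ : C ^+ 2 + Z ^+ 2 = 1 by rewrite Z2 addrC subrK.
rewrite -b5 in ud; rewrite -b6 in vd.
have fE : rot7 e C Z \in d.
  rewrite /rot7 b1 b7 /x scalerA divff // scale1r.
  by rewrite -/w /f' subrK.
exact: (rot_frame_not_instanton oB phiE vol_alt vol1 CZ brC nil Z0 ud vd fE d3 cc lcD lDl inst).
Qed.

End Main.

Lemma xt_diag (R : rcfType) (c : nat -> nat -> nat -> R) r y a m :
  eq_rng c (ccal (xdiag r) y) -> (0 < a < 4)%N -> (0 < m < 4)%N -> xt c a m = xdiag r a m.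
Proof.
move=> cE; move: a m => [|[|[|[|a]]]] [|[|[|[|m]]]] // _ _; rewrite /xt !cE //;
cbv [addn Nat.add ccal ccal_sorted alt2 sdasd xs xdiag idx Nat.compare]; lra.
Qed.

Theorem proposition4p5 (R : realType) (V : vectType R)
    (br : {bilinear V -> V -> V})
    (phi : kform V 3) (g : {dot V for idfun}) (vol : kform V 7)
    (lambda : R) (D : {bilinear V -> V -> V}) (Dl : V -> V -> V)
    (j : subvs_of (derivedv br) -> 'End(subvs_of (orth_derivedv br g)))
    (tau : subvs_of (derivedv br) -> 'End(subvs_of (derivedv br))) :
  \dim {:V} = 7%N ->
  lie_bracket br ->
  two_step_nilpotent br ->
  \dim (derivedv br) = 2%N \/ \dim (derivedv br) = 3%N ->
  g2_structure phi ->
  g2_metric phi g vol ->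
  coclosed br phi g vol ->
  levi_civita br g D ->
  lambda_connection br phi g vol lambda D Dl ->
  is_j j ->
  is_tau phi g tau ->
  g2_instanton br phi g vol Dl <->
  \dim (derivedv br) = 3%N /\
  lambda = 1 /\
  exists mu : R,
    [/\ mu != 0,
        exists e : 7.-tuple V,
          [/\ orthonormal_basis g e,
              derivedv br = <<[:: e`_4; e`_5; e`_6]>>%VS,
              phi =1 g2_model e
            & self_dual_condition br g e mu]
      & forall z z' : subvs_of (derivedv br),
          ((j z \o j z') - (j z' \o j z))%VF = (2 / 3 * mu) *: j (tau z z')].
Proof.
move=> dimV [brC _] nil dim23 phi_g2 gphi cc lcD lDl jE tauE; split=> [inst|].
  case: dim23 => [d2|d3].
    by case: (instanton_dim2 brC nil dimV phi_g2 gphi cc lcD lDl d2 inst).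
  have [lE [e [r [y [oB phiE bD r0 rE]]]]] :=
    instanton_frame brC nil dimV phi_g2 gphi cc lcD lDl d3 inst.
  have [vol_alt vol1] := vol_adapted gphi oB phiE.
  split=> //; split=> //; exists (- 3 * r); split.
  - by rewrite mulf_neq0 // oppr_eq0 pnatr_eq0.
  - exists e; split=> //; first by rewrite -(span_basis (derived_basis oB d3 bD)).
    apply/(self_dual_conditionP oB brC d3 bD) => a m a4 m4.
    rewrite (_ : - (- 3 * r / 3) = r); last by field; rewrite ?pnatr_eq0.
    exact: xt_diag rE a4 m4.
  apply/(j_relationP oB phiE brC d3 bD jE tauE rE).
  exact: (diag_instanton oB phiE vol_alt vol1 brC lcD lDl lE rE).1 inst.
move=> [d3 [lE [mu [mu0 [e [oB dE phiE SD]] J]]]].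
have [vol_alt vol1] := vol_adapted gphi oB phiE.
have bD k : k \in [:: 5; 6; 7]%N -> bv e k \in derivedv br.
  by rewrite dE !inE => /or3P[] /eqP ->; apply: memv_span; rewrite !inE eqxx ?orbT.
have cE := cst_dim3 oB brC nil (bD 5%N isT) (bD 6%N isT) d3 (bD 7%N isT).
move/(self_dual_conditionP oB brC d3 bD): SD; set r := - (mu / 3) => SD.
have rE : eq_rng (cst br g e) (ccal (xdiag r) (yt (cst br g e))).
  move=> i p k ri rp rk; rewrite (cst_ccal oB phiE vol_alt vol1 cc cE) //.
  move: i p k ri rp rk; apply: ccal_ext => a m.
  by move: a m => [|[|[|[|a]]]] [|[|[|[|m]]]] // _ _; rewrite /xs !SD.
have muE : mu = - 3 * r by rewrite /r; field; rewrite ?pnatr_eq0.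
rewrite muE in J; have := (j_relationP oB phiE brC d3 bD jE tauE rE).1 J.
exact: (diag_instanton oB phiE vol_alt vol1 brC lcD lDl lE rE).2.
Qed.
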